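(* Let $T$ be a filling of the shape $\lambda$ by nonnegative integers, weakly increasing from left to right along each row and from bottom to top along each column. Then the subspace of antisymmetric polynomials in $\mathcal M_T$ (those $f\in\mathcal M_T$ with $f\mathbf T_i=-f$ for all $1\le i\le N-1$) is one-dimensional if $T$ is row-strict (strictly increasing from left to right in each row), and is $\{0\}$ otherwise.
   Context: $N\ge2$, $q,s$ indeterminates, $K=\mathbb C(q,s)$. Operators act on the right, composed left to right. $\mathcal H_N(s)$ is generated by $T_1,\dots,T_{N-1}$ with $(T_i+1)(T_i-s)=0$ and braid relations. $\lambda$ a partition of $N$ (French convention, rows numbered bottom to top); $\mathrm{Tab}_\lambda$ = reverse standard tableaux (bijective fillings by $1,\dots,N$ strictly decreasing left to right in rows and bottom to top in columns); $\mathrm{CT}_{\mathbb T}[i]$ = column minus row of the cell of $i$; $\mathbb T^{(i,j)}$ exchanges $i,j$. $V_\lambda$ has basis $\mathrm{Tab}_\lambda$, right action $\mathbb TT_i=s\mathbb T$ if $i,i+1$ share a row, $-\mathbb T$ if they share a column, and if $i$ is in a higher row than $i+1$, with $m=\mathrm{CT}_{\mathbb T}[i+1]-\mathrm{CT}_{\mathbb T}[i]>0$, $\mathbb TT_i=\frac{s-1}{1-s^m}\mathbb T+\frac{s(1-s^{m+1})(1-s^{m-1})}{(1-s^m)^2}\mathbb T^{(i,i+1)}$; remaining case determined by this formula for $\mathbb T^{(i,i+1)}$ and the quadratic relation. $\mathcal M_\lambda=K[x_1,\dots,x_N]\otimes V_\lambda$; $(p\otimes u)\mathbf T_i=(1-s)\frac{x_{i+1}(p-p^{s_i})}{x_i-x_{i+1}}\otimes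 u+p^{s_i}\otimes uT_i$ ($p^{s_i}$: $x_i,x_{i+1}$ exchanged), $(p\otimes u)\mathbf w=p(qx_N,x_1,\dots,x_{N-1})\otimes uT_1\cdots T_{N-1}$, $\mathbf T_i^{-1}=s^{-1}(\mathbf T_i+1-s)$, $\Xi_i=s^{i-N}\mathbf T_{i-1}^{-1}\cdots\mathbf T_1^{-1}\mathbf w\mathbf T_{N-1}\cdots\mathbf T_i$. For $v\in\mathbb N_0^N$, $r_v[i]=\#\{j\le i:v_j\ge v_i\}+\#\{j>i:v_j>v_i\}$; $P_{v,\mathbb T}$ is the vector-valued nonsymmetric Macdonald polynomial, the simultaneous eigenfunction of the $\Xi_i$ with $P_{v,\mathbb T}\Xi_i=q^{v_i}s^{\mathrm{CT}_{\mathbb T}[r_v[i]]}P_{v,\mathbb T}$; these form a basis of $\mathcal M_\lambda$. For $v\in\mathbb N_0^N$ let $v^+$ be its decreasing rearrangement and, for $\mathbb T\in\mathrm{Tab}_\lambda$, let $T(\mathbb T,v)$ be the filling obtained by replacing each entry $i$ of $\mathbb T$ by $v^+_i$. For a filling $T$ as in the claim, $\mathcal M_T:=\mathrm{span}_K\{P_{v,\mathbb T}:\ \mathbb T\in\mathrm{Tab}_\lambda,\ v\in\mathbb N_0^N,\ T(\mathbb T,v)=T\}$. *)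

(* Defs.v *)
From HB Require Import structures.
From mathcomp Require Import ssreflect ssrfun ssrbool eqtype ssrnat seq choice fintype finfun bigop finset path order.
From mathcomp Require Import ssralg ssrnum ssrint poly fraction fingroup perm.
From mathcomp Require Import Rstruct complex.
From mathcomp Require Import mpoly.

Set Implicit Arguments.
Unset Strict Implicit.
Unset Printing Implicit Defensive.

Import GRing.Theory Num.Theory.
Local Open Scope ring_scope.

Definition CC : fieldType := complex Rdefinitions.R.
Definition KK : fieldType := {fraction {poly {poly CC}}}.
Definition qq : KK := FracField.tofrac ((('X : {poly CC})%:P) : {poly {poly CC}}).
Definition ss : KK := FracField.tofrac ('X : {poly {poly CC}}).

(* Conventions: everything is 0-based.  Entries of tableaux 1..N of the     *)
(* paper are 0..N-1 here; cells are (row, col) with row 0 the bottom row    *)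
(* (French convention) and col 0 the leftmost column; variable x_k of the   *)
(* paper is 'X_(k-1); the generator T_k of the paper (1 <= k <= N-1) is     *)
(* [heckeM (k-1)], exchanging (0-based) entries/variables k-1 and k; and    *)
(* Xi_k of the paper (1 <= k <= N) is [Xi (k-1)].                           *)

Definition is_partition (N : nat) (la : seq nat) : bool :=
  [&& sorted geq la, all (fun x => 0 < x)%N la & sumn la == N].

Definition is_cell (la : seq nat) (r c : nat) : bool :=
  (r < size la)%N && (c < nth 0%N la r)%N.

Section Tableaux.
Variables (N : nat) (la : seq nat).

(* a filling by 1..N (0-based: entry i : 'I_N sits in cell f i = (row, col)) *)
Definition tabb (f : {ffun 'I_N -> 'I_N * 'I_N}) : bool :=
  [&& injectiveb f,
      [forall i, is_cell la (f i).1 (f i).2],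
      [forall i, forall j,
         (((f i).1 == (f j).1) && ((f i).2 < (f j).2)%N) ==> (j < i)%N] &
      [forall i, forall j,
         (((f i).2 == (f j).2) && ((f i).1 < (f j).1)%N) ==> (j < i)%N]].

Definition Tab := {f : {ffun 'I_N -> 'I_N * 'I_N} | tabb f}.
HB.instance Definition _ := Finite.on Tab.

Definition cellT (t : Tab) (a : nat) : nat * nat :=
  if insub a is Some o then (nat_of_ord ((val t) o).1, nat_of_ord ((val t) o).2)
  else (0%N, 0%N).
Definition rowT (t : Tab) (a : nat) : nat := (cellT t a).1.
Definition colT (t : Tab) (a : nat) : nat := (cellT t a).2.

Definition CT (t : Tab) (a : nat) : int := (colT t a)%:Z - (rowT t a)%:Z.

Definition atT (t : Tab) (b : nat) (d : 'I_N * 'I_N) : 'I_N * 'I_N :=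
  if insub b is Some o then (val t) o else d.
Definition swapF (t : Tab) (a b : nat) : {ffun 'I_N -> 'I_N * 'I_N} :=
  [ffun k : 'I_N => if nat_of_ord k == a then atT t b ((val t) k)
                    else if nat_of_ord k == b then atT t a ((val t) k)
                    else (val t) k].
Definition swapT (t : Tab) (a b : nat) : option Tab := insub (swapF t a b).

(* The representation V_la, with basis Tab; vectors are coordinate vectors *)
Local Notation Vect := {ffun Tab -> KK^o}.
Definition delta (t : Tab) : Vect := [ffun u => (u == t)%:R].
Definition deltaO (o : option Tab) : Vect :=
  if o is Some u then delta u else 0.

Definition coefA (m : int) : KK := (ss - 1) / (1 - ss ^ m).
Definition coefB (m : int) : KK :=
  ss * (1 - ss ^ (m + 1)) * (1 - ss ^ (m - 1)) / (1 - ss ^ m) ^+ 2.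

(* image of the basis vector t under T_{i+1} (paper numbering) *)
Definition heckeB (i : nat) (t : Tab) : Vect :=
  if rowT t i == rowT t i.+1 then ss *: delta t
  else if colT t i == colT t i.+1 then - delta t
  else if (rowT t i.+1 < rowT t i)%N then
    let m := CT t i.+1 - CT t i in
    coefA m *: delta t + coefB m *: deltaO (swapT t i i.+1)
  else
    (* remaining case: determined by the formula for t' = t^{(i,i+1)},  *)
    (* t' T = a t' + b t, and the quadratic relation T^2 = (s-1) T + s:  *)
    (* t T = ((s-1) - a) t + ((s + (s-1) a - a^2) / b) t'               *)
    let m := CT t i - CT t i.+1 in
    ((ss - 1) - coefA m) *: delta t
    + ((ss + (ss - 1) * coefA m - coefA m ^+ 2) / coefB m)
        *: deltaO (swapT t i i.+1).

Definition heckeV (i : nat) (v : Vect) : Vect := \sum_(t : Tab) v t *: heckeB i t.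

Definition Xn (a : nat) : {mpoly KK[N]} := if insub a is Some o then 'X_o else 0.
Definition mexp (m : 'X_{1..N}) (a : nat) : nat :=
  if insub a is Some o then m o else 0%N.

Definition swapP (i : nat) (p : {mpoly KK[N]}) : {mpoly KK[N]} :=
  mmap (@mpolyC N KK)
    (fun j : 'I_N => if nat_of_ord j == i then Xn i.+1
                     else if nat_of_ord j == i.+1 then Xn i else 'X_j) p.

Definition setm (i : nat) (m : 'X_{1..N}) (e1 e2 : nat) : 'X_{1..N} :=
  [multinom (if nat_of_ord j == i then e1 else if nat_of_ord j == i.+1 then e2
             else m j) | j < N].

(* (x^m - (x^m)^{s})/(x_i - x_{i+1}) for a monomial x^m (exact division) *)
Definition ddmon (i : nat) (m : 'X_{1..N}) : {mpoly KK[N]} :=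
  let a := mexp m i in let b := mexp m i.+1 in
  let c := minn a b in let d := (maxn a b - c)%N in
  (if (b <= a)%N then 1 else -1) *
    \sum_(k < d) 'X_[setm i m (c + k) (c + (d.-1 - k))].

(* divided difference (p - p^{s_{i+1}})/(x_i - x_{i+1}) (0-based variables) *)
Definition dd (i : nat) (p : {mpoly KK[N]}) : {mpoly KK[N]} :=
  \sum_(m <- msupp p) p@_m *: ddmon i m.

(* The module M_la = K[x] (x) V_la : f = sum_t f(t) (x) t *)
Local Notation Mod := {ffun Tab -> {mpoly KK[N]}}.

Definition heckeM (i : nat) (f : Mod) : Mod :=
  [ffun u => (1 - ss) *: (Xn i.+1 * dd i (f u))
             + \sum_(t : Tab) heckeB i t u *: swapP i (f t)].

Definition heckeMinv (i : nat) (f : Mod) : Mod :=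
  ss^-1 *: (heckeM i f + (1 - ss) *: f).

Definition wP (p : {mpoly KK[N]}) : {mpoly KK[N]} :=
  mmap (@mpolyC N KK)
    (fun j : 'I_N => if nat_of_ord j == 0%N then qq *: Xn N.-1
                     else Xn (nat_of_ord j).-1) p.

(* u T_1 T_2 ... T_{N-1} (operators act on the right, composed left to right) *)
Definition wB (t : Tab) : Vect := foldl (fun v k => heckeV k v) (delta t) (iota 0 N.-1).

Definition wM (f : Mod) : Mod :=
  [ffun u => \sum_(t : Tab) wB t u *: wP (f t)].

(* Xi_{i+1} = s^{(i+1)-N} T_i^{-1} ... T_1^{-1} w T_{N-1} ... T_{i+1}        *)
(* (paper numbering; applied from left to right)                            *)
Definition Xi (i : nat) (f : Mod) : Mod :=
  ss ^ ((i.+1)%:Z - N%:Z) *: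
    foldl (fun g k => heckeM k g)
      (wM (foldl (fun g k => heckeMinv k g) f (rev (iota 0 i))))
      (rev (iota i (N.-1 - i))).

(* r_v[i] (paper, 1-based) ; here returned 0-based: r_v[i+1] - 1 *)
Definition rv (v : {ffun 'I_N -> nat}) (i : 'I_N) : nat :=
  (#|[set j : 'I_N | (j <= i)%N && (v i <= v j)%N]|
   + #|[set j : 'I_N | (i < j)%N && (v i < v j)%N]|).-1.

(* f is a simultaneous eigenfunction of the Xi's with the eigenvalues of    *)
(* P_{v,t}:  f Xi_i = q^{v_i} s^{CT_t[r_v[i]]} f                            *)
Definition eigenP (v : {ffun 'I_N -> nat}) (t : Tab) (f : Mod) : Prop :=
  forall i : 'I_N, Xi i f = (qq ^+ v i * ss ^ CT t (rv v i)) *: f.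

Definition vplus (v : {ffun 'I_N -> nat}) (a : nat) : nat :=
  nth 0%N (sort geq [seq v j | j <- enum 'I_N]) a.

(* fillings of shape la: functions row -> col -> value (only cells matter) *)
Definition fill_eq (t : Tab) (v : {ffun 'I_N -> nat}) (T : nat -> nat -> nat) : Prop :=
  forall a : 'I_N, T (rowT t a) (colT t a) = vplus v a.

(* f belongs to M_T : a finite sum of vectors in the lines K P_{v,t} with  *)
(* T(t, v) = T                                                              *)
Definition inMT (T : nat -> nat -> nat) (f : Mod) : Prop :=
  exists l : seq ({ffun 'I_N -> nat} * Tab * Mod),
    (forall x, List.In x l -> fill_eq x.1.2 x.1.1 T /\ eigenP x.1.1 x.1.2 x.2)
    /\ f = \sum_(x <- l) x.2.

Definition antisym (f : Mod) : Prop :=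
  forall i : nat, (i.+1 < N)%N -> heckeM i f = - f.

End Tableaux.

Definition weakly_increasing (la : seq nat) (T : nat -> nat -> nat) : Prop :=
  (forall r c c', (c <= c')%N -> is_cell la r c' -> (T r c <= T r c')%N) /\
  (forall r r' c, (r <= r')%N -> is_cell la r' c -> (T r c <= T r' c)%N).

Definition row_strict (la : seq nat) (T : nat -> nat -> nat) : Prop :=
  forall r c c', (c < c')%N -> is_cell la r c' -> (T r c < T r c')%N.

(* Main.v *)
Require Import Defs.
From HB Require Import structures.
From mathcomp Require Import ssreflect ssrfun ssrbool eqtype ssrnat seq choice fintype finfun bigop finset path order.
From mathcomp Require Import ssralg ssrnum ssrint poly fraction fingroup perm.
From mathcomp Require Import mpoly.
From mathcomp Require Import ssrcomplements matrix mxalgebra zify ring.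
Set Implicit Arguments.
Unset Strict Implicit.
Unset Printing Implicit Defensive.
Import GRing.Theory.
Local Open Scope ring_scope.

(* The operators T_i, w and the multiplications by variables generate an affine Hecke algebra     *)
(* action, and the Xi_i are its Cherednik operators. A pair (v, T) is encoded by the word of v and *)
(* the cells sg i = T[r_v[i]], whose spectral vector is q^(v_i) s^(content (sg i)); such words are *)
(* separated by their spectral vectors. The affine raising operator and the intertwiners          *)
(* T_i - (s-1)/(1 - z_(i+1)/z_i) produce an eigenvector for every word, and a dimension count in  *)
(* each degree shows that the eigenlines of words are all of the joint spectrum.                  *)
(* On M_T, T_i multiplies the eigenvector of sg by a scalar and adds a multiple of the eigenvector *)
(* of sg with i, i+1 exchanged; the multiple is nonzero whenever that word still fills T. Hence a *)
(* coefficient zero of an antisymmetric vector propagates to all words, so there is at most one   *)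
(* antisymmetric line. If two adjacent cells of a row carry the same entry, they are consecutive in *)
(* the row reading word, where T_i has the eigenvalue s <> -1 and kills that coefficient. If T is *)
(* row-strict, an antisymmetric vector is obtained by antisymmetrizing under S_1, S_2, ..., S_N.  *)

(** * Cherednik operators of an affine Hecke module *)

(** Antisymmetry is read off in a basis of joint eigenvectors of the Cherednik operators. A pair (v,
    T) becomes a word: position i carries the part v_i and the cell of the entry r_v[i] in T. Its
    weight at i is q^(v_i) s^(content). Monomials in q and s are distinct ([qq_ss_inj]) and contents
    determine a word ([contents_inj]), so distinct words have distinct weights ([word_wt_inj]). If
    (v, T) fills the shape as prescribed, then v_i is the value of the filling in the cell at
    position i; hence M_T has one basis line for each [admissible] word of cells.

    The eigenvectors are constructed. The Hecke relations are checked on V_lambda ([T_quad],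
    [T_far], [T_braid]) and pass to polynomials. Then [intertwine] and the raising operator carry
    eigenvectors from word to word ([eigen_exists]). There are as many words of degree at most d as
    coordinates of vectors of degree at most d, so these eigenvectors form a basis ([eigenbasis]):
    each word owns exactly one line ([eigen_line]), and no other weight occurs ([eigen_weight]).

    On M_T, T_i sends the vector of a word to a diagonal multiple of itself plus a multiple of the
    vector of the exchanged word, and the latter multiple is nonzero whenever the exchange stays
    admissible ([eigen_action]). For an antisymmetric vector a zero coefficient therefore spreads
    along admissible exchanges, and these link all admissible words ([antisym_connect]). So one zero
    coefficient kills the vector ([antisym_eq0]), and the antisymmetric space has dimension at most
    one. If two neighbours in a row carry the same value, some admissible word has them in
    consecutive positions; there the exchange is blocked, T_i acts by s, which is not -1, and the
    coefficient is zero ([antisym_row_adjacent]).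

    If the filling is row-strict, an exchange is blocked only inside a column, where T_i acts by -1
    as antisymmetry wants. An antisymmetric vector is then grown one position at a time, summing
    over minimal coset representatives ([antisymmetrizeP]). The crux is that it does not vanish: its
    coefficient at a suitable word is a product of nonzero off-diagonal entries, a power of -1/s and
    a sum 1 + s^-1 + ... + s^-j ([chain_sum_neq0]). *)

Section AffineHecke.

Variables (F : fieldType) (M : lmodType F) (s q : F) (N : nat).
Variables (T : nat -> {linear M -> M}) (w : {linear M -> M}).
Variable (x : nat -> {linear M -> M}).

Definition Tinv i (f : M) : M := s^-1 *: (T i f + (1 - s) *: f).
(** In a right action the leftmost factor is applied first, hence the reversed lists here and in
    [upT]: [downT i] begins with the index [i-1], [upT i] with [N-2]. *)
Definition downT i (f : M) : M := foldl (fun g k => Tinv k g) f (rev (iota 0 i)).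
Definition upT i (f : M) : M :=
  foldl (fun g k => T k g) f (rev (iota i (N.-1 - i))).
Definition cherednik i (f : M) : M :=
  s ^ ((i.+1)%:Z - N%:Z) *: upT i (w (downT i f)).

Hypothesis s0 : s != 0.
Hypothesis quad : forall i f, (i.+1 < N)%N -> T i (T i f) = (s - 1) *: T i f + s *: f.
Hypothesis braid : forall i f, (i.+2 < N)%N ->
  T i (T i.+1 (T i f)) = T i.+1 (T i (T i.+1 f)).
Hypothesis far : forall i j f, (i.+1 < j)%N -> (j.+1 < N)%N -> T i (T j f) = T j (T i f).
Hypothesis wT : forall i f, (i.+2 < N)%N -> w (T i.+1 f) = T i (w f).
Hypothesis wwT : forall f, (1 < N)%N -> w (w (T 0%N f)) = T N.-2 (w (w f)).
Hypothesis Tx : forall i f, (i.+1 < N)%N -> T i (x i f) = x i.+1 (T i f + (1 - s) *: f).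
Hypothesis Tx_far : forall i j f, (i.+1 < N)%N -> (j < N)%N -> j != i -> j != i.+1 ->
  T i (x j f) = x j (T i f).
Hypothesis wx0 : forall f, w (x 0%N f) = q *: x N.-1 (w f).
Hypothesis wxS : forall j f, (j.+1 < N)%N -> w (x j.+1 f) = x j (w f).

Lemma linear_Tinv (L : {linear M -> M}) i f :
  L (Tinv i f) = s^-1 *: (L (T i f) + (1 - s) *: L f).
Proof. by rewrite /Tinv [LHS]linearZ; congr (_ *: _); rewrite [LHS]linearD [in LHS]linearZ. Qed.

Lemma TinvK i f : (i.+1 < N)%N -> Tinv i (T i f) = f.
Proof.
move=> hi; rewrite /Tinv quad // addrAC -scalerDl addrC.
by rewrite (_ : s - 1 + (1 - s) = 0) ?scale0r ?addr0 ?scalerA ?mulVf ?scale1r //; ring.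
Qed.

Lemma TTinv i f : (i.+1 < N)%N -> T i (Tinv i f) = f.
Proof.
move=> hi; rewrite linear_Tinv quad // addrAC -scalerDl addrC.
by rewrite (_ : s - 1 + (1 - s) = 0) ?scale0r ?addr0 ?scalerA ?mulVf ?scale1r //; ring.
Qed.

Lemma TTinv_scaled i f : (i.+1 < N)%N -> T i (T i f + (1 - s) *: f) = s *: f.
Proof.
move=> hi; rewrite -[in RHS](TTinv f hi) /Tinv [X in s *: X]linearZ /=.
by rewrite scalerA divff // scale1r.
Qed.

Lemma Tinv_cancel i f g : (i.+1 < N)%N -> T i f = T i g -> f = g.
Proof. by move=> hi e; rewrite -(TinvK f hi) e TinvK. Qed.

Lemma far_sym i j f : (i.+1 < N)%N -> (j.+1 < N)%N -> j != i -> j != i.+1 -> i != j.+1 ->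
  T i (T j f) = T j (T i f).
Proof.
move=> hi hj h1 h2 h3; case: (ltnP i.+1 j) => h; first exact: far.
by rewrite [RHS]far //; lia.
Qed.

Lemma far_inv i j f : (i.+1 < N)%N -> (j.+1 < N)%N -> j != i -> j != i.+1 -> i != j.+1 ->
  Tinv i (T j f) = T j (Tinv i f).
Proof. move=> hi hj h1 h2 h3; by rewrite linear_Tinv /Tinv far_sym. Qed.

Lemma upT_last f : upT N.-1 f = f.
Proof. by rewrite /upT subnn. Qed.

Lemma upT_step i f : (i.+1 < N)%N -> upT i f = T i (upT i.+1 f).
Proof.
move=> hi; rewrite /upT (_ : N.-1 - i = (N.-1 - i.+1).+1)%N; last by lia.
by rewrite /= rev_cons foldl_rcons.
Qed.

Lemma downT_step i f : downT i.+1 f = downT i (Tinv i f).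
Proof. by rewrite /downT -addn1 iotaD rev_cat /= add0n. Qed.

Lemma upT_far k i f : (k.+1 < i)%N -> (i < N)%N -> upT i (T k f) = T k (upT i f).
Proof.
move=> hk hi; have [m] := ubnP (N - i)%N; elim: m i hk hi => // m IH i hk hi hm.
have [->|ne] := eqVneq i N.-1; first by rewrite !upT_last.
have hi' : (i.+1 < N)%N by lia.
rewrite (upT_step (T k f) hi') (upT_step f hi') IH; try lia.
by rewrite [LHS]far_sym //; lia.
Qed.

(** All factors of the product commute with the moving operator except those of index [j] and [j-1],
    where the braid relation raises its index by one. *)
Lemma upT_shift i j f : (i < j)%N -> (j.+1 < N)%N -> upT i (T j.-1 f) = T j (upT i f).
Proof.
move=> hij hj; have [m] := ubnP (j - i)%N; elim: m i hij => // m IH i hij hm.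
have hi' : (i.+1 < N)%N by lia.
rewrite (upT_step (T j.-1 f) hi') (upT_step f hi').
have [e|ne] := eqVneq j i.+1.
  by subst j; rewrite /= (upT_step (T i f) hj) (upT_step f hj) upT_far // braid.
rewrite IH; try lia.
by rewrite [LHS]far_sym //; lia.
Qed.

Lemma downT_far i j f : (i < j)%N -> (j.+1 < N)%N -> downT i (T j f) = T j (downT i f).
Proof.
elim: i j f => // i IH j f hij hj.
by rewrite !downT_step far_inv ?IH //; lia.
Qed.

Lemma braid_inv i f : (i.+2 < N)%N ->
  Tinv i (Tinv i.+1 (T i f)) = T i.+1 (Tinv i (Tinv i.+1 f)).
Proof.
move=> hi; apply: (@Tinv_cancel i); first by lia.
rewrite TTinv; last by lia.
apply: (@Tinv_cancel i.+1); first by lia.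
rewrite TTinv // -(braid (Tinv i (Tinv i.+1 f)) hi) !TTinv //; lia.
Qed.

Lemma downT_shift i j f : (j.+1 < i)%N -> (i < N)%N -> downT i (T j f) = T j.+1 (downT i f).
Proof.
elim: i f => // i IH f hji hi; rewrite !downT_step.
have [e|ne] := eqVneq i j.+1; last by rewrite far_inv ?IH //; lia.
by subst i; rewrite !downT_step braid_inv // downT_far.
Qed.

Lemma cherednik_linear i : linear (cherednik i).
Proof.
have Tl k : linear (Tinv k).
  move=> a f g; rewrite /Tinv linearP [(1 - s) *: (_ + _)]scalerDr addrACA scalerDr.
  by congr (_ + _); rewrite !scalerDr !scalerA; congr (_ *: _ + _ *: _); ring.
have dl k : linear (downT k).
  by elim: k => [|k IH] a f g //; rewrite !downT_step Tl IH.
have ul l : linear (fun f => foldl (fun g k => T k g) f l).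
  by elim: l => [|k l IH] a f g //=; rewrite linearP IH.
move=> a f g; rewrite /cherednik dl linearP /upT ul scalerDr !scalerA.
by congr (_ *: _ + _); rewrite mulrC.
Qed.
HB.instance Definition _ i :=
  GRing.isLinear.Build F M M *:%R (cherednik i) (cherednik_linear i).

Lemma cherednikZ i c f : cherednik i (c *: f) = c *: cherednik i f.
Proof. exact: (linearZ_LR (cherednik i)). Qed.

Lemma cherednikB i f g : cherednik i (f - g) = cherednik i f - cherednik i g.
Proof. exact: (linearB (cherednik i)). Qed.

Lemma cherednikD i f g : cherednik i (f + g) = cherednik i f + cherednik i g.
Proof. exact: (linearD (cherednik i)). Qed.

(** The inner [T i] cancels the first factor of [downT i.+1], the outer one completes [upT i.+1] to
    [upT i], and the prefactors differ by one power of [s]. *)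
Lemma cherednik_T i f : (i.+1 < N)%N ->
  T i (cherednik i.+1 (T i f)) = s *: cherednik i f.
Proof.
move=> hi; rewrite /cherednik linearZ /= downT_step TinvK // scalerA.
rewrite (_ : i.+2%:Z - N%:Z = 1 + (i.+1%:Z - N%:Z)); last by lia.
by rewrite (expfzDr 1) // expr1z -upT_step.
Qed.

Lemma cherednik_rec i f : (i.+1 < N)%N ->
  cherednik i f = s^-1 *: T i (cherednik i.+1 (T i f)).
Proof. by move=> hi; rewrite cherednik_T // scalerA mulVf // scale1r. Qed.

(** For [i < j] the operator passes [downT], [w] lowers its index and [upT_shift] restores it; for
    [i > j+1] the index is raised by [downT_shift] and lowered by [w]. *)
Lemma cherednik_far i j f : (i < N)%N -> (j.+1 < N)%N -> j != i -> i != j.+1 ->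
  cherednik i (T j f) = T j (cherednik i f).
Proof.
move=> hi hj h1 h2; rewrite /cherednik linearZ /=; congr (_ *: _).
case: (ltnP i j) => h.
  rewrite downT_far //; case: j h hj {h1 h2} => // j h hj.
  by rewrite wT // -(upT_shift (j := j.+1)).
by rewrite downT_shift ?wT ?upT_far //; lia.
Qed.

(** The affine intertwiner: it rotates a weight cyclically, multiplies the rotated entry by [q], and
    raises the degree by one. *)
Definition affine_raise (f : M) : M := x N.-1 (w f).

Lemma T_raise i f : (i.+2 < N)%N ->
  T i (affine_raise f) = affine_raise (T i.+1 f).
Proof. by move=> hi; rewrite /affine_raise Tx_far ?wT //; lia. Qed.

Lemma Tx_inv i f : (i.+1 < N)%N -> T i (x i f) = s *: x i.+1 (Tinv i f).
Proof. by move=> hi; rewrite Tx // /Tinv [x i.+1 (s^-1 *: _)]linearZ /= scalerA divff // scale1r. Qed.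

(** Pulling the variable through an inverse factor lowers its index and turns that factor into
    [s^-1] times a direct one. The product of inverses thus becomes the product [upT 0] that occurs
    in [cherednik 0]. *)
Lemma cherednik_last_raise f : (1 < N)%N ->
  cherednik N.-1 (affine_raise f) = q *: affine_raise (cherednik 0 f).
Proof.
move=> N1; rewrite /cherednik /affine_raise.
have down_x i g : (i < N)%N ->
    downT i (x i g) = s ^- i *: x 0%N (foldr (fun k g => T k g) g (iota 0 i)).
  elim: i g => [|i IH] g hi; first by rewrite expr0 invr1 scale1r.
  have e : Tinv i (x i.+1 g) = s^-1 *: x i (T i g).
    apply: (@Tinv_cancel i) => //; rewrite TTinv // linearZ /= Tx_inv // TinvK //.
    by rewrite scalerA mulVf // scale1r.
  have dl c f' : downT i (c *: f') = c *: downT i f'.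
    rewrite /downT; elim: (rev _) f' => //= k l IHl f'; rewrite -IHl; congr foldl.
    by rewrite /Tinv linearZ /= !scalerDr !scalerA; congr (_ *: _ + _ *: _); ring.
  rewrite downT_step e dl IH; last by lia.
  rewrite scalerA exprS invfM; congr (_ *: x _ _).
  by rewrite -addn1 iotaD foldr_cat add0n.
rewrite down_x; last by lia.
have -> : foldr (fun k g => T k g) (w f) (iota 0 N.-1) = upT 0 (w f).
  by rewrite /upT subn0 foldl_rev.
rewrite upT_last linearZ /= wx0 [w (_ *: _)]linearZ [x _ (_ *: _)]linearZ !scalerA.
congr (_ *: _).
rewrite (_ : (N.-1.+1)%:Z - N%:Z = 0) ?expr0z ?mul1r; last by lia.
rewrite mulrC; congr (_ * _).
by rewrite (_ : 1%:Z - N%:Z = - (N.-1)%:Z) ?exprnN //; lia.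
Qed.

(** Descending induction on [i]: [cherednik_rec] and [T_raise] reduce [i] to [i+1]. The base case
    [i = N-2] is where the relation between [w] squared and [T 0] enters. *)
Lemma cherednik_raise i f : (i.+1 < N)%N ->
  cherednik i (affine_raise f) = affine_raise (cherednik i.+1 f).
Proof.
move=> hi; have [m] := ubnP (N - i)%N; elim: m i f hi => // m IH i f hi hm.
have raiseZ c g : affine_raise (c *: g) = c *: affine_raise g.
  by rewrite /affine_raise !linearZ.
have [e|ne] := eqVneq i.+2 N; last first.
  rewrite cherednik_rec // T_raise ?IH //; try lia.
  rewrite T_raise; last by lia.
  rewrite cherednik_T; last by lia.
  by rewrite raiseZ scalerA mulVf // scale1r.
have wTinv j g : (j.+2 < N)%N -> w (Tinv j.+1 g) = Tinv j (w g).
  by move=> hj; rewrite linear_Tinv wT.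
have eN : N.-1 = i.+1 by lia.
have ul g : upT i.+1 g = g by rewrite -eN upT_last.
rewrite /cherednik upT_step // !ul raiseZ.
rewrite (_ : i.+2%:Z - N%:Z = 1 + (i.+1%:Z - N%:Z)); last by lia.
rewrite (expfzDr 1) // expr1z mulrC -scalerA; congr (_ *: _).
rewrite /affine_raise.
have down_x k g : (k.+1 < N)%N -> downT k (x N.-1 g) = x N.-1 (downT k g).
  elim: k g => // k IHk g hk; rewrite !downT_step.
  rewrite (_ : Tinv k (x N.-1 g) = x N.-1 (Tinv k g)); first by rewrite IHk //; lia.
  by rewrite linear_Tinv /Tinv Tx_far //; lia.
rewrite down_x // eN.
rewrite wxS // Tx_inv //; congr (_ *: x _ _).
have shift k g : (k.+1 < N)%N -> w (w (downT k.+1 g)) = Tinv N.-2 (w (downT k (w g))).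
  elim: k g => [|k IHk] g hk; last first.
    by rewrite downT_step IHk ?wTinv -?downT_step //; lia.
  by rewrite /downT /= linear_Tinv [w _ in LHS]linearZ linearD linearZ /= wwT //; lia.
by rewrite shift // -e.
Qed.

(** The hypothesis holds for constants, on which [w] is the full product of the [T k]; that product
    undoes [downT]. *)
Lemma cherednik_last f :
  w (downT N.-1 f) = foldl (fun g k => T k g) (downT N.-1 f) (iota 0 N.-1) ->
  (0 < N)%N -> cherednik N.-1 f = f.
Proof.
have K i : (i < N)%N ->
    forall g, foldl (fun g k => T k g) (downT i g) (iota 0 i) = g.
  elim: i => // i IH hi g.
  by rewrite -addn1 iotaD foldl_cat addn1 downT_step /= add0n IH ?TTinv //; lia.
move=> wf N0; rewrite /cherednik upT_last wf K; last by lia.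
by rewrite (_ : (N.-1.+1)%:Z - N%:Z = 0) ?expr0z ?scale1r //; lia.
Qed.

Definition joint_eigen (z : 'I_N -> F) (f : M) : Prop :=
  forall i : 'I_N, cherednik i f = z i *: f.

Lemma joint_eigenZ z c f : joint_eigen z f -> joint_eigen z (c *: f).
Proof. by move=> zf i; rewrite cherednikZ zf !scalerA mulrC. Qed.

Lemma joint_eigen_sub z f g : joint_eigen z f -> joint_eigen z g -> joint_eigen z (f - g).
Proof. by move=> zf zg i; rewrite cherednikB zf zg scalerBr. Qed.

Definition hecke_diag (z : 'I_N -> F) (a b : 'I_N) : F := (s - 1) / (1 - z b / z a).

(** On [f] and [T a f] the operators of index [a] and [b] are triangular ([Ea], [Eb]). The scalar
    [hecke_diag] is the one that removes the component along [f]; the other operators commute with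
    [T a]. *)
Lemma intertwine z (a b : 'I_N) f : b = a.+1 :> nat -> joint_eigen z f ->
  z a != 0 -> z a != z b ->
  joint_eigen (fun k => z (tperm a b k)) (T a f - hecke_diag z a b *: f).
Proof.
move=> hb zf za0 zab; set c := hecke_diag z a b.
have ha : (a.+1 < N)%N by rewrite -hb.
have zab' : z a - z b != 0 by rewrite subr_eq0.
have ce : c = (s - 1) * z a / (z a - z b).
  by rewrite /c /hecke_diag; field; rewrite za0 zab'.
have Eb : cherednik b (T a f) = z a *: (T a f + (1 - s) *: f).
  apply: (@Tinv_cancel a) => //.
  by rewrite hb cherednik_T // zf [RHS]linearZ /= TTinv_scaled // !scalerA mulrC.
have Ea : cherednik a (T a f) = (s - 1) * z a *: f + z b *: T a f.
  rewrite cherednik_rec // quad // cherednikD !cherednikZ -hb Eb zf.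
  rewrite linearD !linearZ /= TTinv_scaled //.
  rewrite scalerDr !scalerA; congr (_ *: _ + _ *: _); field; exact: s0.
have comb (u v : M) (x1 x2 y1 y2 : F) : x1 = y1 -> x2 = y2 -> x1 *: u + x2 *: v = y1 *: u + y2 *: v.
  by move=> -> ->.
move=> k; rewrite cherednikB cherednikZ zf.
case: tpermP => [->|->|/eqP nka /eqP nkb].
- rewrite Ea !scalerBr !scalerA addrC addrA -scaleNr -scalerDl addrC -scaleNr.
  by apply: comb => //; rewrite ce; field.
- rewrite Eb scalerDr scalerBr !scalerA -addrA -scalerBl -scaleNr.
  by apply: comb => //; rewrite ce; field.
rewrite cherednik_far // ?zf ?[T a (_ *: _)]linearZ /=; last by rewrite -hb.
  by rewrite scalerBr !scalerA [c * _]mulrC.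
by rewrite eq_sym.
Qed.

(** Applying [cherednik i - z y i], with [i] separating two weights, removes the term [y] and only
    rescales the others, so the set shrinks. *)
Lemma eigen_independent (I : finType) (z : I -> 'I_N -> F) (g : I -> M) (S : {set I}) :
  (forall u y, u \in S -> y \in S -> u != y -> exists i, z u i != z y i) ->
  (forall u, u \in S -> joint_eigen (z u) (g u)) ->
  \sum_(u in S) g u = 0 -> forall u, u \in S -> g u = 0.
Proof.
have [n] := ubnP #|S|; elim: n S g => // n IH S g hn zS gS sum0 u xS.
have [/existsP[y /andP[yS nyx]]|] := boolP [exists y, (y \in S) && (y != u)].
  have [i zi] := zS _ _ yS xS nyx.
  have xSy : u \in S :\ y by rewrite !inE eq_sym nyx.
  suff /eqP : (z u i - z y i) *: g u = 0.
    by rewrite scaler_eq0 subr_eq0 eq_sym (negPf zi) => /eqP.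
  apply: (IH (S :\ y) (fun t => (z t i - z y i) *: g t)) => //.
  - by move: hn; rewrite (cardsD1 y) yS.
  - by move=> a b; rewrite !inE => /andP[_ aS] /andP[_ bS]; apply: zS.
  - by move=> a; rewrite !inE => /andP[_ aS]; apply/joint_eigenZ/gS.
  have: cherednik i (\sum_(u in S) g u) - z y i *: (\sum_(u in S) g u) = 0.
    by rewrite sum0 (linear0 (cherednik i)) scaler0 subr0.
  rewrite (linear_sum (cherednik i)) scaler_sumr -sumrB (bigD1 y yS) /= (gS _ yS i) subrr add0r.
  rewrite (eq_bigr (fun t => (z t i - z y i) *: g t)); last first.
    by move=> t /andP[tS _]; rewrite (gS _ tS i) scalerBl.
  by move=> e; rewrite -[RHS]e; apply: eq_bigl => t; rewrite !inE andbC.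
rewrite negb_exists => /forallP h; move: sum0.
rewrite (bigD1 u xS) /= big1 ?addr0 // => y hy.
by have := h y; rewrite /= hy.
Qed.

End AffineHecke.

(** * Words *)

Section Words.

Variable N : nat.
Local Notation cell := ('I_N * 'I_N)%type.
Local Notation filling := {ffun 'I_N -> 'I_N * 'I_N}.
Local Notation composition := {ffun 'I_N -> nat}.

Definition content (c : cell) : int := (c.2 : nat)%:Z - (c.1 : nat)%:Z.

Definition cell_lt (c d : cell) : bool :=
  ((c.1 == d.1) && (c.2 < d.2)%N) || ((c.2 == d.2) && (c.1 < d.1)%N).

(** The order in which [rv] numbers the positions: larger parts first, ties from left to right. *)
Definition before (v : composition) (i j : 'I_N) : bool :=
  (v j < v i)%N || ((v i == v j) && (i < j)%N).

Lemma before_total v i j : i != j -> before v i j || before v j i.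
Proof. by move=> nij; have : (i : nat) != j := nij; rewrite /before; lia. Qed.

Lemma before_asym v i j : before v i j -> ~~ before v j i.
Proof. by rewrite /before; lia. Qed.

Lemma before_irr v i : before v i i = false.
Proof. by rewrite /before; lia. Qed.

Lemma before_trans v i j k : before v i j -> before v j k -> before v i k.
Proof. by rewrite /before; lia. Qed.

Lemma cell_eq (c d : cell) : c.1 = d.1 :> nat -> c.2 = d.2 :> nat -> c = d.
Proof. by case: c d => a b [c d] /= /val_inj -> /val_inj ->. Qed.

Lemma before_succ (v : composition) (a b : 'I_N) : b = a.+1 :> nat -> v a = v b ->
  before v a b /\ (forall k, before v a k -> ~~ before v k b).
Proof. by move=> hb e; split=> [|k]; rewrite /before; lia. Qed.

(* A word is determined by its contents: at the last position where two words differ, the lower *)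
(* of the two cells would have to occur later in one of them.                                     *)
Lemma contents_inj v (sg tu : 'I_N -> cell) :
  injective sg -> injective tu ->
  (forall i, exists j, sg j = tu i) -> (forall i, exists j, tu j = sg i) ->
  (forall i j, content (sg i) = content (sg j) -> ((sg i).1 < (sg j).1)%N -> before v j i) ->
  (forall i j, content (tu i) = content (tu j) -> ((tu i).1 < (tu j).1)%N -> before v j i) ->
  (forall i, content (sg i) = content (tu i)) -> sg =1 tu.
Proof.
move=> si ti st ts sb tb hc i; apply/eqP/negPn/negP => hi.
have [k hk kmax] : exists2 k, sg k != tu k & forall l, before v k l -> sg l = tu l.
  have [n] := ubnP #|[set l | before v i l]|; elim: n i hi => // n IH i hi hn.
  have [/existsP[l /andP[h1 h2]]|] := boolP [exists l, before v i l && (sg l != tu l)].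
    apply: (IH l h2); rewrite ltnS in hn; apply: leq_trans hn; apply: proper_card.
    apply/properP; split; first by apply/subsetP => m; rewrite !inE; apply: before_trans.
    by exists l; rewrite !inE ?before_irr.
  rewrite negb_exists => /forallP h; exists i => // l hl.
  by have := h l; rewrite hl /= negbK => /eqP.
have [e|] := eqVneq ((sg k).1 : nat) (tu k).1.
  move/eqP: hk; apply; apply: cell_eq => //.
  by move: (hc k); rewrite /content; lia.
rewrite neq_ltn => /orP[h|h].
  have [j hj] := ts k.
  have bj : before v k j by apply: tb; rewrite hj // hc.
  by have := kmax _ bj; rewrite hj => /si e; move: bj; rewrite e before_irr.
have [j hj] := st k.
have bj : before v k j by apply: sb; rewrite hj // hc.
by have := kmax _ bj; rewrite hj => /esym/ti e; move: bj; rewrite e before_irr.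
Qed.

Definition swap_word (a b : 'I_N) (sg : filling) : filling := [ffun i => sg (tperm a b i)].
Definition swap_comp (a b : 'I_N) (v : composition) : composition := [ffun i => v (tperm a b i)].

Lemma swap_wordK a b : involutive (swap_word a b).
Proof. by move=> sg; apply/ffunP => i; rewrite !ffunE tpermK. Qed.

Lemma swap_compK a b : involutive (swap_comp a b).
Proof. by move=> sg; apply/ffunP => i; rewrite !ffunE tpermK. Qed.

(** Exchanging two neighbours together with their parts can only reverse a tie between them, because
    only ties are decided by position. *)
Lemma before_swap (v : composition) (a b i j : 'I_N) : b = a.+1 :> nat ->
  ~~ ((v a == v b) && (i == a) && (j == b)) ->
  before v i j -> before (swap_comp a b v) (tperm a b i) (tperm a b j).
Proof.
move=> hb; rewrite /before !ffunE !tpermK.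
have tv k : (tperm a b k : nat) = if (k : nat) == a then b : nat else if (k : nat) == b then a : nat else k.
  case: tpermP => [->|->|/eqP h1 /eqP h2]; first by rewrite eqxx.
    by rewrite hb eqxx (gtn_eqF (ltnSn _)).
  by rewrite (negPf (h1 : (k : nat) != a)) (negPf (h2 : (k : nat) != b)).
rewrite !tv -!(inj_eq val_inj) /=.
case: (eqVneq (i : nat) a) => [/val_inj ->|n1]; [|case: (eqVneq (i : nat) b) => [/val_inj ->|n2]];
  (case: (eqVneq (j : nat) a) => [/val_inj ->|n3]; [|case: (eqVneq (j : nat) b) => [/val_inj ->|n4]]);
  rewrite ?eqxx /=; lia.
Qed.

Variable la : seq nat.

Definition in_shape (c : cell) : bool := is_cell la c.1 c.2.

(** Read in the order [before v], the cells spell out a reverse standard tableau: a cell further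
    right or higher comes earlier. *)
Definition word (v : composition) (sg : filling) : bool :=
  [&& injectiveb sg, [forall i, in_shape (sg i)] &
      [forall i, forall j, cell_lt (sg i) (sg j) ==> before v j i]].

Lemma wordP v (sg : filling) :
  reflect [/\ injective sg, forall i, in_shape (sg i) &
              forall i j, cell_lt (sg i) (sg j) -> before v j i]
          (word v sg).
Proof.
apply: (iffP and3P) => [[/injectiveP h1 /forallP h2 h3]|[h1 h2 h3]]; split=> //.
- by move=> i j h; move/forallP: h3 => /(_ i) /forallP /(_ j); rewrite h.
- exact/injectiveP.
- exact/forallP.
- by apply/forallP=> i; apply/forallP=> j; apply/implyP; apply: h3.
Qed.

Hypothesis la_part : is_partition N la.

Lemma is_cell_le r c r' c' : is_cell la r c -> (r' <= r)%N -> (c' <= c)%N -> is_cell la r' c'.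
Proof.
move/and3P: la_part => [hs _ _] /andP[h1 h2] hr hc; rewrite /is_cell.
have -> /= : (r' < size la)%N by lia.
have gt : transitive geq by move=> x y z /= h h'; apply: leq_trans h' h.
have gr : reflexive geq by move=> x /=.
have := sorted_leq_nth gt gr 0%N hs; rewrite /sorted => /(_ r' r).
rewrite !inE; have -> /= : (r' < size la)%N by lia.
by rewrite h1 => /(_ isT isT hr) /=; lia.
Qed.

Lemma in_shape_le (c d : cell) : in_shape d -> (c.1 <= d.1)%N -> (c.2 <= d.2)%N -> in_shape c.
Proof. exact: is_cell_le. Qed.

Lemma nth_le_sumn (l : seq nat) r : (nth 0 l r <= sumn l)%N.
Proof. by elim: l r => [|a l IH] [|r] //=; [rewrite leq_addr|apply: leq_trans (IH r) (leq_addl _ _)]. Qed.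

Lemma size_le_sumn (l : seq nat) : all (fun x => 0 < x)%N l -> (size l <= sumn l)%N.
Proof. by elim: l => //= a l IH /andP[a0 /IH h]; lia. Qed.

Lemma is_cell_bound r c : is_cell la r c -> (r < N)%N && (c < N)%N.
Proof.
move/and3P: la_part => [_ h0 /eqP hN] /andP[h1 h2].
have := size_le_sumn h0; have := nth_le_sumn la r; lia.
Qed.

Lemma card_shape : #|[set c : cell | in_shape c]| = N.
Proof.
move/and3P: (la_part) => [_ h0 /eqP hN].
rewrite -sum1_card (eq_bigl (fun c : cell => in_shape c)); last by move=> c; rewrite inE.
rewrite big_mkcond /= -(pair_bigA _ (fun i j => if in_shape (i, j) then 1 else 0)%N) /=.
rewrite (eq_bigr (fun r : 'I_N => nth 0%N la r)); last first.
  move=> r _; rewrite -big_mkcond /= sum1_card.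
  have hr : (nth 0%N la r <= N)%N by have := nth_le_sumn la r; rewrite hN.
  have wi : injective (widen_ord hr) by move=> k l /(congr1 val) /= /val_inj.
  rewrite -[RHS]card_ord -(card_image wi).
  apply: eq_card => c; rewrite /in_shape /is_cell unfold_in /=.
  apply/idP/imageP => [/andP[_ hc]|[k _ ->]].
    by exists (Ordinal hc) => //; apply: val_inj.
  rewrite /= ltn_ord andbT ltnNge; apply/negP => /(nth_default 0%N) e.
  by have := ltn_ord k; rewrite [X in (_ < X)%N]e.
rewrite -[in RHS]hN sumnE (big_nth 0%N) big_mkord.
have hs : (size la <= N)%N by have := size_le_sumn h0; rewrite hN.
rewrite (big_ord_widen _ (fun i => nth 0%N la i) hs) [RHS]big_mkcond /=.
by apply: eq_bigr => i _; case: (ltnP i (size la)) => // /(nth_default 0%N) ->.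
Qed.

Lemma word_surj (v : composition) (sg : filling) c : word v sg -> in_shape c -> exists i, sg i = c.
Proof.
case/wordP => hi hc _ cs.
have : sg @: setT == [set c : cell | in_shape c].
  rewrite eqEcard card_shape card_imset // cardsT card_ord leqnn andbT.
  by apply/subsetP => d /imsetP[i _ ->]; rewrite inE.
by move=> /eqP/setP /(_ c); rewrite inE cs => /imsetP[i _ ->]; exists i.
Qed.

(* Any two comparable cells are linked through the corner cell of the rectangle they span. *)
Lemma word_le (v : composition) (sg : filling) i j : word v sg -> i != j ->
  ((sg i).1 <= (sg j).1)%N -> ((sg i).2 <= (sg j).2)%N -> before v j i.
Proof.
move=> hw nij h1 h2; have [hi hc hb] := wordP _ _ hw.
have [k hk] : exists k, sg k = ((sg i).1, (sg j).2).
  by apply: (word_surj hw); apply: in_shape_le (hc j) _ _ => /=.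
have [e1|n1] := eqVneq (sg i).1 (sg j).1.
  apply: hb; rewrite /cell_lt e1 eqxx ltn_neqAle h2 andbT.
  apply/orP; left; apply: contraNneq nij => e2; apply/eqP/hi.
  by move: e1 (val_inj e2); case: (sg i) (sg j) => a b [c d] /= -> ->.
have l1 : ((sg i).1 < (sg j).1)%N by rewrite ltn_neqAle h1 andbT.
have kj : before v j k by apply: hb; rewrite hk /cell_lt /= eqxx l1 orbT.
have [e2|n2] := eqVneq (sg i).2 (sg j).2.
  by apply: hb; rewrite /cell_lt e2 eqxx l1 orbT.
apply: before_trans kj _; apply: hb; rewrite hk /cell_lt /= eqxx ltn_neqAle h2 andbT.
by rewrite n2.
Qed.

Lemma word_diag (v : composition) (sg : filling) i j : word v sg -> content (sg i) = content (sg j) ->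
  ((sg i).1 < (sg j).1)%N -> before v j i.
Proof.
move=> hw hc h1; apply: (word_le hw); last by move: hc; rewrite /content; lia.
  by apply: contraTneq h1 => ->; rewrite ltnn.
exact: ltnW.
Qed.

Lemma word_contents_inj v (sg tu : filling) : word v sg -> word v tu ->
  (forall i, content (sg i) = content (tu i)) -> sg = tu.
Proof.
move=> hs ht hc; apply/ffunP; apply: (contents_inj (v := v)) hc.
- by case/wordP: hs.
- by case/wordP: ht.
- by move=> i; apply: (word_surj hs); case/wordP: ht.
- by move=> i; apply: (word_surj ht); case/wordP: hs.
- by move=> i j; apply: word_diag.
- by move=> i j; apply: word_diag.
Qed.

Lemma word_swap (v : composition) (sg : filling) (a b : 'I_N) : b = a.+1 :> nat -> word v sg ->
  ~~ ((v a == v b) && cell_lt (sg b) (sg a)) -> word (swap_comp a b v) (swap_word a b sg).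
Proof.
move=> hb /wordP[hi hc hw] hab; apply/wordP; split.
- by move=> i j; rewrite !ffunE => /hi/perm_inj.
- by move=> i; rewrite ffunE.
move=> i j; rewrite !ffunE => hl; have := hw _ _ hl.
move=> /(before_swap hb); rewrite !tpermK; apply.
apply: contra hab => /andP[/andP[-> /eqP ea] /eqP eb].
by move: hl; rewrite ea eb.
Qed.

(** If the two cells are comparable, every cell of the rectangle they span occurs between them in
    the order, and no position is left for one. So the rectangle is a domino. *)
Lemma word_consecutive (v : composition) (sg : filling) (a b : 'I_N) : word v sg -> before v a b ->
  (forall k, before v a k -> ~~ before v k b) ->
  [\/ (sg a).1 = (sg b).1 /\ (sg a).2 = (sg b).2.+1 :> nat,
      (sg a).2 = (sg b).2 /\ (sg a).1 = (sg b).1.+1 :> nat,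
      ((sg b).1 < (sg a).1)%N /\ ((sg a).2 < (sg b).2)%N |
      ((sg a).1 < (sg b).1)%N /\ ((sg b).2 < (sg a).2)%N].
Proof.
move=> hw hab nb; have nab : a != b by apply: contraTneq hab => ->; rewrite before_irr.
have [hi hc hl] := wordP _ _ hw.
have nle : ~ (((sg a).1 <= (sg b).1)%N /\ ((sg a).2 <= (sg b).2)%N).
  by case=> h1 h2; have := word_le hw nab h1 h2; rewrite (negPf (before_asym hab)).
case: (ltnP (sg a).1 (sg b).1) => h1.
  by case: (ltnP (sg b).2 (sg a).2) => h2; [constructor 4|case: nle; lia].
case: (ltnP (sg a).2 (sg b).2) => h2.
  by constructor 3; split=> //; lia.
have nocell (c : cell) : ((sg b).1 <= c.1)%N -> ((sg b).2 <= c.2)%N -> (c.1 <= (sg a).1)%N ->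
    (c.2 <= (sg a).2)%N -> c = sg a \/ c = sg b.
  move=> l1 l2 l3 l4; have [k hk] := word_surj hw (in_shape_le (hc a) l3 l4).
  have [e|nka] := eqVneq k a; first by left; rewrite -hk e.
  have [e|nkb] := eqVneq k b; first by right; rewrite -hk e.
  have h : before v a k by apply: (word_le hw) => //; rewrite hk.
  by have := nb _ h; rewrite (word_le hw) // ?hk // eq_sym.
have [e1|n1] := eqVneq ((sg a).1 : nat) (sg b).1.
  constructor 1; split; first exact: val_inj.
  have lt2 : ((sg b).2 < (sg a).2)%N by move: nle; lia.
  have hN : ((sg b).2.+1 < N)%N by have := ltn_ord (sg a).2; lia.
  have [] := nocell ((sg b).1, Ordinal hN) => /=; try lia.
    by move=> <-.
  by move=> /(congr1 (fun c : cell => c.2 : nat)) /=; lia.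
have hN : ((sg b).1.+1 < N)%N by have := ltn_ord (sg a).1; lia.
constructor 2.
have [] := nocell (Ordinal hN, (sg b).2) => /=; try lia.
  by move=> <-.
by move=> /(congr1 (fun c : cell => c.1 : nat)) /=; lia.
Qed.

End Words.

(** * Monomials in q and s, and the matrix entries of T_i on V_lambda *)

Section QuadraticCoefficients.

Lemma ss_neq0 : ss != 0.
Proof. by rewrite /ss tofrac_eq0 polyX_eq0. Qed.

Lemma qq_neq0 : qq != 0.
Proof. by rewrite /qq tofrac_eq0 polyC_eq0 polyX_eq0. Qed.

(** After division by the smaller power of [ss] both sides are polynomials in [ss] over polynomials
    in [qq]; the degree in [ss] settles one exponent, the degree in [qq] the other. *)
Lemma qq_ss_inj (m n : nat) (k l : int) :
  qq ^+ m * ss ^ k = qq ^+ n * ss ^ l -> m = n /\ k = l.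
Proof.
wlog hkl : m n k l / k <= l => [wl e|e].
  have [h|h] : k <= l \/ l <= k by lia.
    exact: wl.
  by case: (wl n m l k).
have [d el] : exists d : nat, l = k + d%:Z.
  by exists `|l - k|%N; lia.
move: e; rewrite el expfzDr ?ss_neq0 // [ss ^ k * _]mulrC mulrA.
move/(mulIf (expfz_neq0 k ss_neq0)); rewrite -exprnP.
rewrite /qq /ss -!(rmorphXn, rmorphM) => /eqP; rewrite tofrac_eq => /eqP.
rewrite /= mul_polyC => e.
have xn j : ('X^j : {poly CC}) != 0 by rewrite expf_neq0 // polyX_eq0.
have := congr1 (fun p : {poly {poly CC}} => size p) e.
rewrite size_polyC xn size_scale // size_polyXn => - [] ed.
move: e; rewrite -ed addr0 expr0 -mul_polyC mulr1 => /polyC_inj.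
by move=> /(congr1 (fun p : {poly CC} => size p)); rewrite !size_polyXn => - [].
Qed.

Lemma ss_exp_inj (k l : int) : ss ^ k = ss ^ l -> k = l.
Proof. by move=> e; have [] := @qq_ss_inj 0 0 k l; rewrite ?e. Qed.

Lemma ss_exp_neq1 (k : int) : k != 0 -> 1 - ss ^ k != 0.
Proof.
by apply: contraNneq => /eqP; rewrite subr_eq0 -(expr0z ss) => /eqP /ss_exp_inj <-.
Qed.

Lemma ss_neqN1 : ss + 1 != 0.
Proof.
have := @ss_exp_neq1 2 isT; rewrite -exprnP; apply: contraNneq => e.
by rewrite -opprB subr_sqr_1 e mulr0 oppr0.
Qed.

End QuadraticCoefficients.

(** The off-diagonal entry as a function of the content gap alone. It is 0 for neighbours in a row
    or column (gap -1 or 1), and 1 in the case fixed by the quadratic relation, where the quotient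
    in the definition simplifies. *)
Definition coefO (m : int) : KK := if 1 < m then Defs.coefB m else if m < -1 then 1 else 0.

Lemma coefA_inv (F : fieldType) (s z : F) : z != 0 -> 1 - z != 0 ->
  (s - 1) - (s - 1) / (1 - z) = (s - 1) / (1 - z^-1).
Proof.
move=> z0 z1; have z2 : z - 1 != 0 by rewrite -opprB oppr_eq0.
by field; rewrite z0 z1 z2.
Qed.

Lemma coefA_opp m : m != 0 -> (ss - 1) - coefA m = coefA (- m).
Proof.
move=> hm; rewrite /coefA -invr_expz; apply: coefA_inv; last exact: ss_exp_neq1.
exact: (expfz_neq0 _ ss_neq0).
Qed.

Lemma coefB_factor (F : fieldType) (s z : F) : s != 0 -> 1 - z != 0 ->
  s * (1 - z * s) * (1 - z * s^-1) / (1 - z) ^+ 2 =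
  (s - (s - 1) / (1 - z)) * (1 + (s - 1) / (1 - z)).
Proof. by move=> h1 h2; field; rewrite h1 h2. Qed.

Lemma coefB_eq m : m != 0 -> Defs.coefB m = (ss - coefA m) * (1 + coefA m).
Proof.
move=> hm; rewrite /Defs.coefB /coefA.
rewrite (expfzDr m 1) ?ss_neq0 // (expfzDr m (-1)) ?ss_neq0 // expr1z.
exact: (coefB_factor ss_neq0 (ss_exp_neq1 hm)).
Qed.

Lemma reflect_factor (R : comRingType) (s a : R) :
  (s - (s - 1 - a)) * (1 + (s - 1 - a)) = (s - a) * (1 + a).
Proof. ring. Qed.

Lemma coefB_opp m : m != 0 -> Defs.coefB (- m) = Defs.coefB m.
Proof.
move=> hm; have hm' : - m != 0 by rewrite oppr_eq0.
by rewrite !coefB_eq // -coefA_opp // reflect_factor.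
Qed.

Lemma coefB_neq0 m : 1 < m -> Defs.coefB m != 0.
Proof.
move=> hm; rewrite /Defs.coefB; apply: mulf_neq0.
  apply: mulf_neq0; last by apply: ss_exp_neq1; lia.
  apply: mulf_neq0; last by apply: ss_exp_neq1; lia.
  exact: ss_neq0.
by rewrite invr_neq0 // expf_neq0 // ss_exp_neq1 //; lia.
Qed.

Lemma coefA1 : coefA 1 = -1.
Proof. by rewrite /coefA expr1z -[X in X / _]opprB mulNr divff // -[X in 1 - X]expr1z ss_exp_neq1. Qed.

Lemma coefAN1 : coefA (-1) = ss.
Proof. by rewrite -(coefA_opp (m := 1)) // coefA1 opprK subrK. Qed.

(** The right side is what the quadratic relation imposes on a two by two block with diagonal
    entries A and s - 1 - A. At [m = 1] and [m = -1] both sides vanish. *)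
Lemma coefO_mul m : m != 0 -> coefO m * coefO (- m) = (ss - coefA m) * (1 + coefA m).
Proof.
move=> hm; rewrite -coefB_eq // /coefO.
case: ifP => h1; first by rewrite ifF ?ifT ?mulr1 //; lia.
case: ifP => h2; first by rewrite ifT ?mul1r ?coefB_opp //; lia.
rewrite mul0r; have [->|->] : m = 1 \/ m = -1 by lia.
  by rewrite coefB_eq // coefA1 subrr mulr0.
by rewrite coefB_eq // coefAN1 subrr mul0r.
Qed.

(** The braid relation on a hexagon of six vectors, one coordinate at a time. Comparing
    coefficients, those of [f4], [f5], [f6] agree term by term; those of [f1], [f2], [f3] are the
    rational identities [c1], [c2], [c3]. *)
Lemma braid_scalar (F : fieldType) (s X Y Z oxy oyx oxz oyz ozy f1 f2 f3 f4 f5 f6 : F) :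
  let A x y := (s - 1) / (1 - y / x) in
  X != 0 -> Y != 0 -> Z != 0 -> X - Y != 0 -> Y - Z != 0 -> X - Z != 0 ->
  oxy * oyx = (s - A X Y) * (1 + A X Y) -> oyz * ozy = (s - A Y Z) * (1 + A Y Z) ->
  A X Y * (A Y Z * (A X Y * f1)) + A X Y * (A Y Z * (oxy * f2)) +
  A X Y * (oyz * (A X Z * f3 + oxz * f5)) +
  (A X Z * (oxy * (A Y X * f2 + oyx * f1)) + oxy * (oxz * (A Y Z * f4 + oyz * f6))) =
  A Y Z * (A X Y * (A Y Z * f1)) + A Y Z * (A X Y * (oyz * f3)) +
  A Y Z * (oxy * (A X Z * f2 + oxz * f4)) +
  (A X Z * (oyz * (A Z Y * f3 + ozy * f1)) + oyz * (oxz * (A X Y * f5 + oxy * f6))).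
Proof.
move=> A X0 Y0 Z0 XY YZ XZ h1 h2; apply/eqP; rewrite -subr_eq0; apply/eqP.
have YX : Y - X != 0 by rewrite -opprB oppr_eq0.
have ZY : Z - Y != 0 by rewrite -opprB oppr_eq0.
have ZX : Z - X != 0 by rewrite -opprB oppr_eq0.
have c1 : A X Y * A Y Z * A X Y + A X Z * (oxy * oyx)
          - (A Y Z * A X Y * A Y Z + A X Z * (oyz * ozy)) = 0.
  by rewrite h1 h2 /A; field; rewrite ?X0 ?Y0 ?Z0 ?XY ?YZ ?XZ ?YX ?ZY ?ZX.
have c2 : A X Y * A Y Z + A X Z * A Y X - A Y Z * A X Z = 0.
  by rewrite /A; field; rewrite ?X0 ?Y0 ?Z0 ?XY ?YZ ?XZ ?YX ?ZY ?ZX.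
have c3 : A X Y * A X Z - A Y Z * A X Y - A X Z * A Z Y = 0.
  by rewrite /A; field; rewrite ?X0 ?Y0 ?Z0 ?XY ?YZ ?XZ ?YX ?ZY ?ZX.
rewrite -[RHS](_ : f1 * 0 + oxy * f2 * 0 + oyz * f3 * 0 = 0); last by ring.
by rewrite -{1}c1 -{1}c2 -c3; ring.
Qed.

(** * The Hecke algebra relations on V and on K[x] (x) V *)

Section BraidFormal.

Variables (F : fieldType) (I : finType).
Local Notation W := {ffun I -> F^o}.
Variables (T1 T2 : {linear W -> W}) (s X Y Z : F).
Variables (e1 e2 e3 e4 e5 e6 : W).
Variables (oxy oyx oxz oyz ozy : F).
Local Notation A x y := ((s - 1) / (1 - y / x)).
Hypotheses (X0 : X != 0) (Y0 : Y != 0) (Z0 : Z != 0).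
Hypotheses (XY : X - Y != 0) (YZ : Y - Z != 0) (XZ : X - Z != 0).
Hypothesis oxyM : oxy * oyx = (s - A X Y) * (1 + A X Y).
Hypothesis oyzM : oyz * ozy = (s - A Y Z) * (1 + A Y Z).
Hypothesis T1e1 : T1 e1 = A X Y *: e1 + oxy *: e2.
Hypothesis T2e1 : T2 e1 = A Y Z *: e1 + oyz *: e3.
Hypothesis T1e2 : oxy *: T1 e2 = oxy *: (A Y X *: e2 + oyx *: e1).
Hypothesis T2e2 : oxy *: T2 e2 = oxy *: (A X Z *: e2 + oxz *: e4).
Hypothesis T2e3 : oyz *: T2 e3 = oyz *: (A Z Y *: e3 + ozy *: e1).
Hypothesis T1e3 : oyz *: T1 e3 = oyz *: (A X Z *: e3 + oxz *: e5).
Hypothesis T1e4 : oxy *: (oxz *: T1 e4) = oxy *: (oxz *: (A Y Z *: e4 + oyz *: e6)).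
Hypothesis T2e5 : oyz *: (oxz *: T2 e5) = oyz *: (oxz *: (A X Y *: e5 + oxy *: e6)).

(** The [e] are the six arrangements of three consecutive entries. The action on all but the first
    is assumed only after multiplication by the coefficients leading there: if these vanish, the
    arrangement need not be a tableau. *)
Lemma braid_formal : T1 (T2 (T1 e1)) = T2 (T1 (T2 e1)).
Proof.
have swapZ (c d : F) (v : W) : c *: (d *: v) = d *: (c *: v) by rewrite !scalerA mulrC.
have E12 : T2 (T1 e1) = A X Y *: (A Y Z *: e1 + oyz *: e3) + oxy *: (A X Z *: e2 + oxz *: e4).
  by rewrite T1e1 linearD !linearZ /= T2e1 T2e2.
have E21 : T1 (T2 e1) = A Y Z *: (A X Y *: e1 + oxy *: e2) + oyz *: (A X Z *: e3 + oxz *: e5).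
  by rewrite T2e1 linearD !linearZ /= T1e1 T1e3.
rewrite E12 E21 !(linearD, linearZ) /= T1e1 T2e1 !scalerDr.
rewrite T1e3 T2e2 [oxy *: (_ *: T1 e2)]swapZ T1e2 T1e4 [oyz *: (_ *: T2 e3)]swapZ T2e3 T2e5.
apply/ffunP => u; rewrite !ffunE /=.
exact: (@braid_scalar F).
Qed.

End BraidFormal.

Lemma quad_factor (R : comRingType) (s a : R) :
  s + (s - 1) * a - a ^+ 2 = (s - a) * (1 + a).
Proof. ring. Qed.

(** * The representation V_lambda in its tableau basis *)

Section SeminormalModule.

Variables (N : nat) (la : seq nat).
Hypothesis la_part : is_partition N la.

Local Notation cell := ('I_N * 'I_N)%type.
Local Notation filling := {ffun 'I_N -> 'I_N * 'I_N}.
Local Notation Vect := {ffun Tab N la -> KK^o}.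

Lemma tabb_word (f : filling) : tabb la f = word la [ffun=> 0%N] f.
Proof.
apply/and4P/wordP => [[/injectiveP h1 /forallP h2 /forallP h3 /forallP h4]|[h1 h2 h3]].
  split=> // i j; rewrite /before !ffunE ltnn eqxx /= => /orP[] h.
    by have /forallP /(_ j) := h3 i; rewrite h.
  by have /forallP /(_ j) := h4 i; rewrite h.
split; [exact/injectiveP|exact/forallP| |]; apply/forallP=> i; apply/forallP=> j; apply/implyP=> h;
  by have := h3 i j; rewrite /cell_lt h ?orbT /before !ffunE ltnn eqxx => /(_ isT).
Qed.

(** Zero when [f] is not a tableau, so that formulas may mention exchanged fillings
    unconditionally. *)
Definition tab_vec (f : filling) : Vect := deltaO (insub f).

Lemma tab_vec_val (t : Tab N la) : tab_vec (val t) = delta t.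
Proof. by rewrite /tab_vec valK. Qed.

Lemma tab_vec_neq0 (f : filling) : tabb la f -> tab_vec f != 0.
Proof.
move=> hf; rewrite -[f]/(val (Sub f hf : Tab N la)) tab_vec_val.
apply/eqP => /ffunP /(_ (Sub f hf)); rewrite !ffunE eqxx => /eqP.
by rewrite oner_eq0.
Qed.

Lemma vect_delta (u : Vect) : u = \sum_t u t *: delta t.
Proof.
apply/ffunP => t; rewrite sum_ffunE (bigD1 t) //= big1 ?addr0.
  by rewrite !ffunE eqxx /GRing.scale /= mulr1.
by move=> r hr; rewrite !ffunE eq_sym (negPf hr) /GRing.scale /= mulr0.
Qed.

Lemma heckeV_linear i : linear (@heckeV N la i).
Proof.
move=> c u v; rewrite /heckeV scaler_sumr -big_split /=; apply: eq_bigr => t _.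
by rewrite !ffunE scalerDl scalerA.
Qed.
HB.instance Definition _ i :=
  GRing.isLinear.Build KK Vect Vect *:%R (@heckeV N la i) (heckeV_linear i).

Lemma heckeV_delta i (t : Tab N la) : heckeV i (delta t) = heckeB i t.
Proof.
rewrite /heckeV (bigD1 t) //= big1 ?addr0; first by rewrite ffunE eqxx scale1r.
by move=> r hr; rewrite ffunE (negPf hr) scale0r.
Qed.

Lemma vect_ind (P : Vect -> Prop) :
  P 0 -> (forall c u v, P u -> P v -> P (c *: u + v)) ->
  (forall f, tabb la f -> P (tab_vec f)) -> forall u, P u.
Proof.
move=> P0 PD Pt u; rewrite (vect_delta u); elim/big_rec: _ => // t v _ Pv.
by apply: PD => //; rewrite -tab_vec_val; apply: Pt; case: t.
Qed.

Lemma tab_consecutive (f : filling) (a b : 'I_N) : b = a.+1 :> nat -> tabb la f ->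
  [\/ (f a).1 = (f b).1 /\ (f a).2 = (f b).2.+1 :> nat,
      (f a).2 = (f b).2 /\ (f a).1 = (f b).1.+1 :> nat,
      ((f b).1 < (f a).1)%N /\ ((f a).2 < (f b).2)%N |
      ((f a).1 < (f b).1)%N /\ ((f b).2 < (f a).2)%N].
Proof.
rewrite tabb_word => hb hf; apply: (word_consecutive la_part hf);
  have [|h1 h2] := @before_succ _ [ffun=> 0%N] a b hb; by rewrite ?ffunE.
Qed.

Definition gap (f : filling) (a b : 'I_N) : int := content (f b) - content (f a).

Lemma gap_neq0 f (a b : 'I_N) : b = a.+1 :> nat -> tabb la f -> gap f a b != 0.
Proof.
by move=> hb /(tab_consecutive hb); rewrite /gap /content => -[] [h1 h2]; rewrite ?h1 ?h2; lia.
Qed.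

Lemma tabb_swap f (a b : 'I_N) : b = a.+1 :> nat -> tabb la f ->
  coefO (gap f a b) != 0 -> tabb la (swap_word a b f).
Proof.
move=> hb hf ho; rewrite tabb_word (_ : [ffun=> 0%N] = swap_comp a b [ffun=> 0%N]); last first.
  by apply/ffunP => i; rewrite !ffunE.
apply: word_swap => //; first by rewrite -tabb_word.
rewrite !ffunE eqxx /=; apply/negP => hl; move: ho; rewrite /coefO.
have [] := tab_consecutive hb hf; rewrite /gap /content => -[h1 h2].
- by rewrite h1 h2 !ifF ?eqxx //; lia.
- by rewrite h1 h2 !ifF ?eqxx //; lia.
- by move: hl; rewrite /cell_lt => /orP[] /andP[/eqP h _]; move: h1 h2; rewrite h; lia.
- by move: hl; rewrite /cell_lt => /orP[] /andP[/eqP h _]; move: h1 h2; rewrite h; lia.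
Qed.

(** All four relative positions of two consecutive entries obey one formula in the content gap: the
    gaps -1 and 1 give the eigenvalues [ss] and -1. *)
Lemma heckeV_tab (f : filling) (a b : 'I_N) : b = a.+1 :> nat -> tabb la f ->
  heckeV a (tab_vec f) =
  coefA (gap f a b) *: tab_vec f + coefO (gap f a b) *: tab_vec (swap_word a b f).
Proof.
move=> hb hf; set t : Tab N la := Sub f hf.
have ft : f = val t by rewrite SubK.
have cellE (k : 'I_N) : cellT t k = ((f k).1 : nat, (f k).2 : nat).
  by rewrite /cellT valK ft.
have sw : deltaO (swapT t a a.+1) = tab_vec (swap_word a b f).
  rewrite /swapT /tab_vec; congr (deltaO (insub _)).
  apply/ffunP => k; rewrite !ffunE /atT -hb !valK -ft.
  case: tpermP => [->|->|h1 h2]; rewrite ?eqxx //.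
    by rewrite hb (gtn_eqF (ltnSn _)).
  by rewrite !ifN //; apply/eqP => /val_inj.
rewrite {1 2}ft tab_vec_val heckeV_delta /heckeB sw -hb /rowT /colT /CT /colT /rowT !cellE /=.
have -> : (f b).2%:Z - (f b).1%:Z - ((f a).2%:Z - (f a).1%:Z) = gap f a b by [].
have -> : (f a).2%:Z - (f a).1%:Z - ((f b).2%:Z - (f b).1%:Z) = - gap f a b.
  by rewrite /gap /content; lia.
have [] := tab_consecutive hb hf => -[h1 h2].
- have -> : gap f a b = -1 by rewrite /gap /content h1 h2; lia.
  by rewrite h1 eqxx coefAN1 /coefO /= scale0r addr0.
- have -> : gap f a b = 1 by rewrite /gap /content h1 h2; lia.
  rewrite ifF; last by rewrite h2; lia.
  by rewrite h1 eqxx coefA1 /coefO /= scale0r addr0 scaleN1r.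
- have hg : 1 < gap f a b by rewrite /gap /content; lia.
  do 2 (rewrite ifF; last by lia).
  by rewrite h1 /coefO hg.
- have hg : gap f a b < -1 by rewrite /gap /content; lia.
  do 3 (rewrite ifF; last by lia).
  have g0 : - gap f a b != 0 by lia.
  rewrite (coefA_opp g0) opprK.
  rewrite (quad_factor (ss : KK) (coefA (- gap f a b))) -(coefB_eq g0).
  rewrite divff; last by apply: coefB_neq0; lia.
  by rewrite /coefO ifF ?hg //; lia.
Qed.

End SeminormalModule.

Lemma quad_formal (F : fieldType) (I : finType) (s A o o' : F) (e e' : {ffun I -> F^o}) :
  o * o' = (s - A) * (1 + A) ->
  A *: (A *: e + o *: e') + o *: ((s - 1 - A) *: e' + o' *: e) =
  (s - 1) *: (A *: e + o *: e') + s *: e.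
Proof.
move=> h; rewrite !scalerDr !scalerA h; apply/ffunP => u; rewrite !ffunE /GRing.scale /=.
have -> // : forall f f' : F, A * A * f + A * o * f' + (o * (s - 1 - A) * f' +
  (s - A) * (1 + A) * f) = (s - 1) * A * f + (s - 1) * o * f' + s * f.
by move=> f f'; ring.
Qed.

Lemma far_formal (F : fieldType) (M : lmodType F) (A o B p : F) (e e1 e2 e3 : M) :
  B *: (A *: e + o *: e1) + p *: (A *: e2 + o *: e3) =
  A *: (B *: e + p *: e2) + o *: (B *: e1 + p *: e3).
Proof.
rewrite !scalerDr !scalerA addrACA.
by congr (_ + _ + (_ + _)); congr (_ *: _); rewrite mulrC.
Qed.

Lemma subz_opp (k l : int) : k - l = - (l - k).
Proof. by rewrite opprB. Qed.

Section SeminormalRelations.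

Variables (N : nat) (la : seq nat).
Hypothesis la_part : is_partition N la.

Local Notation cell := ('I_N * 'I_N)%type.
Local Notation filling := {ffun 'I_N -> 'I_N * 'I_N}.

Lemma gap_swap (f : filling) (a b : 'I_N) : gap (swap_word a b f) a b = - gap f a b.
Proof. by rewrite /gap !ffunE tpermL tpermR; lia. Qed.

(** Two cells on one diagonal span a rectangle whose other two corners must hold entries strictly
    between; between [a] and [c] there is only [b]. *)
Lemma consecutive_contents (f : filling) (a b c : 'I_N) : tabb la f ->
  b = a.+1 :> nat -> c = b.+1 :> nat -> content (f a) != content (f c).
Proof.
rewrite tabb_word => hf hb hc; apply/eqP => e; have [fi fc fl] := wordP _ _ _ hf.
have bf (k l : 'I_N) : before [ffun=> 0%N] k l = (k < l)%N by rewrite /before !ffunE; lia.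
have lt1 : ((f c).1 < (f a).1)%N.
  case: (ltngtP (f c).1 (f a).1) => // h.
    by have := word_diag la_part hf e h; rewrite bf; lia.
  have /fi ac : f a = f c by apply: cell_eq => //; move: e; rewrite /content; lia.
  by move: hb hc; rewrite ac; lia.
have lt2 : ((f c).2 < (f a).2)%N by move: e; rewrite /content; lia.
have mid (d : cell) : ((f c).1 <= d.1)%N -> ((f c).2 <= d.2)%N -> (d.1 <= (f a).1)%N ->
    (d.2 <= (f a).2)%N -> d != f a -> d != f c -> d = f b.
  move=> l1 l2 l3 l4 na nc; have [k hk] := word_surj la_part hf (in_shape_le la_part (fc a) l3 l4).
  have nka : k != a by apply: contraNneq na => <-; rewrite hk.
  have nkc : c != k by apply: contraNneq nc => ->; rewrite hk.
  rewrite -hk; congr (f _); apply: val_inj => /=.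
  have := word_le la_part hf nka; rewrite hk => /(_ l3 l4); rewrite bf => h1.
  have := word_le la_part hf nkc; rewrite hk => /(_ l1 l2); rewrite bf; lia.
have := mid ((f c).1, (f a).2) (leqnn _) (ltnW lt2) (ltnW lt1) (leqnn _).
rewrite -(mid ((f a).1, (f c).2) (ltnW lt1) (leqnn _) (leqnn _) (ltnW lt2)).
- move=> h; suff [e1 _] : ((f c).1, (f a).2) = ((f a).1, (f c).2) by move: lt1; rewrite e1 ltnn.
  apply: h; first by apply: contraTneq lt1 => /(congr1 fst) /= <-; rewrite ltnn.
  by apply: contraTneq lt2 => /(congr1 snd) /= <-; rewrite ltnn.
- by apply: contraTneq lt2 => /(congr1 snd) /= <-; rewrite ltnn.
by apply: contraTneq lt1 => /(congr1 fst) /= <-; rewrite ltnn.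
Qed.

Variables (F : fieldType) (I : finType) (s : F) (wt cA cO : int -> F).
Local Notation W := {ffun I -> F^o}.
Variables (T : nat -> {linear W -> W}) (e : filling -> W).
Hypothesis wt_neq0 : forall k, wt k != 0.
Hypothesis wt_inj : injective wt.
Hypothesis cA_ratio : forall k l, cA (l - k) = (s - 1) / (1 - wt l / wt k).
Hypothesis cA_opp : forall k, k != 0 -> (s - 1) - cA k = cA (- k).
Hypothesis cO_mul : forall k, k != 0 -> cO k * cO (- k) = (s - cA k) * (1 + cA k).
Hypothesis e_swap : forall f (a b : 'I_N), b = a.+1 :> nat -> tabb la f ->
  cO (gap f a b) != 0 -> tabb la (swap_word a b f).
Hypothesis T_tab : forall (f : filling) (a b : 'I_N), b = a.+1 :> nat -> tabb la f ->
  T a (e f) = cA (gap f a b) *: e f + cO (gap f a b) *: e (swap_word a b f).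
Hypothesis W_ind : forall P : W -> Prop, P 0 ->
  (forall c u v, P u -> P v -> P (c *: u + v)) ->
  (forall f, tabb la f -> P (e f)) -> forall u, P u.

Let T_comb1 i c (u v : W) : T i (c *: u + v) = c *: T i u + T i v.
Proof. by rewrite linearP. Qed.

Let T_comb i c d (u v : W) : T i (c *: u + d *: v) = c *: T i u + d *: T i v.
Proof. by rewrite linearD !linearZ. Qed.

Lemma T_guarded c (f : filling) (a b : 'I_N) :
  b = a.+1 :> nat -> (c != 0 -> tabb la f) ->
  c *: T a (e f) = c *: (cA (gap f a b) *: e f + cO (gap f a b) *: e (swap_word a b f)).
Proof.
by move=> hb; case: (eqVneq c 0) => [->|c0 hf]; rewrite ?scale0r // (T_tab hb) ?hf.
Qed.

Lemma T_quad i (u : W) : (i.+1 < N)%N ->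
  T i (T i u) = (s - 1) *: T i u + s *: u.
Proof.
move=> hi; pose a : 'I_N := Ordinal (ltnW hi); pose b : 'I_N := Ordinal hi.
have hb : b = a.+1 :> nat by [].
elim/W_ind: u => [|c u v hu hv|f hf].
- by rewrite !linear0 ?scaler0 addr0.
- rewrite !T_comb1 hu hv !scalerDr [in RHS]addrACA !scalerA.
  by rewrite [c * (s - 1)]mulrC [c * s]mulrC.
have g0 := gap_neq0 la_part hb hf; have go := e_swap hb hf.
rewrite -[i]/(val a) (T_tab hb hf) T_comb (T_tab hb hf).
rewrite (T_guarded hb go) gap_swap swap_wordK -(cA_opp g0).
exact: (quad_formal _ _ (cO_mul g0)).
Qed.

Lemma T_far i j (u : W) : (i.+1 < j)%N -> (j.+1 < N)%N ->
  T i (T j u) = T j (T i u).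
Proof.
move=> hij hj; have hi : (i.+1 < N)%N by lia.
pose a : 'I_N := Ordinal (ltnW hi); pose b : 'I_N := Ordinal hi.
pose c : 'I_N := Ordinal (ltnW hj); pose d : 'I_N := Ordinal hj.
have hb : b = a.+1 :> nat by []; have hd : d = c.+1 :> nat by [].
have [ca cb da db] : [/\ c != a, c != b, d != a & d != b].
  by rewrite -!(inj_eq val_inj) /=; split; lia.
elim/W_ind: u => [|k u v hu hv|f hf].
- by rewrite !linear0.
- rewrite (T_comb1 i k u) (T_comb1 j k u) (T_comb1 i k (T j u)).
  rewrite (T_comb1 j k (T i u)).
  by rewrite hu hv.
have g1 : gap (swap_word c d f) a b = gap f a b by rewrite /gap !ffunE !tpermD.
have g2 : gap (swap_word a b f) c d = gap f c d by rewrite /gap !ffunE !tpermD // eq_sym.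
have sw : swap_word c d (swap_word a b f) = swap_word a b (swap_word c d f).
  apply/ffunP => k; rewrite !ffunE; congr (f _).
  have [->|ka] := eqVneq k a; first by rewrite tpermL (tpermD ca da) tpermL (tpermD cb db).
  have [->|kb] := eqVneq k b; first by rewrite tpermR (tpermD cb db) tpermR (tpermD ca da).
  rewrite [tperm a b k]tpermD 1?eq_sym //.
  by case: (tpermP c d k) => [_|_|_ _]; rewrite tpermD // eq_sym.
rewrite -[i]/(val a) -[j]/(val c) (T_tab hb hf) (T_tab hd hf).
rewrite !T_comb (T_tab hb hf) (T_tab hd hf).
rewrite (T_guarded hb (e_swap hd hf)) (T_guarded hd (e_swap hb hf)).
rewrite g1 g2 sw; exact: far_formal.
Qed.

Lemma T_braid i (u : W) : (i.+2 < N)%N ->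
  T i (T i.+1 (T i u)) = T i.+1 (T i (T i.+1 u)).
Proof.
move=> hi; have hi1 : (i.+1 < N)%N by lia.
pose a : 'I_N := Ordinal (ltnW hi1); pose b : 'I_N := Ordinal hi1; pose c : 'I_N := Ordinal hi.
have hb : b = a.+1 :> nat by []; have hc : c = b.+1 :> nat by [].
have [ab bc ac] : [/\ a != b, b != c & a != c] by rewrite -!(inj_eq val_inj) /=; split; lia.
have [ba cb ca] : [/\ b != a, c != b & c != a] by rewrite ![_ == a]eq_sym [c == b]eq_sym.
elim/W_ind: u => [|k u v hu hv|f hf].
- by rewrite !linear0.
- rewrite (T_comb1 i k u) (T_comb1 i.+1 k u) (T_comb1 i.+1 k (T i u)).
  rewrite (T_comb1 i k (T i.+1 u)) (T_comb1 i k (T i.+1 (T i u))).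
  by rewrite (T_comb1 i.+1 k (T i (T i.+1 u))) hu hv.
rewrite -[i]/(val a) -[i.+1]/(val b).
set s1 := swap_word a b; set s2 := swap_word b c.
have E1 g : s1 g a = g b by rewrite ffunE tpermL.
have E2 g : s1 g b = g a by rewrite ffunE tpermR.
have E3 g : s1 g c = g c by rewrite ffunE tpermD.
have E4 g : s2 g a = g a by rewrite ffunE tpermD.
have E5 g : s2 g b = g c by rewrite ffunE tpermL.
have E6 g : s2 g c = g b by rewrite ffunE tpermR.
have s121 : s1 (s2 (s1 f)) = s2 (s1 (s2 f)).
  apply/ffunP => k.
  have [->|ka] := eqVneq k a; first by rewrite !(E1, E2, E3, E4, E5, E6).
  have [->|kb] := eqVneq k b; first by rewrite !(E1, E2, E3, E4, E5, E6).
  have [->|kc] := eqVneq k c; first by rewrite !(E1, E2, E3, E4, E5, E6).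
  by rewrite !ffunE !tpermD // eq_sym.
pose x := content (f a); pose y := content (f b); pose z := content (f c).
have cac : x != z := consecutive_contents hf hb hc.
have xy : y - x != 0 := gap_neq0 la_part hb hf.
have yz : z - y != 0 := gap_neq0 la_part hc hf.
pose X := wt x; pose Y := wt y; pose Z := wt z.
have sub0 k l : k != l -> wt k - wt l != 0.
  by move=> kl; rewrite subr_eq0; apply: contraNneq kl => /wt_inj ->.
have n0 := wt_neq0.
have g1 g : gap g a b = content (g b) - content (g a) by [].
have g2 g : gap g b c = content (g c) - content (g b) by [].
have E := (E1, E2, E3, E4, E5, E6).
have t1 : cO (y - x) != 0 -> tabb la (s1 f) := e_swap hb hf.
have t2 : cO (z - y) != 0 -> tabb la (s2 f) := e_swap hc hf.
have t12 : cO (y - x) * cO (z - x) != 0 -> tabb la (s2 (s1 f)).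
  by rewrite mulf_eq0 negb_or => /andP[/t1 h1 h2]; apply: e_swap; rewrite // g2 !E.
have t21 : cO (z - y) * cO (z - x) != 0 -> tabb la (s1 (s2 f)).
  by rewrite mulf_eq0 negb_or => /andP[/t2 h1 h2]; apply: e_swap; rewrite // g1 !E.
have oppxy : x - y = - (y - x) := subz_opp x y.
have oppyz : y - z = - (z - y) := subz_opp y z.
apply: (@braid_formal F I (T a) (T b) s X Y Z
  (e f) (e (s1 f)) (e (s2 f)) (e (s2 (s1 f)))
  (e (s1 (s2 f))) (e (s1 (s2 (s1 f))))
  (cO (y - x)) (cO (x - y)) (cO (z - x)) (cO (z - y)) (cO (y - z)));
  rewrite -?cA_ratio //.
- exact: n0.
- exact: n0.
- exact: n0.
- by apply: sub0; apply: contraNneq xy => ->; rewrite subrr.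
- by apply: sub0; apply: contraNneq yz => ->; rewrite subrr.
- exact: sub0.
- by rewrite oppxy cO_mul.
- by rewrite oppyz cO_mul.
- by rewrite (T_tab hb hf) g1.
- by rewrite (T_tab hc hf) g2.
- by rewrite (T_guarded hb t1) g1 !E /s1 swap_wordK.
- by rewrite (T_guarded hc t1) g2 !E.
- by rewrite (T_guarded hc t2) g2 !E /s2 swap_wordK.
- by rewrite (T_guarded hb t2) g1 !E.
- by rewrite !scalerA (T_guarded hb t12) g1 !E.
- by rewrite !scalerA (T_guarded hc t21) g2 !E s121.
Qed.

End SeminormalRelations.

(* The relations of the affine Hecke algebra on K[x] (x) V, reduced to those on the constants V: *)
(* each of them is stable under multiplication by a variable.                                     *)
Section InducedModule.

Variables (F : fieldType) (V M : lmodType F) (s q : F) (N : nat).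
Variables (TV : nat -> {linear V -> V}) (T x : nat -> {linear M -> M}) (w : {linear M -> M}).
Variable iota_V : {linear V -> M}.

Hypothesis N_gt1 : (1 < N)%N.
Hypothesis generated : forall P : M -> Prop,
  (forall f g, P f -> P g -> P (f + g)) -> (forall i f, (i < N)%N -> P f -> P (x i f)) ->
  (forall u, P (iota_V u)) -> forall f, P f.
Hypothesis quadV : forall i u, (i.+1 < N)%N -> TV i (TV i u) = (s - 1) *: TV i u + s *: u.
Hypothesis braidV : forall i u, (i.+2 < N)%N ->
  TV i (TV i.+1 (TV i u)) = TV i.+1 (TV i (TV i.+1 u)).
Hypothesis farV : forall i j u, (i.+1 < j)%N -> (j.+1 < N)%N ->
  TV i (TV j u) = TV j (TV i u).
Hypothesis T_iota : forall i u, (i.+1 < N)%N -> T i (iota_V u) = iota_V (TV i u).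
Hypothesis w_iota : forall u,
  w (iota_V u) = iota_V (foldl (fun v k => TV k v) u (iota 0 N.-1)).
Hypothesis Tx : forall i f, (i.+1 < N)%N -> T i (x i f) = x i.+1 (T i f + (1 - s) *: f).
Hypothesis TxS : forall i f, (i.+1 < N)%N ->
  T i (x i.+1 f) = x i (T i f) - (1 - s) *: x i.+1 f.
Hypothesis Tx_far : forall i j f, (i.+1 < N)%N -> (j < N)%N -> j != i -> j != i.+1 ->
  T i (x j f) = x j (T i f).
Hypothesis wx0 : forall f, w (x 0%N f) = q *: x N.-1 (w f).
Hypothesis wxS : forall j f, (j.+1 < N)%N -> w (x j.+1 f) = x j (w f).

Let c := 1 - s.

Lemma induced_quad i f : (i.+1 < N)%N -> T i (T i f) = (s - 1) *: T i f + s *: f.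
Proof.
move=> hi; have e : s - 1 = - c by rewrite opprB.
(* In this factored form the relation is transported by the commutation rules with variables, which
   involve the same combination. *)
suff : T i (T i f + c *: f) = s *: f.
  by rewrite linearD linearZ /= e scaleNr => <-; rewrite addrC addrK.
elim/generated: f => [f g hf hg|j f hj hf|u].
- by rewrite [T i (f + g)]linearD scalerDr addrACA linearD hf hg scalerDr.
- have [->|ji] := eqVneq j i.
    rewrite Tx // linearD TxS // hf [T i (c *: _)]linearZ /= Tx // -/c.
    by rewrite subrK linearZ.
  have [->|ji'] := eqVneq j i.+1.
    rewrite TxS // subrK Tx // (_ : _ + _ = s *: f) ?[LHS]linearZ //.
    by rewrite -hf linearD linearZ.
  by rewrite Tx_far // -linearZ -linearD Tx_far // hf linearZ.
- by rewrite T_iota // -linearZ -linearD T_iota // linearD linearZ /= quadV // e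
    addrAC scaleNr addNr add0r linearZ.
Qed.

Let TTc i f : (i.+1 < N)%N -> T i (T i f + c *: f) = s *: f.
Proof.
move=> hi; rewrite linearD linearZ /= induced_quad // addrAC -scalerDl /c.
by rewrite (_ : s - 1 + (1 - s) = 0) ?scale0r ?add0r //; ring.
Qed.

Let dl k u := foldl (fun v k => TV k v) u (iota 0 k).

Let dlS k u : dl k.+1 u = TV k (dl k u).
Proof. by rewrite /dl -addn1 iotaD foldl_cat. Qed.

Let dl_far k j u : (k < j)%N -> (j.+1 < N)%N -> dl k (TV j u) = TV j (dl k u).
Proof.
elim: k => [|k IH]; first by [].
move=> hk hj; rewrite (dlS k (TV j u)) (dlS k u) IH; try lia.
rewrite farV; [by []|lia|lia].
Qed.

Let dl_shift k i u : (i.+1 < k)%N -> (k < N)%N -> dl k (TV i.+1 u) = TV i (dl k u).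
Proof.
elim: k => // k IH hi hk; rewrite (dlS k (TV i.+1 u)) (dlS k u).
have [e|ne] := eqVneq k i.+1; last first.
  rewrite IH; try lia.
  rewrite [RHS]farV; [by []|lia|lia].
by subst k; rewrite (dlS i (TV i.+1 u)) (dlS i u) dl_far ?braidV.
Qed.

Lemma induced_far i j f : (i.+1 < j)%N -> (j.+1 < N)%N -> T i (T j f) = T j (T i f).
Proof.
move=> hij hj; have hi : (i.+1 < N)%N by lia.
elim/generated: f => [f g hf hg|k f hk hf|u].
- by rewrite !linearD hf hg.
- have [->|ki] := eqVneq k i.
    rewrite Tx_far // ?Tx // ?Tx_far //; try lia.
    by rewrite [T j (_ + _)]linearD [T j (_ *: _)]linearZ hf.
  have [->|ki'] := eqVneq k i.+1.
    rewrite [T j _]Tx_far //; try lia.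
    rewrite !TxS // linearB [T j (_ *: _)]linearZ /= !Tx_far ?hf //; lia.
  have [->|kj] := eqVneq k j.
    rewrite [T i (x j f)]Tx_far // ?Tx // ?Tx_far //; try lia.
    by rewrite [T i (_ + _)]linearD [T i (_ *: _)]linearZ hf.
  have [->|kj'] := eqVneq k j.+1.
    rewrite [T i (x _ f)]Tx_far //; try lia.
    rewrite !TxS // linearB [T i (_ *: _)]linearZ /= !Tx_far ?hf //; lia.
  by rewrite !Tx_far ?hf.
- by rewrite !T_iota // farV.
Qed.

Lemma induced_braid i f : (i.+2 < N)%N ->
  T i (T i.+1 (T i f)) = T i.+1 (T i (T i.+1 f)).
Proof.
move=> hi2; have hi : (i.+1 < N)%N by lia.
have hi0 : (i < N)%N by lia.
elim/generated: f => [f g hf hg|k f hk hf|u].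
- by rewrite !linearD hf hg.
- have [->|k0] := eqVneq k i.
    rewrite Tx // Tx // [T i (x i.+2 _)]Tx_far //; try lia.
    rewrite [T i.+1 (x i f)]Tx_far // ?[T i (x i _)]Tx // ?[T i.+1 (x i.+1 _)]Tx //; try lia.
    congr (x _ _); rewrite -/c.
    rewrite [T i.+1 (T i f + _)]linearD [T i.+1 (c *: f)]linearZ /= [LHS]linearD [T i (_ + _)]linearD /=.
    rewrite hf [T i (c *: (_ + _))]linearZ /= TTc // [T i (c *: _)]linearZ /=.
    rewrite [T i.+1 (T i _ + _)]linearD [T i.+1 (c *: _)]linearZ /= scalerDr -!addrA; congr (_ + _).
    rewrite addrCA; congr (_ + _); rewrite -scalerDr; congr (_ *: _).
    by rewrite -(TTc f hi2) linearD linearZ.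
  have [->|k1] := eqVneq k i.+1.
    rewrite TxS // linearB [T i.+1 (_ *: _)]linearZ /= Tx // ![T i.+1 (x i _)]Tx_far //; try lia.
    rewrite linearB [T i (_ *: _)]linearZ /= Tx // [T i (x i.+2 _)]Tx_far //; try lia.
    rewrite TxS // -/c; congr (_ - _); congr (x _ _).
    by rewrite hf [T i (T i.+1 f + _)]linearD [T i (c *: f)]linearZ [RHS]linearD [T i.+1 (c *: _)]linearZ.
  have [->|k2] := eqVneq k i.+2.
    have e1 : T i.+1 (x i.+2 (T i f)) = x i.+1 (T i.+1 (T i f)) - c *: x i.+2 (T i f).
      by rewrite TxS.
    have e2 : T i (x i.+2 (T i f)) = x i.+2 (T i (T i f)) by rewrite Tx_far //; lia.
    have e3 : T i (x i.+1 (T i.+1 f) - c *: x i.+2 f) =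
        x i (T i (T i.+1 f)) - c *: x i.+1 (T i.+1 f) - c *: x i.+2 (T i f).
      by rewrite linearB TxS // [T i (c *: _)]linearZ /= Tx_far //; lia.
    have e4 : T i.+1 (x i (T i (T i.+1 f))) = x i (T i.+1 (T i (T i.+1 f))).
      by rewrite Tx_far //; lia.
    rewrite [T i (x i.+2 f)]Tx_far //; try lia.
    rewrite e1 TxS // e3 linearB [T i (_ *: _)]linearZ /= e2 TxS // hf -/c.
    rewrite 2!linearB [T i.+1 (c *: x i.+1 _)]linearZ [T i.+1 (c *: x i.+2 _)]linearZ /=.
    rewrite e4 e1 Tx // -/c -!addrA; congr (_ + _).
    have -> : T i (T i f) = s *: f - c *: T i f by rewrite -(TTc f hi) linearD linearZ /= addrK.
    have -> : T i.+1 (T i.+1 f) + c *: T i.+1 f = s *: f.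
      by rewrite -(TTc f hi2) linearD linearZ.
    rewrite [x i.+2 (_ - _)]linearB [x i.+2 (c *: _)]linearZ /= -!opprD; congr (- _).
    by rewrite !scalerBr addrCA addrC -!addrA.
  by rewrite !Tx_far ?hf.
- by rewrite !T_iota // braidV.
Qed.

Lemma induced_wT i f : (i.+2 < N)%N -> w (T i.+1 f) = T i (w f).
Proof.
move=> hi; have hi1 : (i.+1 < N)%N by lia.
have wl g : w (x N.-1 g) = x N.-2 (w g).
  by rewrite (_ : N.-1 = N.-2.+1) ?wxS //; lia.
elim/generated: f => [f g hf hg|k f hk hf|u].
- by rewrite !linearD hf hg.
- have [->|k1] := eqVneq k i.+1.
    by rewrite Tx // !wxS // Tx // -hf [w (_ + _)]linearD [w (_ *: f)]linearZ.
  have [->|k2] := eqVneq k i.+2.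
    by rewrite TxS // linearB [w (_ *: _)]linearZ /= !wxS // TxS // hf.
  case: k hk k1 k2 => [|k] hk k1 k2.
    rewrite Tx_far // !wx0 hf [T i (_ *: _)]linearZ /= Tx_far //; lia.
  by rewrite Tx_far // !wxS // Tx_far ?hf //; lia.
- by rewrite T_iota // !w_iota T_iota // -/(dl _ _) dl_shift //; lia.
Qed.

Lemma induced_wwT f : w (w (T 0%N f)) = T N.-2 (w (w f)).
Proof.
have hN : (N.-2.+1 < N)%N by lia.
have eN : N.-1 = N.-2.+1 by lia.
have wwx0 g : w (w (x 0%N g)) = q *: x N.-2 (w (w g)).
  by rewrite wx0 linearZ /= eN wxS.
have wwx1 g : w (w (x 1%N g)) = q *: x N.-1 (w (w g)) by rewrite wxS // wx0.
elim/generated: f => [f g hf hg|k f hk hf|u].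
- by rewrite !linearD hf hg.
- have [->|k0] := eqVneq k 0%N.
    by rewrite Tx // wwx1 wwx0 linearZ /= Tx // -eN -hf !linearD ![w (_ *: _)]linearZ.
  have [->|k1] := eqVneq k 1%N.
    rewrite TxS // linearB linearB [w (_ *: _)]linearZ [w (_ *: _)]linearZ /= wwx0 !wwx1.
    by rewrite [RHS]linearZ /= eN TxS // hf scalerBr !scalerA [q * _]mulrC.
  case: k k0 k1 hk => // -[|k] // _ _ hk.
  by rewrite Tx_far // !wxS ?Tx_far ?hf //; lia.
- rewrite T_iota // !w_iota T_iota // -!/(dl _ _); congr (iota_V _).
  (* On constants [w] is the product [dl N.-1], and [dl'] is that product without its first factor.
     Moving it through another [dl N.-1] lowers all its indices by one ([sh]). *)
  pose dl' m v := foldl (fun v k => TV k v) v (iota 1 m).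
  have dlE v : dl N.-1 v = dl' N.-2 (TV 0%N v) by rewrite /dl eN.
  have sh m v : (m < N.-1)%N -> dl N.-1 (dl' m v) = dl m (dl N.-1 v).
    elim: m v => [|m IH] v hm //.
    have -> : dl' m.+1 v = TV m.+1 (dl' m v) by rewrite /dl' -[m.+1 in LHS]addn1 iotaD foldl_cat.
    by rewrite dl_shift ?IH ?(dlS m) //; lia.
  have -> v : dl N.-1 v = TV N.-2 (dl N.-2 v) by rewrite eN dlS.
  by rewrite -sh ?dlE //; lia.
Qed.

End InducedModule.

(** * Divided differences, exchanges of variables and degrees *)

Section Polynomials.

Variable N : nat.
Local Notation P := {mpoly KK[N]}.
Implicit Types (p r : P) (m : 'X_{1..N}).
Local Opaque KK.

Lemma XnE (j : 'I_N) : Xn N j = 'X_j.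
Proof. by rewrite /Xn valK. Qed.

Lemma Xn_lt j (hj : (j < N)%N) : Xn N j = 'X_(Ordinal hj).
Proof. by rewrite -[j in LHS]/(val (Ordinal hj)) XnE. Qed.

Definition degree_le d p := (msize p <= d.+1)%N.

Lemma degree_le0 d : degree_le d 0.
Proof. by rewrite /degree_le msize0. Qed.

Lemma degree_leD d p r : degree_le d p -> degree_le d r -> degree_le d (p + r).
Proof.
by move=> hp hr; apply: leq_trans (mmeasureD_le _ _ _) _; rewrite geq_max; apply/andP.
Qed.

Lemma degree_leZ d c p : degree_le d p -> degree_le d (c *: p).
Proof. by move=> hp; apply: leq_trans (msizeZ_le _ _) hp. Qed.

Lemma degree_leM d e p r : degree_le d p -> degree_le e r -> degree_le (d + e) (p * r).
Proof.
rewrite /degree_le => hp hr.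
have [->|p0] := eqVneq p 0; first by rewrite mul0r msize0.
have [->|r0] := eqVneq r 0; first by rewrite mulr0 msize0.
rewrite msizeM //; move: (msize p) (msize r) hp hr => k l; lia.
Qed.

Lemma degree_le_sum (I : Type) (s : seq I) (Q : pred I) (G : I -> P) d :
  (forall i, Q i -> degree_le d (G i)) -> degree_le d (\sum_(i <- s | Q i) G i).
Proof.
by move=> h; elim/big_rec: _ => [|i p Qi hp]; [apply: degree_le0|apply: degree_leD; auto].
Qed.

Lemma degree_leX (j : nat) : degree_le 1 (Xn N j).
Proof.
rewrite /Xn /degree_le; case: insubP => [i _ _|_]; last by rewrite msize0.
by rewrite msizeX mdeg1.
Qed.

Lemma degree_le_mmap (h : 'I_N -> P) d p : (forall i, degree_le 1 (h i)) ->
  degree_le d p -> degree_le d (mmap (@mpolyC N KK) h p).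
Proof.
move=> hh hp; rewrite /mmap big_seq; apply: degree_le_sum => m hm.
have hd : (mdeg m <= d)%N by rewrite -ltnS; apply: leq_trans (msize_mdeg_lt hm) hp.
rewrite mul_mpolyC; apply: degree_leZ.
suff : degree_le (mdeg m) (mmap1 h m) by move=> h1; apply: leq_trans h1 _.
have hX i n : degree_le n (h i ^+ n).
  elim: n => [|n IH]; first by rewrite expr0 /degree_le msize1.
  by rewrite exprS -add1n; apply: degree_leM.
rewrite mdegE /mmap1; elim/big_rec2: _ => [|i y1 y2 _ hy]; first by rewrite /degree_le msize1.
exact: degree_leM.
Qed.

(** Replaces the support of [p] by a range of monomials common to several polynomials, which gives
    linearity. *)
Lemma ddE i p k : (msize p <= k)%N ->
  dd i p = \sum_(m : 'X_{1..N < k}) p@_m *: ddmon i m.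
Proof.
move=> le_pk; rewrite /dd; set I : subFinType _ := 'X_{1..N < k}.
rewrite (big_mksub I) ?msupp_uniq //=; first last.
  by move=> x /msize_mdeg_lt /leq_trans; apply.
by rewrite big_rmcond //= => j /memN_msupp_eq0 ->; rewrite scale0r.
Qed.

Lemma dd_linear i : linear (@dd N i).
Proof.
move=> c p r; pose k := maxn (msize p) (msize r).
have hp : (msize p <= k)%N by apply: leq_maxl.
have hr : (msize r <= k)%N by apply: leq_maxr.
have hs : (msize (c *: p + r) <= k)%N.
  apply: leq_trans (mmeasureD_le _ _ _) _; rewrite geq_max hr andbT.
  exact: leq_trans (msizeZ_le _ _) hp.
rewrite (ddE _ hp) (ddE _ hr) (ddE _ hs) scaler_sumr -big_split /=.
by apply: eq_bigr => m _; rewrite mcoeffD mcoeffZ scalerDl scalerA.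
Qed.
HB.instance Definition _ i := GRing.isLinear.Build KK P P *:%R (@dd N i) (dd_linear i).

Section Swap.

Variables (a b : 'I_N).
Hypothesis hb : b = a.+1 :> nat.

Let nab : a != b.
Proof. by rewrite -val_eqE /= hb neq_ltn ltnSn. Qed.

Let hba : ((b : nat) == a) = false.
Proof. by rewrite hb gtn_eqF. Qed.

Lemma swapP_msym p : swapP a p = msym (tperm a b) p.
Proof.
rewrite /swapP /msym /mmap; apply: eq_bigr => m _; congr (_ * _); apply: mmap1_eq => j.
rewrite -hb !XnE; case: tpermP => [->|->|/eqP ja /eqP jb]; rewrite ?eqxx //.
  by rewrite hba.
by rewrite !ifN.
Qed.

Lemma swapP_X (j : nat) :
  swapP a (Xn N j) = Xn N (if j == a :> nat then b : nat else if j == b :> nat then a : nat else j).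
Proof.
rewrite swapP_msym /Xn; case: insubP => [i _ <-|hj]; last first.
  rewrite msym0 insubF //; apply: negbTE.
  case: eqP => [ja|_]; first by rewrite ja ltn_ord in hj.
  by case: eqP => [jb|_]; first by rewrite jb ltn_ord in hj.
rewrite -[LHS]/(mmap _ _ 'X_i) mmapX mmap1U.
case: tpermP => [->|->|/eqP ja /eqP jb]; rewrite ?eqxx ?valK //.
  by rewrite hba valK.
by rewrite !ifN // valK.
Qed.

Lemma swapP_linear : linear (@swapP N a).
Proof. by move=> c p r; rewrite !swapP_msym msymD msymZ. Qed.

Lemma swapPM p r : swapP a (p * r) = swapP a p * swapP a r.
Proof. by rewrite !swapP_msym msymM. Qed.

Lemma mexpE (m : 'X_{1..N}) (j : 'I_N) : mexp m j = m j.
Proof. by rewrite /mexp valK. Qed.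

Lemma setm_factor m e1 e2 :
  'X_[setm a m e1 e2] = 'X_a ^+ e1 * 'X_b ^+ e2 * 'X_[setm a m 0 0] :> P.
Proof.
rewrite !mpolyXn -!mpolyXD; congr 'X_[_]; apply/mnmP => j.
rewrite !mnmDE !mulmnE !mnm1E !mnmE -hb ![_ == j]eq_sym.
have -> : ((j : nat) == a) = (j == a) by [].
have -> : ((j : nat) == b) = (j == b) by [].
by case: (eqVneq j a) => [->|ja]; case: (eqVneq _ b) => [e|jb] //=;
  rewrite ?mul1n ?mul0n ?addn0 ?add0n //; move: nab; rewrite e eqxx.
Qed.

Lemma Xsub_neq0 : 'X_a - 'X_b != 0 :> P.
Proof.
apply/eqP => /(congr1 (mcoeff U_(a))); rewrite mcoeffB !mcoeffXU eqxx eq_sym (negPf nab).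
by rewrite subr0 mcoeff0 => /eqP; rewrite oner_eq0.
Qed.

(** After the common power of the two variables is taken out, this is the telescoping of a geometric
    sum; the sign in [ddmon] covers the opposite order of the exponents. *)
Lemma ddmon_eq m : ('X_a - 'X_b) * ddmon a m = 'X_[m] - swapP a 'X_[m] :> P.
Proof.
have em : m = setm a m (m a) (m b).
  apply/mnmP => j; rewrite mnmE -hb.
  by case: eqP => [/val_inj ->|_] //; case: eqP => [/val_inj ->|_].
have es : swapP a 'X_[m] = 'X_[setm a m (m b) (m a)] :> P.
  rewrite swapP_msym msymX tpermV; congr 'X_[_]; apply/mnmP => j; rewrite !mnmE -hb.
  case: tpermP => [->|->|/eqP ja /eqP jb]; rewrite ?eqxx //.
    by rewrite hba.
  by rewrite !ifN.
rewrite es setm_factor.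
have -> : 'X_[m] = 'X_a ^+ m a * 'X_b ^+ m b * 'X_[setm a m 0 0] :> P by rewrite -setm_factor -em.
rewrite /ddmon -hb !mexpE (eq_bigr _ (fun k _ => setm_factor m _ _)).
move: ('X_[setm a m 0 0] : P) ('X_a : P) ('X_b : P) (m a) (m b) => r x y k l.
rewrite -mulr_suml !mulrA -mulrBl; congr (_ * _).
have key c d :
    (x - y) * (\sum_(i < d) x ^+ (c + i) * y ^+ (c + (d.-1 - i))) =
    x ^+ (c + d) * y ^+ c - x ^+ c * y ^+ (c + d).
  have -> : \sum_(i < d) x ^+ (c + i) * y ^+ (c + (d.-1 - i)) =
      x ^+ c * y ^+ c * \sum_(i < d) y ^+ (d.-1 - i) * x ^+ i.
    by rewrite mulr_sumr; apply: eq_bigr => i _; rewrite !exprD; ring.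
  have e := subrXX y x d; move: (\sum_(i < d) _) e => S e.
  transitivity (- (x ^+ c * y ^+ c * ((y - x) * S))); first by ring.
  by rewrite -e !exprD; ring.
case: (leqP l k) => h.
  by rewrite mulr1 key subnKC.
by rewrite mulrN1 mulNr key subnKC ?(ltnW h) // opprB.
Qed.

Lemma dd_eq p : ('X_a - 'X_b) * dd a p = p - swapP a p.
Proof.
elim/mpolyind: p => [|c m p _ _ IH].
  by rewrite (linear0 (@dd N a)) swapP_msym msym0 mulr0 subr0.
rewrite (dd_linear a c) swapP_linear mulrDr IH -scalerAr.
have -> : dd a 'X_[m] = ddmon a m by rewrite /dd msuppX big_seq1 mcoeffX eqxx scale1r.
by rewrite ddmon_eq scalerBr opprD addrACA.
Qed.

Lemma dd_cancel p r : ('X_a - 'X_b) * r = p - swapP a p -> dd a p = r.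
Proof. by rewrite -dd_eq => /(mulfI Xsub_neq0). Qed.

Lemma dd_Xa p : dd a ('X_a * p) = 'X_b * dd a p + p.
Proof.
apply: dd_cancel; rewrite swapPM -XnE swapP_X eqxx !XnE mulrDr mulrCA dd_eq; ring.
Qed.

Lemma dd_Xb p : dd a ('X_b * p) = 'X_a * dd a p - p.
Proof.
apply: dd_cancel; rewrite swapPM -!XnE swapP_X hba eqxx !XnE mulrBr mulrCA dd_eq; ring.
Qed.

Lemma dd_X_far j p : j != a -> j != b -> dd a ('X_j * p) = 'X_j * dd a p.
Proof.
move=> ja jb; apply: dd_cancel; rewrite swapPM -[in swapP a 'X_j]XnE swapP_X !ifN //.
by rewrite XnE mulrCA dd_eq mulrBr.
Qed.

(** The divided difference times a nonzero polynomial of degree one is [p - swapP a p], so division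
    lowers the degree by one and the variable restores it. *)
Lemma degree_le_dd d p : degree_le d p -> degree_le d (Xn N a.+1 * dd a p).
Proof.
move=> hp; rewrite -hb XnE.
have [->|dn0] := eqVneq (dd a p) 0; first by rewrite mulr0 degree_le0.
have hs : degree_le d (p - swapP a p).
  apply: degree_leD => //; rewrite -scaleN1r; apply: degree_leZ.
  rewrite swapP_msym; apply: degree_le_mmap => // i.
  by rewrite -XnE; apply: degree_leX.
have Xb0 : 'X_b != 0 :> P by rewrite -msize_poly_eq0 msizeX.
have size_sub : (1 < msize ('X_a - 'X_b : P))%N.
  apply: leq_trans (msize_mdeg_lt (m := U_(a)%MM) _); first by rewrite mdeg1.
  by rewrite mcoeff_msupp mcoeffB !mcoeffXU eqxx [b == a]eq_sym (negPf nab) subr0 oner_neq0.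
move: hs; rewrite /degree_le -dd_eq !msizeM ?Xsub_neq0 // msizeX mdeg1.
move: size_sub; move: (msize ('X_a - 'X_b : P)) (msize (dd a p)) => k l; lia.
Qed.

End Swap.

Lemma degree_le_swapP i d p : degree_le d p -> degree_le d (swapP i p).
Proof.
apply: degree_le_mmap => j; case: ifP => _; first exact: degree_leX.
by case: ifP => _; [exact: degree_leX|rewrite -XnE; exact: degree_leX].
Qed.

Lemma degree_le_wP d p : degree_le d p -> degree_le d (wP p).
Proof.
apply: degree_le_mmap => j; case: ifP => _; last exact: degree_leX.
by apply: degree_leZ; apply: degree_leX.
Qed.

Lemma wP_linear : linear (@wP N).
Proof.
by move=> c p r; rewrite /wP (mmapD _ (@mpolyC N KK)) (mmapZ _ (@mpolyC N KK)) mul_mpolyC.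
Qed.

Lemma wPM p r : wP (p * r) = wP p * wP r.
Proof. exact: (rmorphM (mmap (@mpolyC N KK) _)). Qed.

Lemma wP_X (j : 'I_N) : wP 'X_j = if val j == 0%N then qq *: Xn N N.-1 else Xn N (val j).-1.
Proof. by rewrite /wP (mmapX _ (@mpolyC N KK)) mmap1U. Qed.

End Polynomials.

(** * Commutation of T_i and w with variables and constants, for abstract coefficients *)

Section TensorOperators.

Variables (F : fieldType) (P : comAlgType F) (I : finType) (s q : F) (N : nat).
Local Notation V := {ffun I -> F^o}.
Local Notation Mod := {ffun I -> P}.
Variables (X : nat -> P) (dd sw : nat -> {linear P -> P}) (wp : {linear P -> P}).
Variables (cH : nat -> I -> I -> F) (cW : I -> I -> F).
Variables (H : nat -> Mod -> Mod) (W : Mod -> Mod) (HV : nat -> V -> V) (WV : V -> V).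

Hypothesis HE : forall i (f : Mod) u,
  H i f u = (1 - s) *: (X i.+1 * dd i (f u)) + \sum_t cH i t u *: sw i (f t).
Hypothesis WE : forall (f : Mod) u, W f u = \sum_t cW t u *: wp (f t).
Hypothesis HVE : forall i (v : V) u, HV i v u = \sum_t v t * cH i t u.
Hypothesis WVE : forall (v : V) u, WV v u = \sum_t v t * cW t u.

Definition mulX (j : nat) (f : Mod) : Mod := [ffun u => X j * f u].
Definition const_vec (v : V) : Mod := [ffun t => (v t : F)%:A].

Lemma tensor_H_linear i : linear (H i).
Proof.
move=> c f g; apply/ffunP => u; rewrite !(ffunE, HE).
have -> : \sum_t cH i t u *: sw i ((c *: f + g) t) =
  c *: (\sum_t cH i t u *: sw i (f t)) + \sum_t cH i t u *: sw i (g t).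
  rewrite scaler_sumr -big_split /=; apply: eq_bigr => t _.
  by rewrite !ffunE linearP scalerDr !scalerA [c * _]mulrC.
by rewrite linearP mulrDr -scalerAr !scalerDr addrACA !scalerA [c * _]mulrC.
Qed.

Lemma tensor_W_linear : linear W.
Proof.
move=> c f g; apply/ffunP => u; rewrite !(ffunE, WE) scaler_sumr -big_split /=.
by apply: eq_bigr => t _; rewrite !ffunE linearP scalerDr !scalerA [c * _]mulrC.
Qed.

Hypothesis swM : forall i, (i.+1 < N)%N -> forall p r, sw i (p * r) = sw i p * sw i r.
Hypothesis swX : forall i, (i.+1 < N)%N -> sw i (X i) = X i.+1.
Hypothesis swXS : forall i, (i.+1 < N)%N -> sw i (X i.+1) = X i.
Hypothesis swX_far : forall i j, (i.+1 < N)%N -> (j < N)%N -> j != i -> j != i.+1 ->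
  sw i (X j) = X j.
Hypothesis ddX : forall i, (i.+1 < N)%N -> forall p, dd i (X i * p) = X i.+1 * dd i p + p.
Hypothesis ddXS : forall i, (i.+1 < N)%N -> forall p, dd i (X i.+1 * p) = X i * dd i p - p.
Hypothesis ddX_far : forall i j, (i.+1 < N)%N -> (j < N)%N -> j != i -> j != i.+1 ->
  forall p, dd i (X j * p) = X j * dd i p.
Hypothesis sw1 : forall i, (i.+1 < N)%N -> sw i 1 = 1.
Hypothesis dd1 : forall i, (i.+1 < N)%N -> dd i 1 = 0.
Hypothesis wp1 : wp 1 = 1.
Hypothesis wpM : forall p r, wp (p * r) = wp p * wp r.
Hypothesis wpX0 : wp (X 0%N) = q *: X N.-1.
Hypothesis wpXS : forall j, (j.+1 < N)%N -> wp (X j.+1) = X j.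

Lemma tensor_mulX i f : (i.+1 < N)%N ->
  H i (mulX i f) = mulX i.+1 (H i f + (1 - s) *: f).
Proof.
move=> hi; apply/ffunP => u; rewrite !(ffunE, HE) ddX //.
have -> : \sum_t cH i t u *: sw i (mulX i f t) = X i.+1 * \sum_t cH i t u *: sw i (f t).
  by rewrite mulr_sumr; apply: eq_bigr => t _; rewrite ffunE swM // swX // -scalerAr.
by rewrite !mulrDr scalerDr -!scalerAr addrAC.
Qed.

Lemma tensor_mulXS i f : (i.+1 < N)%N ->
  H i (mulX i.+1 f) = mulX i (H i f) - (1 - s) *: mulX i.+1 f.
Proof.
move=> hi; apply/ffunP => u; rewrite !(ffunE, HE) ddXS //.
have -> : \sum_t cH i t u *: sw i (mulX i.+1 f t) = X i * \sum_t cH i t u *: sw i (f t).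
  by rewrite mulr_sumr; apply: eq_bigr => t _; rewrite ffunE swM // swXS // -scalerAr.
by rewrite mulrBr scalerBr mulrDr -!scalerAr mulrCA addrAC.
Qed.

Lemma tensor_mulX_far i j f : (i.+1 < N)%N -> (j < N)%N -> j != i -> j != i.+1 ->
  H i (mulX j f) = mulX j (H i f).
Proof.
move=> hi hj ji ji'; apply/ffunP => u; rewrite !(ffunE, HE) ddX_far //.
have -> : \sum_t cH i t u *: sw i (mulX j f t) = X j * \sum_t cH i t u *: sw i (f t).
  by rewrite mulr_sumr; apply: eq_bigr => t _; rewrite ffunE swM // swX_far // -scalerAr.
by rewrite mulrDr mulrCA -scalerAr.
Qed.

Lemma tensor_W_mulX0 f : W (mulX 0 f) = q *: mulX N.-1 (W f).
Proof.
apply/ffunP => u; rewrite !(ffunE, WE) mulr_sumr scaler_sumr; apply: eq_bigr => t _.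
by rewrite ffunE wpM wpX0 -scalerAr -scalerAl !scalerA mulrC.
Qed.

Lemma tensor_W_mulXS j f : (j.+1 < N)%N -> W (mulX j.+1 f) = mulX j (W f).
Proof.
move=> hj; apply/ffunP => u; rewrite !(ffunE, WE) mulr_sumr; apply: eq_bigr => t _.
by rewrite ffunE wpM wpXS // -scalerAr.
Qed.

Lemma tensor_const i v : (i.+1 < N)%N -> H i (const_vec v) = const_vec (HV i v).
Proof.
move=> hi; apply/ffunP => u; rewrite !(ffunE, HE) linearZ /= dd1 // scaler0 mulr0 scaler0 add0r.
rewrite HVE scaler_suml; apply: eq_bigr => t _.
by rewrite ffunE linearZ /= sw1 // scalerA mulrC.
Qed.

Lemma tensor_W_const v : W (const_vec v) = const_vec (WV v).
Proof.
apply/ffunP => u; rewrite !(ffunE, WE) WVE scaler_suml; apply: eq_bigr => t _.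
by rewrite ffunE linearZ /= wp1 scalerA mulrC.
Qed.

End TensorOperators.

(** * The concrete operators on polynomials with values in V_lambda *)

Section VectorValued.

Variables (N : nat) (la : seq nat).
Local Notation P := {mpoly KK[N]}.
Local Notation Vect := {ffun Tab N la -> KK^o}.
Local Notation Mod := {ffun Tab N la -> {mpoly KK[N]}}.

Lemma mmap_linear (h : 'I_N -> P) : linear (mmap (@mpolyC N KK) h).
Proof.
by move=> c p r; rewrite (mmapD _ (@mpolyC N KK)) (mmapZ _ (@mpolyC N KK)) mul_mpolyC.
Qed.

Lemma swapP_is_linear i : linear (@swapP N i).
Proof. exact: mmap_linear. Qed.
HB.instance Definition _ i := GRing.isLinear.Build KK P P *:%R (@swapP N i) (swapP_is_linear i).
HB.instance Definition _ := GRing.isLinear.Build KK P P *:%R (@wP N) (@wP_linear N).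

Definition hecke_coef i (t u : Tab N la) : KK := heckeB i t u.
Definition w_coef (t u : Tab N la) : KK := wB t u.
Definition w_vec (v : Vect) : Vect := foldl (fun v k => heckeV k v) v (iota 0 N.-1).

Lemma heckeM_E i (f : Mod) u : heckeM i f u =
  (1 - ss) *: (Xn N i.+1 * dd i (f u)) + \sum_t hecke_coef i t u *: swapP i (f t).
Proof. by rewrite {1}/heckeM ffunE. Qed.

Lemma wM_E (f : Mod) u : wM f u = \sum_t w_coef t u *: wP (f t).
Proof. by rewrite {1}/wM ffunE. Qed.

Lemma heckeV_E i (v : Vect) u : heckeV i v u = \sum_t v t * hecke_coef i t u.
Proof. by rewrite {1}/heckeV sum_ffunE; apply: eq_bigr => t _; rewrite ffunE. Qed.

Lemma w_vec_linear : linear w_vec.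
Proof.
rewrite /w_vec; elim: (iota 0 N.-1) => [|k l IH] c v v' //=.
by rewrite heckeV_linear IH.
Qed.
HB.instance Definition _ := GRing.isLinear.Build KK Vect Vect *:%R w_vec w_vec_linear.

Lemma w_vec_E (v : Vect) u : w_vec v u = \sum_t v t * w_coef t u.
Proof.
rewrite {1}(vect_delta v) linear_sum sum_ffunE; apply: eq_bigr => t _.
by rewrite linearZ ffunE.
Qed.

Lemma heckeM_linear i : linear (@heckeM N la i).
Proof. exact: (tensor_H_linear (heckeM_E)). Qed.
HB.instance Definition _ i := GRing.isLinear.Build KK Mod Mod *:%R (@heckeM N la i) (heckeM_linear i).

Lemma wM_linear : linear (@wM N la).
Proof. exact: (tensor_W_linear (wM_E)). Qed.
HB.instance Definition _ := GRing.isLinear.Build KK Mod Mod *:%R (@wM N la) wM_linear.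

Definition var_mul (j : nat) (f : Mod) : Mod := [ffun u => Xn N j * f u].
Definition const_tensor (v : Vect) : Mod := [ffun t => (v t : KK) *: 1].

Lemma var_mul_linear j : linear (var_mul j).
Proof. by move=> c f g; apply/ffunP => u; rewrite !ffunE mulrDr -scalerAr. Qed.
HB.instance Definition _ j := GRing.isLinear.Build KK Mod Mod *:%R (var_mul j) (var_mul_linear j).

Lemma const_tensor_linear : linear const_tensor.
Proof. by move=> c f g; apply/ffunP => u; rewrite !ffunE scalerDl scalerA. Qed.
HB.instance Definition _ := GRing.isLinear.Build KK Vect Mod *:%R const_tensor const_tensor_linear.

Lemma ord_pair i : (i.+1 < N)%N -> exists a b : 'I_N, [/\ a = i :> nat & b = a.+1 :> nat].
Proof. by move=> hi; exists (Ordinal (ltnW hi)), (Ordinal hi). Qed.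

Lemma swapP_mul i : (i.+1 < N)%N -> forall p r : P, swapP i (p * r) = swapP i p * swapP i r.
Proof. by case/ord_pair => a [b [<- hb]]; apply: (swapPM hb). Qed.

Lemma swapP_Xn i : (i.+1 < N)%N -> swapP i (Xn N i) = Xn N i.+1.
Proof. by case/ord_pair => a [b [<- hb]]; rewrite (swapP_X hb) eqxx hb. Qed.

Lemma swapP_XnS i : (i.+1 < N)%N -> swapP i (Xn N i.+1) = Xn N i.
Proof. by case/ord_pair => a [b [<- hb]]; rewrite -hb (swapP_X hb) hb gtn_eqF // eqxx. Qed.

Lemma swapP_Xn_far i j : (i.+1 < N)%N -> (j < N)%N -> j != i -> j != i.+1 ->
  swapP i (Xn N j) = Xn N j.
Proof. by case/ord_pair => a [b [<- hb]] hj; rewrite -hb (swapP_X hb) => /negPf -> /negPf ->. Qed.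

Lemma dd_Xn i : (i.+1 < N)%N -> forall p : P, dd i (Xn N i * p) = Xn N i.+1 * dd i p + p.
Proof. by case/ord_pair => a [b [<- hb]] p; rewrite -hb !XnE (dd_Xa hb). Qed.

Lemma dd_XnS i : (i.+1 < N)%N -> forall p : P, dd i (Xn N i.+1 * p) = Xn N i * dd i p - p.
Proof. by case/ord_pair => a [b [<- hb]] p; rewrite -hb !XnE (dd_Xb hb). Qed.

Lemma dd_Xn_far i j : (i.+1 < N)%N -> (j < N)%N -> j != i -> j != i.+1 ->
  forall p : P, dd i (Xn N j * p) = Xn N j * dd i p.
Proof.
case/ord_pair => a [b [<- hb]] hj ja jb p; rewrite (Xn_lt hj) (dd_X_far hb) //.
by rewrite -val_eqE /= hb.
Qed.

Lemma swapP_1 i : swapP i (1 : P) = 1.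
Proof. by rewrite /swapP -mpolyC1 (mmapC _ (@mpolyC N KK)). Qed.

Lemma dd_1 i : (i.+1 < N)%N -> dd i (1 : P) = 0.
Proof.
by case/ord_pair => a [b [<- hb]]; apply: (dd_cancel hb); rewrite swapP_1 subrr mulr0.
Qed.

Lemma wP_1 : wP (1 : P) = 1.
Proof. by rewrite /wP -mpolyC1 (mmapC _ (@mpolyC N KK)). Qed.

Lemma wP_Xn0 : (0 < N)%N -> wP (Xn N 0) = qq *: Xn N N.-1.
Proof. by move=> hN; rewrite (Xn_lt hN) wP_X. Qed.

Lemma wP_XnS j : (j.+1 < N)%N -> wP (Xn N j.+1) = Xn N j.
Proof. by move=> hj; rewrite (Xn_lt hj) wP_X. Qed.

Lemma mod_generated (Q : Mod -> Prop) :
  (forall f g, Q f -> Q g -> Q (f + g)) -> (forall i f, (i < N)%N -> Q f -> Q (var_mul i f)) ->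
  (forall u, Q (const_tensor u)) -> forall f, Q f.
Proof.
move=> QD QX Qc f; pose mulp (p : P) (g : Mod) : Mod := [ffun u => p * g u].
have mulp_mon m g : Q g -> Q (mulp 'X_[m] g).
  rewrite mpolyXE_id; elim/big_rec: _ g => [|i p _ IH] g Qg.
    by rewrite (_ : mulp 1 g = g) //; apply/ffunP => u; rewrite ffunE mul1r.
  have IHn : Q (mulp p g) by apply: IH.
  elim: (m i) => [|k IHk].
    by rewrite expr0 mul1r; exact: IHn.
  rewrite (_ : mulp _ g = var_mul i (mulp ('X_i ^+ k * p) g)); first by apply: QX.
  by apply/ffunP => u; rewrite !ffunE XnE exprS !mulrA.
have Q0 : Q 0 by have := Qc 0; rewrite (linear0 const_tensor).
pose single t (p : P) : Mod := [ffun u => if u == t then p else 0].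
have Qs t p : Q (single t p).
  elim/mpolyind: p => [|c m p _ _ IH].
    by rewrite (_ : single t 0 = 0) //; apply/ffunP => u; rewrite !ffunE if_same.
  rewrite (_ : single t _ = mulp 'X_[m] (const_tensor (c *: delta t)) + single t p).
    by apply: QD => //; apply: mulp_mon.
  apply/ffunP => u; rewrite !ffunE; case: eqP => _; last first.
    by rewrite [c *: _]mulr0 scale0r mulr0 addr0.
  by rewrite [c *: true%:R]mulr1 -scalerAr mulr1.
rewrite (_ : f = \sum_t single t (f t)); first by elim/big_rec: _ => // t g _; apply: QD.
apply/ffunP => u; rewrite sum_ffunE (bigD1 u) //= big1 ?addr0; first by rewrite ffunE eqxx.
by move=> t /negPf tu; rewrite ffunE eq_sym tu.
Qed.

Definition mod_degree_le d (f : Mod) : Prop := forall u, degree_le d (f u).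

Lemma heckeM_degree i d f : (i.+1 < N)%N -> mod_degree_le d f -> mod_degree_le d (heckeM i f).
Proof.
move=> hi hf u; rewrite heckeM_E; apply: degree_leD; last first.
  by apply: degree_le_sum => t _; apply: degree_leZ; apply: degree_le_swapP.
by case/ord_pair: hi => a [b [<- hb]]; apply: degree_leZ; apply: (degree_le_dd hb).
Qed.

Lemma wM_degree d f : mod_degree_le d f -> mod_degree_le d (wM f).
Proof.
move=> hf u; rewrite wM_E; apply: degree_le_sum => t _; apply: degree_leZ; exact: degree_le_wP.
Qed.

Lemma var_mul_degree j d f : mod_degree_le d f -> mod_degree_le d.+1 (var_mul j f).
Proof. by move=> hf u; rewrite ffunE -add1n; apply: degree_leM => //; apply: degree_leX. Qed.

Lemma const_tensor_degree u : mod_degree_le 0 (const_tensor u).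
Proof. by move=> t; rewrite ffunE; apply: degree_leZ; rewrite /degree_le msize1. Qed.

End VectorValued.

(** * The affine Hecke relations for the concrete operators *)

Section HeckeRelations.

Variables (N : nat) (la : seq nat).
Hypothesis N_gt1 : (1 < N)%N.
Hypothesis la_part : is_partition N la.
Local Notation P := {mpoly KK[N]}.
Local Notation Vect := {ffun Tab N la -> KK^o}.
Local Notation Mod := {ffun Tab N la -> {mpoly KK[N]}}.

Definition TV (i : nat) : {linear Vect -> Vect} := @heckeV N la i.
Definition TM (i : nat) : {linear Mod -> Mod} := @heckeM N la i.
Definition WM : {linear Mod -> Mod} := @wM N la.
Definition XM (i : nat) : {linear Mod -> Mod} := @var_mul N la i.
Definition iotaM : {linear Vect -> Mod} := @const_tensor N la.

Definition ss_wt (k : int) : KK := ss ^ k.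

Lemma ss_wt_neq0 k : ss_wt k != 0.
Proof. exact: (expfz_neq0 _ ss_neq0). Qed.

Lemma coefA_ratio (k l : int) : coefA (l - k) = (ss - 1) / (1 - ss_wt l / ss_wt k).
Proof. by rewrite /coefA /ss_wt expfzDr ?ss_neq0 // invr_expz. Qed.

Lemma TV_quad i u : (i.+1 < N)%N -> TV i (TV i u) = (ss - 1) *: TV i u + ss *: u.
Proof.
exact: (T_quad la_part (T := TV) (e := @tab_vec N la) coefA_opp coefO_mul (tabb_swap la_part) (heckeV_tab la_part)
  (@vect_ind N la)).
Qed.

Lemma TV_far i j u : (i.+1 < j)%N -> (j.+1 < N)%N -> TV i (TV j u) = TV j (TV i u).
Proof.
exact: (T_far la_part (T := TV) (e := @tab_vec N la) (cA := coefA) (tabb_swap la_part) (heckeV_tab la_part) (@vect_ind N la)).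
Qed.

Lemma TV_braid i u : (i.+2 < N)%N -> TV i (TV i.+1 (TV i u)) = TV i.+1 (TV i (TV i.+1 u)).
Proof.
exact: (T_braid la_part (T := TV) (e := @tab_vec N la) ss_wt_neq0 ss_exp_inj coefA_ratio coefO_mul
  (tabb_swap la_part) (heckeV_tab la_part) (@vect_ind N la)).
Qed.

Lemma TM_X i f : (i.+1 < N)%N -> TM i (XM i f) = XM i.+1 (TM i f + (1 - ss) *: f).
Proof.
move=> hi; exact: (tensor_mulX (heckeM_E (la := la)) (@swapP_mul N) (@swapP_Xn N) (@dd_Xn N) _ hi).
Qed.

Lemma TM_XS i f : (i.+1 < N)%N -> TM i (XM i.+1 f) = XM i (TM i f) - (1 - ss) *: XM i.+1 f.
Proof.
move=> hi; exact: (tensor_mulXS (heckeM_E (la := la)) (@swapP_mul N) (@swapP_XnS N) (@dd_XnS N) _ hi).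
Qed.

Lemma TM_X_far i j f : (i.+1 < N)%N -> (j < N)%N -> j != i -> j != i.+1 ->
  TM i (XM j f) = XM j (TM i f).
Proof.
exact: (tensor_mulX_far (heckeM_E (la := la)) (@swapP_mul N) (@swapP_Xn_far N) (@dd_Xn_far N)).
Qed.

Lemma WM_X0 f : WM (XM 0 f) = qq *: XM N.-1 (WM f).
Proof.
exact: (tensor_W_mulX0 (wM_E (la := la)) (@wPM N) (wP_Xn0 (ltnW N_gt1))).
Qed.

Lemma WM_XS j f : (j.+1 < N)%N -> WM (XM j.+1 f) = XM j (WM f).
Proof. exact: (tensor_W_mulXS (wM_E (la := la)) (@wPM N) (@wP_XnS N)). Qed.

Lemma TM_iota i v : (i.+1 < N)%N -> TM i (iotaM v) = iotaM (TV i v).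
Proof.
move=> hi; exact: (tensor_const (heckeM_E (la := la)) (heckeV_E (la := la)) (fun i _ => swapP_1 N i) (@dd_1 N) _ hi).
Qed.

Lemma WM_iota v : WM (iotaM v) = iotaM (foldl (fun u k => TV k u) v (iota 0 N.-1)).
Proof. exact: (tensor_W_const (wM_E (la := la)) (w_vec_E (la := la)) (@wP_1 N)). Qed.

Lemma TM_quad i f : (i.+1 < N)%N -> TM i (TM i f) = (ss - 1) *: TM i f + ss *: f.
Proof.
exact: (induced_quad (T := TM) (x := XM) (@mod_generated N la) TV_quad TM_iota TM_X TM_XS TM_X_far).
Qed.

Lemma TM_far i j f : (i.+1 < j)%N -> (j.+1 < N)%N -> TM i (TM j f) = TM j (TM i f).
Proof.
exact: (induced_far (T := TM) (x := XM) N_gt1 (@mod_generated N la) TV_far TM_iota TM_X TM_XS TM_X_far).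
Qed.

Lemma TM_braid i f : (i.+2 < N)%N -> TM i (TM i.+1 (TM i f)) = TM i.+1 (TM i (TM i.+1 f)).
Proof.
exact: (induced_braid (T := TM) (x := XM) N_gt1 (@mod_generated N la) TV_quad TV_braid TM_iota TM_X TM_XS TM_X_far).
Qed.

Lemma WM_T i f : (i.+2 < N)%N -> WM (TM i.+1 f) = TM i (WM f).
Proof.
exact: (induced_wT (T := TM) (x := XM) N_gt1 (@mod_generated N la) TV_braid TV_far TM_iota WM_iota TM_X TM_XS TM_X_far WM_X0 WM_XS).
Qed.

Lemma WM_WM_T f : WM (WM (TM 0 f)) = TM N.-2 (WM (WM f)).
Proof.
exact: (induced_wwT (T := TM) (x := XM) N_gt1 (@mod_generated N la) TV_braid TV_far TM_iota WM_iota TM_X TM_XS TM_X_far WM_X0 WM_XS).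
Qed.

End HeckeRelations.

(** * The joint spectrum *)

(** The dimension count: for a square matrix, trivial kernel implies solvability. *)
Lemma square_system (F : fieldType) (I : finType) (a : I -> I -> F) :
  (forall c, (forall y, \sum_x c x * a x y = 0) -> forall x, c x = 0) ->
  forall b, exists c, forall y, \sum_x c x * a x y = b y.
Proof.
move=> inj b; pose A : 'M[F]_#|I| := \matrix_(i, j) a (enum_val i) (enum_val j).
have sumE (u : 'rV[F]_#|I|) y :
    (u *m A) ord0 (enum_rank y) = \sum_x u ord0 (enum_rank x) * a x y.
  rewrite mxE [RHS](reindex _ (onW_bij _ (enum_val_bij I))) /=.
  by apply: eq_bigr => i _; rewrite mxE enum_valK enum_rankK.
have Au : A \in unitmx.
  rewrite -row_free_unit; apply: inj_row_free => u uA; apply/rowP => i.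
  rewrite mxE -[i]enum_valK; apply: (inj (fun x => u ord0 (enum_rank x))) => y.
  by rewrite -sumE uA mxE.
pose u := (\row_j b (enum_val j)) *m invmx A.
exists (fun x => u ord0 (enum_rank x)) => y.
by rewrite -sumE /u mulmxKV // mxE enum_rankK.
Qed.

Section Spectrum.

Variables (F : fieldType) (M : lmodType F) (s q : F) (N : nat) (la : seq nat).
Hypothesis N_gt0 : (0 < N)%N.
Hypothesis la_part : is_partition N la.

Local Notation filling := {ffun 'I_N -> 'I_N * 'I_N}.
Local Notation composition := {ffun 'I_N -> nat}.

Variables (E : ('I_N -> F) -> M -> Prop) (T : nat -> {linear M -> M}) (raise : M -> M).
Variables (e0 : filling -> M) (deg_le : nat -> M -> Prop).

Hypothesis s0 : s != 0.
Hypothesis q0 : q != 0.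
Hypothesis qs_inj : forall (m n : nat) (k l : int),
  q ^+ m * s ^ k = q ^+ n * s ^ l -> m = n /\ k = l.
Hypothesis E_ext : forall z z' f, z =1 z' -> E z f -> E z' f.
Hypothesis EZ : forall z c f, E z f -> E z (c *: f).
Hypothesis EB : forall z f g, E z f -> E z g -> E z (f - g).
Hypothesis E_indep : forall (I : finType) (z : I -> 'I_N -> F) (g : I -> M) (S : {set I}),
  (forall x y, x \in S -> y \in S -> x != y -> exists i, z x i != z y i) ->
  (forall x, x \in S -> E (z x) (g x)) ->
  \sum_(x in S) g x = 0 -> forall x, x \in S -> g x = 0.
Hypothesis E_intertwine : forall z (a b : 'I_N) f, b = a.+1 :> nat -> E z f ->
  z a != 0 -> z a != z b -> E (fun k => z (tperm a b k)) (T a f - hecke_diag s z a b *: f).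
Hypothesis quad : forall i f, (i.+1 < N)%N -> T i (T i f) = (s - 1) *: T i f + s *: f.
Hypothesis E_raise : forall z z' f, E z f ->
  (forall i j : 'I_N, j = i.+1 :> nat -> z' i = z j) ->
  (forall i j : 'I_N, i.+1 = N -> j = 0%N :> nat -> z' i = q * z j) ->
  E z' (raise f).
Hypothesis raise_eq0 : forall z f, E z f -> (forall i, z i != 0) -> raise f = 0 -> f = 0.

Hypothesis deg_le_T : forall i d f, (i.+1 < N)%N -> deg_le d f -> deg_le d (T i f).
Hypothesis deg_le_raise : forall d f, deg_le d f -> deg_le d.+1 (raise f).
Hypothesis deg_leD : forall d f g, deg_le d f -> deg_le d g -> deg_le d (f + g).
Hypothesis deg_leZ : forall d c f, deg_le d f -> deg_le d (c *: f).
Hypothesis deg_leW : forall d d' f, (d <= d')%N -> deg_le d f -> deg_le d' f.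
Hypothesis deg_ex : forall f, exists d, deg_le d f.

Hypothesis e0_eigen : forall f, tabb la f -> E (fun i => s ^ content (f i)) (e0 f).
Hypothesis e0_neq0 : forall f, tabb la f -> e0 f != 0.
Hypothesis e0_deg : forall f, tabb la f -> deg_le 0 (e0 f).

Definition word_wt (v : composition) (sg : filling) (i : 'I_N) : F :=
  q ^+ v i * s ^ content (sg i).

Lemma word_wt_neq0 v sg i : word_wt v sg i != 0.
Proof. by rewrite mulf_neq0 ?expf_neq0 ?expfz_neq0. Qed.

(* The quadratic relation forces the eigenvalue -1 or s. *)
Lemma hecke_diag_eigen z (a b : 'I_N) f : (a.+1 < N)%N -> z a != 0 -> z a != z b -> f != 0 ->
  T a f = hecke_diag s z a b *: f -> z b = s * z a \/ z a = s * z b.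
Proof.
move=> ha za zab f0 Tf; have := quad f ha; rewrite !Tf linearZ /= Tf !scalerA -scalerDl.
set c := hecke_diag s z a b => /eqP; rewrite -subr_eq0 -scalerBl scaler_eq0 (negPf f0) orbF => /eqP hc.
have zab' : z a - z b != 0 by rewrite subr_eq0.
have : (z a - z b) ^+ 2 * (c * c - ((s - 1) * c + s)) = (z b - s * z a) * (z a - s * z b).
  by rewrite /c /hecke_diag; field; rewrite za zab'.
rewrite hc mulr0 => /esym/eqP; rewrite mulf_eq0 !subr_eq0 => /orP[]/eqP; by [left|right].
Qed.

Definition comp_sum (v : composition) : nat := \sum_i v i.

Lemma comp_sum_swap a b v : comp_sum (swap_comp a b v) = comp_sum v.
Proof.
rewrite /comp_sum [RHS](reindex_inj (@perm_inj _ (tperm a b))).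
by apply: eq_bigr => i _; rewrite ffunE.
Qed.

(** The intertwined vector is nonzero: otherwise the two weights would differ by a factor [s], and
    comparing powers of [q] would make the parts equal. *)
Lemma eigen_swap (v : composition) (sg : filling) (a b : 'I_N) f d : b = a.+1 :> nat -> v a != v b ->
  E (word_wt v sg) f -> f != 0 -> deg_le d f ->
  exists g, [/\ g != 0, E (word_wt (swap_comp a b v) (swap_word a b sg)) g & deg_le d g].
Proof.
move=> hb vab Ef f0 df; have ha : (a.+1 < N)%N by rewrite -hb.
have zab : word_wt v sg a != word_wt v sg b.
  by apply/eqP => /qs_inj [h _]; rewrite h eqxx in vab.
exists (T a f - hecke_diag s (word_wt v sg) a b *: f); split.
- apply/eqP => /eqP; rewrite subr_eq0 => /eqP Tf.
  have sE (i j : 'I_N) : word_wt v sg i = s * word_wt v sg j -> v i = v j.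
    have e : s * s ^ content (sg j) = s ^ (1 + content (sg j)) by rewrite (expfzDr 1) // expr1z.
    by rewrite /word_wt mulrCA e => /qs_inj [].
  case: (hecke_diag_eigen ha (word_wt_neq0 v sg a) zab f0 Tf) => /sE h; by rewrite h eqxx in vab.
- have := E_intertwine hb Ef (word_wt_neq0 v sg a) zab; apply: E_ext => k.
  by rewrite /word_wt !ffunE.
- by rewrite -scaleNr; apply: deg_leD; [apply: deg_le_T|apply: deg_leZ].
Qed.

(** Inverse of raising on words: the last position moves to the front and its part drops by one. The
    tie rule in [before] makes this preserve the order of positions. *)
Lemma eigen_unraise (v : composition) (sg : filling) (l : 'I_N) : l.+1 = N -> (0 < v l)%N -> word la v sg ->
  exists u tu, [/\ word la u tu, (comp_sum u).+1 = comp_sum v &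
    forall f d, E (word_wt u tu) f -> f != 0 -> deg_le d f ->
    [/\ raise f != 0, E (word_wt v sg) (raise f) & deg_le d.+1 (raise f)]].
Proof.
move=> hl vl hw.
pose rot (i : 'I_N) : 'I_N := if val i is j.+1 then insubd l j else l.
have rotS (i j : 'I_N) : j = i.+1 :> nat -> rot j = i.
  move=> h; rewrite /rot; case: j h => -[|j] hj //= [->].
  by apply: val_inj; rewrite val_insubd ltn_ord.
have rot0 (j : 'I_N) : j = 0%N :> nat -> rot j = l by rewrite /rot; case: j => -[|j].
have rot_inj : injective rot.
  move=> i j; rewrite /rot; case: i => -[|i] hi; case: j => -[|j] hj //=.
  - by move=> _; apply: val_inj.
  - by move=> /(congr1 val); rewrite val_insubd /= ltnW //; lia.
  - by move=> /(congr1 val); rewrite val_insubd /= ltnW //; lia.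
  by move=> /(congr1 val); rewrite !val_insubd (ltnW hi) (ltnW hj) /= => e; apply: val_inj; rewrite /= e.
pose u : composition := [ffun i => if val i == 0%N then (v l).-1 else v (rot i)].
pose tu : filling := [ffun i => sg (rot i)].
exists u, tu; split.
- case/wordP: hw => hi hc hb; apply/wordP; split.
  + by move=> i j; rewrite !ffunE => /hi /rot_inj.
  + by move=> i; rewrite ffunE.
  move=> i j; rewrite !ffunE => /hb; rewrite /before !ffunE.
  have rl (k : 'I_N) : k != 0%N :> nat -> (rot k : nat) = k.-1.
    by rewrite /rot; case: k => -[|k] hk //= _; rewrite val_insubd ltnW.
  have := ltn_ord (rot i); have := ltn_ord (rot j).
  case: (eqVneq (i : nat) 0%N) => hi0; case: (eqVneq (j : nat) 0%N) => hj0.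
  + by rewrite !rot0 //; lia.
  + by rewrite (rot0 i) // rl //; lia.
  + by rewrite (rot0 j) // rl //; lia.
  by rewrite !rl //; lia.
- rewrite /comp_sum (bigD1 (Ordinal N_gt0)) //= [RHS](reindex_inj rot_inj) /=.
  rewrite [RHS](bigD1 (Ordinal N_gt0)) //= ffunE /= rot0 // -addSn prednK //; congr (_ + _)%N.
  by apply: eq_bigr => i hi; rewrite ffunE ifN.
move=> f d Ef f0 df; split; last exact: deg_le_raise.
  by apply: contraNneq f0 => /(raise_eq0 Ef (word_wt_neq0 u tu)) ->.
apply: (E_raise Ef) => [i j hij|i j hi hj]; rewrite /word_wt !ffunE.
  by rewrite -[val j]/(nat_of_ord j) hij (rotS _ _ hij).
rewrite -[val j]/(nat_of_ord j) hj eqxx rot0 // mulrA -exprS prednK // (_ : i = l) //.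
by apply: val_inj => /=; lia.
Qed.

(* The Yang-Baxter graph: every word is reached from a word of degree 0 by affine raisings and by *)
(* exchanges of two distinct adjacent parts.                                                      *)
Lemma eigen_exists (v : composition) (sg : filling) : word la v sg ->
  exists f, [/\ f != 0, E (word_wt v sg) f & deg_le (comp_sum v) f].
Proof.
have [n] := ubnP (comp_sum v); elim: n v sg => // n IHn v sg hn hw.
have [/existsP[j vj]|] := boolP [exists j : 'I_N, (0 < v j)%N]; last first.
  rewrite negb_exists => /forallP hv.
  have v0 : v = [ffun=> 0%N] by apply/ffunP => i; rewrite ffunE; apply/eqP; rewrite -leqn0 leqNgt.
  have ht : tabb la sg.
    case/wordP: hw => hi hc hb; apply/and4P; split.
    - exact/injectiveP.
    - exact/forallP.
    - apply/forallP => i; apply/forallP => k; apply/implyP => h.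
      by have := hb i k; rewrite /cell_lt h v0 /before !ffunE /= => /(_ isT).
    apply/forallP => i; apply/forallP => k; apply/implyP => h.
    by have := hb i k; rewrite /cell_lt h orbT v0 /before !ffunE /= => /(_ isT).
  exists (e0 sg); split; first exact: e0_neq0.
    by apply: E_ext (e0_eigen ht) => i; rewrite /word_wt v0 ffunE mul1r.
  by apply: deg_leW (e0_deg ht).
(* Inner induction: a positive part is pushed to the last position by exchanges with zero parts, and
   there the word can be unraised. *)
have [m] := ubnP (N - j)%N; elim: m v sg j vj hw hn => // m IHm v sg j vj hw hn hm.
have [jl|jl] := eqVneq j.+1 N.
  have [u [tu [hu hs hr]]] := eigen_unraise jl vj hw.
  have [|f [f0 Ef df]] := IHn u tu _ hu; first by rewrite -ltnS hs.
  by have [h1 h2 h3] := hr f _ Ef f0 df; exists (raise f); split=> //; rewrite -hs.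
have hj : (j.+1 < N)%N by have := ltn_ord j; lia.
pose b : 'I_N := Ordinal hj; have hb : b = j.+1 :> nat by [].
have [vb|] := ltnP 0 (v b); first by apply: (IHm v sg b) => //; rewrite hb; lia.
rewrite leqn0 => /eqP vb.
have vjb : v j != v b by rewrite vb -lt0n.
have [||||f [f0 Ef df]] := IHm (swap_comp j b v) (swap_word j b sg) b.
- by rewrite ffunE tpermR.
- by apply: word_swap; rewrite // (negPf vjb).
- by rewrite comp_sum_swap.
- by rewrite hb; lia.
have ne : swap_comp j b v j != swap_comp j b v b by rewrite !ffunE tpermL tpermR eq_sym.
have [g [g0]] := eigen_swap hb ne Ef f0 df.
by rewrite swap_compK swap_wordK comp_sum_swap => Eg dg; exists g.
Qed.

Lemma word_wt_inj (v u : composition) (sg tu : filling) : word la v sg -> word la u tu ->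
  word_wt v sg =1 word_wt u tu -> v = u /\ sg = tu.
Proof.
move=> hw hu e.
have vu : v = u by apply/ffunP => i; have /qs_inj[] := e i.
split=> //; rewrite -vu in hu; apply: (word_contents_inj la_part hw hu) => i.
by have /qs_inj[] := e i.
Qed.

Lemma word_wt_sep (v u : composition) (sg tu : filling) : word la v sg -> word la u tu -> (v, sg) != (u, tu) ->
  exists i, word_wt v sg i != word_wt u tu i.
Proof.
move=> hw hu ne; apply/existsP; apply: contraNT ne; rewrite negb_exists => /forallP h.
have [|-> -> //] := word_wt_inj hw hu.
by move=> i; apply/eqP; have := h i; rewrite negbK.
Qed.

Variables (Id : nat -> finType) (idx : forall d, Id d -> composition * filling).
Variable (coord : forall d, Id d -> M -> F).
Hypothesis idx_word : forall d (y : Id d), word la (idx y).1 (idx y).2.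
Hypothesis idx_deg : forall d (y : Id d), (comp_sum (idx y).1 <= d)%N.
Hypothesis idx_inj : forall d, injective (@idx d).
Hypothesis idx_surj : forall d v sg, word la v sg -> (comp_sum v <= d)%N ->
  exists y : Id d, idx y = (v, sg).
Hypothesis coordP : forall d (y : Id d) c f g, coord y (c *: f + g) = c * coord y f + coord y g.
Hypothesis coord_inj : forall d f, deg_le d f -> (forall y : Id d, coord y f = 0) -> f = 0.

Let coord_sum d (y : Id d) (I : Type) (r : seq I) (c : I -> F) (g : I -> M) :
  coord y (\sum_(i <- r) c i *: g i) = \sum_(i <- r) c i * coord y (g i).
Proof.
elim: r => [|i r IH]; last by rewrite !big_cons coordP IH.
rewrite !big_nil; have := coordP y 1 0 0.
by rewrite scaler0 addr0 mul1r => /eqP; rewrite -subr_eq subrr eq_sym => /eqP.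
Qed.

(** The finite type [Id d] indexes both the words of degree at most [d] and the coordinates of
    vectors of degree at most [d]. The eigenvectors are independent, so their square coordinate
    matrix is invertible and they span. *)
Lemma eigenbasis d : exists e : Id d -> M,
  (forall y, [/\ e y != 0, E (word_wt (idx y).1 (idx y).2) (e y) & deg_le d (e y)]) /\
  (forall f, deg_le d f -> exists c, f = \sum_y c y *: e y).
Proof.
have /fin_all_exists [e he] (y : Id d) : exists f,
    [/\ f != 0, E (word_wt (idx y).1 (idx y).2) f & deg_le d f].
  have [f [f0 Ef df]] := eigen_exists (idx_word y); exists f; split=> //.
  exact: deg_leW (idx_deg y) df.
exists e; split=> // f df.
have sum_deg c : deg_le d (\sum_y c y *: e y).
  elim/big_rec: _ => [|y g _ hg]; first by rewrite -(scale0r f); apply: deg_leZ.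
  by apply: deg_leD => //; apply: deg_leZ; case: (he y).
have indep c : \sum_y c y *: e y = 0 -> forall y, c y = 0.
  move=> sum0 y; have := E_indep (S := [set: Id d])
    (z := fun y => word_wt (idx y).1 (idx y).2) (g := fun y => c y *: e y).
  have [ey0 _ _] := he y; move=> /(_ _ _ _ y (in_setT y)) h.
  apply/eqP; move: ey0; apply: contraNT => cy; apply/eqP.
  suff /eqP : c y *: e y = 0 by rewrite scaler_eq0 (negPf cy) => /eqP.
  apply: h.
  - move=> y1 y2 _ _ ne; apply: word_wt_sep => //.
    by rewrite -!surjective_pairing (inj_eq (@idx_inj d)).
  - by move=> y1 _; apply: EZ; case: (he y1).
  by rewrite -[RHS]sum0; apply: eq_bigl => y1; rewrite inE.
have [|c hc] := square_system (a := fun x y => coord y (e x)) _ (fun y => coord y f).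
  move=> c hc; apply: indep; apply: (coord_inj (sum_deg c)) => y.
  by rewrite coord_sum hc.
exists c; apply/eqP; rewrite -subr_eq0; apply/eqP; rewrite -scaleN1r addrC.
apply: (@coord_inj d) => [|y]; first by apply: deg_leD => //; apply: deg_leZ.
by rewrite coordP coord_sum hc mulN1r addNr.
Qed.

(** Expand both vectors in an eigenbasis of large enough degree: by independence only the basis
    vector of their common weight survives. *)
Lemma eigen_line v sg f e : word la v sg -> E (word_wt v sg) f -> E (word_wt v sg) e -> e != 0 ->
  exists c, f = c *: e.
Proof.
move=> hw Ef Ee e_neq0.
have [d1 hd1] := deg_ex f; have [d2 hd2] := deg_ex e.
pose d := maxn (comp_sum v) (maxn d1 d2).
have [y0 hy0] := idx_surj (d := d) hw (leq_maxl _ _).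
have [b [hb sb]] := eigenbasis d; have [b0 _ _] := hb y0.
have line g : deg_le d g -> E (word_wt v sg) g -> exists c, g = c *: b y0.
  move=> dg Eg; have [c gE] := sb g dg; exists (c y0).
  have := E_indep (S := [set: Id d]) (z := fun y => word_wt (idx y).1 (idx y).2)
    (g := fun y => c y *: b y - (if y == y0 then g else 0)).
  move=> /(_ _ _ _ y0 (in_setT y0)); rewrite eqxx => h; apply/esym/eqP; rewrite -subr_eq0.
  apply/eqP/h.
  - move=> y1 y2 _ _ ne; apply: word_wt_sep => //.
    by rewrite -!surjective_pairing (inj_eq (@idx_inj d)).
  - move=> y _; apply: EB; first by apply: EZ; case: (hb y).
    case: eqP => [->|_]; first by rewrite hy0.
    by rewrite -(scale0r (b y)); apply: EZ; case: (hb y).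
  rewrite (eq_bigl xpredT) => [|y]; last by rewrite inE.
  rewrite sumrB -gE (bigD1 y0) //= eqxx big1 ?addr0 ?subrr //.
  by move=> y /negPf ->.
have [|c fE] := line f _ Ef; first by apply: deg_leW hd1; rewrite /d; lia.
have [|c' eE] := line e _ Ee; first by apply: deg_leW hd2; rewrite /d; lia.
have c'0 : c' != 0 by apply: contraNneq e_neq0 => c'0; rewrite eE c'0 scale0r.
by exists (c / c'); rewrite eE fE scalerA divfK.
Qed.

(** An eigenvector of a foreign weight would be independent of an eigenbasis that spans it. The
    index type is enlarged by [None], which stands for [f]. *)
Lemma eigen_weight z f : E z f -> f != 0 ->
  exists v sg, word la v sg /\ z =1 word_wt v sg.
Proof.
move=> Ef f0; have [d df] := deg_ex f.
have [b [hb sb]] := eigenbasis d; have [c fE] := sb f df.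
have [/existsP[y /forallP hy]|] :=
    boolP [exists y : Id d, [forall i, z i == word_wt (idx y).1 (idx y).2 i]].
  by exists (idx y).1, (idx y).2; split=> // i; apply/eqP.
rewrite negb_exists => /forallP hz; case/eqP: f0.
pose zo (o : option (Id d)) := if o is Some y then word_wt (idx y).1 (idx y).2 else z.
pose g (o : option (Id d)) := if o is Some y then c y *: b y else - f.
have sep (y : Id d) : exists i, z i != word_wt (idx y).1 (idx y).2 i.
  by apply/existsP; rewrite -negb_forall.
have := E_indep (S := [set: option (Id d)]) (z := zo) (g := g).
move=> /(_ _ _ _ None (in_setT _)) h; apply/eqP; rewrite -oppr_eq0; apply/eqP/h.
- move=> [y1|] [y2|] _ _ ne //=.
  + apply: word_wt_sep => //; rewrite -!surjective_pairing (inj_eq (@idx_inj d)).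
    by apply: contraNneq ne => ->.
  + by have [i hi] := sep y1; exists i; rewrite eq_sym.
- move=> [y|] _ /=; first by apply: EZ; case: (hb y).
  by rewrite -scaleN1r; apply: EZ.
rewrite (eq_bigl xpredT) => [|y]; last by rewrite inE.
rewrite (bigD1 None) //= (reindex_omap Some id) => [|[]] //=.
rewrite (eq_bigl xpredT) => [|y]; last by rewrite eqxx.
by rewrite -fE addNr.
Qed.

End Spectrum.

(** * Antisymmetric vectors *)

Lemma perm_ge_id N (p : {perm 'I_N}) : (forall i : 'I_N, (i <= p i)%N) -> p = 1%g.
Proof.
move=> h; apply/permP => i; rewrite perm1.
have [n] := ubnP (N - i)%N; elim: n i => // n IH i hn.
have := h i; rewrite leq_eqVlt => /orP[/eqP e|lt]; first exact/esym/val_inj.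
have e : p (p i) = p i by apply: IH; have := ltn_ord (p i); lia.
by move/perm_inj: e.
Qed.

(** * Extending antisymmetry by one position *)

Section Antisymmetrizer.

Variables (F : fieldType) (M : lmodType F) (s : F) (N : nat) (T : nat -> {linear M -> M}).
Hypothesis s0 : s != 0.
Hypothesis quad : forall i f, (i.+1 < N)%N -> T i (T i f) = (s - 1) *: T i f + s *: f.
Hypothesis braid : forall i f, (i.+2 < N)%N ->
  T i (T i.+1 (T i f)) = T i.+1 (T i (T i.+1 f)).
Hypothesis far : forall i j f, (i.+1 < j)%N -> (j.+1 < N)%N -> T i (T j f) = T j (T i f).

(** The product of [T (k-1)], ..., [T (k-m)], applied in this order: the coset representative of
    length [m]. *)
Fixpoint down_chain k (g : M) m : M :=
  if m is m'.+1 then T (k.-1 - m') (down_chain k g m') else g.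

Definition antisymmetrize k g : M := \sum_(m < k.+1) (- s^-1) ^+ m *: down_chain k g m.

(* [antisymmetrize k] is the sum over the minimal coset representatives of S_k in S_(k+1). *)
Lemma antisymmetrizeP k g : (k < N)%N -> (forall j, (j.+1 < k)%N -> T j g = - g) ->
  forall j, (j < k)%N -> T j (antisymmetrize k g) = - antisymmetrize k g.
Proof.
move=> hk hg j hj; set h := down_chain k g.
have hS m : h m.+1 = T (k.-1 - m) (h m) by [].
have low i m : (m + i.+1 < k)%N -> T i (h m) = - h m.
  elim: m => [|m IH] hm; first exact: hg.
  rewrite hS far; try lia.
  by rewrite IH ?linearN //; lia.
have at0 m : (m + j.+1 = k)%N -> T j (h m) = h m.+1.
  by move=> hm; rewrite hS (_ : k.-1 - m = j)%N //; lia.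
have at1 m : (m + j.+1 = k)%N -> T j (h m.+1) + h m.+1 = s *: (h m.+1 + h m).
  move=> hm; rewrite -(at0 m hm) quad; last by lia.
  by rewrite addrAC scalerBl scale1r subrK scalerDr.
have high m : (k <= m + j)%N -> (m < k)%N -> T j (h m.+1) = - h m.+1.
  elim: m => [|m IH] h1 h2; first by lia.
  have [e|ne] := eqVneq (m.+1 + j)%N k.
    have hm : (m + j.+1 = k)%N by lia.
    case: j hj at0 at1 IH h1 e hm => [|j] hj at0 at1 IH h1 e hm; first by lia.
    rewrite hS (_ : k.-1 - m.+1 = j)%N; last by lia.
    rewrite -(at0 m hm) -braid; last by lia.
    by rewrite low ?linearN //; lia.
  rewrite hS -far; try lia.
  by rewrite IH ?linearN //; lia.
have hm0 : (k - j.+1 + j.+1 = k)%N by lia.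
(* [T j] acts by -1 on each term except those of lengths [m0] and [m0+1], where it attaches to the
   chain or meets its last factor. Their contributions cancel by [at1], thanks to the ratio -1/s. *)
pose m0 := (k - j.+1)%N; have m0k : (m0 < k.+1)%N by rewrite /m0; lia.
have m1k : (m0.+1 < k.+1)%N by rewrite /m0; lia.
apply/eqP; rewrite -addr_eq0 /antisymmetrize linear_sum -big_split /=.
rewrite (bigD1 (Ordinal m0k)) //= (bigD1 (Ordinal m1k)) /=; last by rewrite -val_eqE /= neq_ltn ltnSn orbT.
rewrite big1 ?addr0 => [|i /andP[i0 i1]]; last first.
  rewrite -/h linearZ /= -scalerDr (_ : T j (h i) + h i = 0) ?scaler0 //.
  apply/eqP; rewrite addr_eq0; apply/eqP.
  have i0' : (i : nat) != m0 := i0; have i1' : (i : nat) != m0.+1 := i1.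
  have [hi|hi] := ltnP (i + j.+1) k; first exact: low.
  have ik := ltn_ord i; have : (m0.+1 < i)%N by rewrite /m0 in i0' i1' *; lia.
  case: (i : nat) ik i0' i1' => // i' ik _ _ hi'; apply: high; rewrite /m0 in hi'; lia.
rewrite -/h -(hS m0) [T j (_ *: h m0)]linearZ [T j (_ *: h m0.+1)]linearZ -!scalerDr.
rewrite at0 // at1 // exprS !scalerA.
by rewrite [- s^-1 * _ * s]mulrAC mulNr mulVf // mulN1r -scalerDl addrN scale0r.
Qed.

End Antisymmetrizer.

Lemma initial_run (f : nat -> bool) k : (forall i, (i.+1 < k)%N -> f i.+1 -> f i) ->
  exists j, [/\ (j <= k)%N, forall i, (i < j)%N -> f i &
                 forall i, (j <= i)%N -> (i < k)%N -> ~~ f i].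
Proof.
elim: k => [|k IH] hf; first by exists 0%N; split.
have [|j [jk h1 h2]] := IH; first by move=> i hi; apply: hf; lia.
have [lt|ge] := ltnP j k.
  exists j; split=> // [|i ji]; first by lia.
  rewrite ltnS leq_eqVlt => /orP[/eqP ->|]; last exact: h2.
  have h3 : ~~ f k.-1 by apply: h2; lia.
  by apply: contra h3; rewrite -{1}(@prednK k) => [|]; first apply: hf; lia.
have ejk : j = k by lia.
have [fk|nfk] := boolP (f k).
  exists k.+1; split=> // i; last by lia.
  by rewrite ltnS leq_eqVlt => /orP[/eqP -> //|lt]; apply: h1; lia.
exists k; split=> // i hi; first by apply: h1; rewrite ejk.
by move=> hi'; have -> : i = k by lia.
Qed.

(** * Antisymmetric vectors in the span of the admissible words *)

Section AntisymmetricWords.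

Variables (F : fieldType) (M : lmodType F) (s q : F) (N : nat) (la : seq nat).
Hypothesis N_gt0 : (0 < N)%N.
Hypothesis la_part : is_partition N la.

Local Notation filling := {ffun 'I_N -> 'I_N * 'I_N}.
Local Notation composition := {ffun 'I_N -> nat}.

Variables (E : ('I_N -> F) -> M -> Prop) (T : nat -> {linear M -> M}).
Hypothesis s0 : s != 0.
Hypothesis q0 : q != 0.
Hypothesis qs_inj : forall (m n : nat) (k l : int),
  q ^+ m * s ^ k = q ^+ n * s ^ l -> m = n /\ k = l.
Hypothesis quad : forall i f, (i.+1 < N)%N -> T i (T i f) = (s - 1) *: T i f + s *: f.
Hypothesis braid : forall i f, (i.+2 < N)%N ->
  T i (T i.+1 (T i f)) = T i.+1 (T i (T i.+1 f)).
Hypothesis far : forall i j f, (i.+1 < j)%N -> (j.+1 < N)%N -> T i (T j f) = T j (T i f).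
Hypothesis E_ext : forall z z' f, z =1 z' -> E z f -> E z' f.
Hypothesis EZ : forall z c f, E z f -> E z (c *: f).
Hypothesis E_indep : forall (I : finType) (z : I -> 'I_N -> F) (g : I -> M) (S : {set I}),
  (forall x y, x \in S -> y \in S -> x != y -> exists i, z x i != z y i) ->
  (forall x, x \in S -> E (z x) (g x)) ->
  \sum_(x in S) g x = 0 -> forall x, x \in S -> g x = 0.
Hypothesis E_intertwine : forall z (a b : 'I_N) f, b = a.+1 :> nat -> E z f ->
  z a != 0 -> z a != z b -> E (fun k => z (tperm a b k)) (T a f - hecke_diag s z a b *: f).
Hypothesis E_exists : forall v sg, word la v sg -> exists f, f != 0 /\ E (word_wt s q v sg) f.
Hypothesis E_line : forall v sg f e, word la v sg -> E (word_wt s q v sg) f ->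
  E (word_wt s q v sg) e -> e != 0 -> exists c, f = c *: e.
Hypothesis E_weight : forall z f, E z f -> f != 0 ->
  exists v sg, word la v sg /\ z =1 word_wt s q v sg.

Variable Tf : nat -> nat -> nat.

(** For words filling [Tf] the composition is a function of the cells, so the cells alone index the
    basis of M_T. *)
Definition level (sg : filling) : composition := [ffun i => Tf (sg i).1 (sg i).2].
Definition admissible (sg : filling) : bool := word la (level sg) sg.
Definition wt (sg : filling) : 'I_N -> F := word_wt s q (level sg) sg.

Lemma level_swap a b sg : level (swap_word a b sg) = swap_comp a b (level sg).
Proof. by apply/ffunP => i; rewrite !ffunE. Qed.

Lemma admissible_swap sg (a b : 'I_N) : b = a.+1 :> nat -> admissible sg ->
  admissible (swap_word a b sg) = ~~ ((level sg a == level sg b) && cell_lt (sg b) (sg a)).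
Proof.
move=> hb hw; rewrite /admissible level_swap; apply/idP/idP => [|h]; last exact: word_swap.
case/wordP => _ _ hs; apply/negP => /andP[e h].
have := hs a b; rewrite !ffunE tpermL tpermR => /(_ h).
rewrite /before !ffunE tpermL tpermR; move: e; rewrite !ffunE; lia.
Qed.

Lemma s_mulE k : s * s ^ k = s ^ (1 + k).
Proof. by rewrite (expfzDr 1) // expr1z. Qed.

Lemma wt_neq0 sg i : wt sg i != 0.
Proof. exact: word_wt_neq0. Qed.

Lemma wt_eq_smul sg i j : wt sg i = s * wt sg j ->
  level sg i = level sg j /\ content (sg i) = 1 + content (sg j).
Proof. by rewrite /wt /word_wt mulrCA s_mulE => /qs_inj. Qed.

Lemma wt_smul sg i j : level sg i = level sg j -> content (sg i) = 1 + content (sg j) ->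
  wt sg i = s * wt sg j.
Proof. by rewrite /wt /word_wt mulrCA s_mulE => -> ->. Qed.

Lemma admissible_cases sg (a b : 'I_N) : b = a.+1 :> nat -> admissible sg ->
  level sg a = level sg b ->
  [\/ (sg a).1 = (sg b).1 /\ (sg a).2 = (sg b).2.+1 :> nat,
      (sg a).2 = (sg b).2 /\ (sg a).1 = (sg b).1.+1 :> nat,
      ((sg b).1 < (sg a).1)%N /\ ((sg a).2 < (sg b).2)%N |
      ((sg a).1 < (sg b).1)%N /\ ((sg b).2 < (sg a).2)%N].
Proof.
move=> hb hw e; have [h1 h2] := before_succ hb e.
exact: (word_consecutive la_part hw h1 h2).
Qed.

Lemma content_step sg (a b : 'I_N) : b = a.+1 :> nat -> admissible sg ->
  level sg a = level sg b -> content (sg a) != content (sg b).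
Proof.
move=> hb hw e; have := admissible_cases hb hw e; rewrite /content.
by case=> -[h1 h2]; rewrite ?h1 ?h2; lia.
Qed.

Lemma wt_step sg (a b : 'I_N) : b = a.+1 :> nat -> admissible sg -> wt sg a != wt sg b.
Proof.
move=> hb hw; apply/eqP => /qs_inj [e /eqP]; apply/negP.
exact: content_step.
Qed.

(** A ratio [s] means equal parts and contents differing by 1. Consecutive cells of that kind are
    neighbours in a row or column, and then the exchange is not admissible. *)
Lemma admissible_generic sg (a b : 'I_N) : b = a.+1 :> nat -> admissible sg ->
  admissible (swap_word a b sg) -> ~ (wt sg b = s * wt sg a \/ wt sg a = s * wt sg b).
Proof.
move=> hb hw; rewrite (admissible_swap hb hw) => hs h.
have [e hc] : level sg a = level sg b /\
    (content (sg b) = 1 + content (sg a) \/ content (sg a) = 1 + content (sg b)).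
  by case: h => /wt_eq_smul [-> ->]; split; auto.
move: hs; rewrite e eqxx /= => hs.
have := admissible_cases hb hw e; rewrite /content in hc; move: hs hc; rewrite /cell_lt.
by move=> hs hc [] [h1 h2]; move: hs hc; rewrite -?val_eqE /= ?h1 ?h2; lia.
Qed.

Definition diag_coef (sg : filling) (a b : 'I_N) : F := hecke_diag s (wt sg) a b.

(* An eigenvector for a transposed weight that belongs to no word must vanish. *)
Lemma eigen_action sg (a b : 'I_N) e e' : b = a.+1 :> nat -> admissible sg ->
  E (wt sg) e -> e != 0 -> (admissible (swap_word a b sg) -> E (wt (swap_word a b sg)) e' /\ e' != 0) ->
  exists c, T a e = diag_coef sg a b *: e
      + (if admissible (swap_word a b sg) then c *: e' else 0) /\
    (admissible (swap_word a b sg) -> c != 0).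
Proof.
move=> hb hw Ee en he'; have ha : (a.+1 < N)%N by rewrite -hb.
have zab := wt_step hb hw; have za := wt_neq0 sg a.
set g := T a e - diag_coef sg a b *: e.
have Eg : E (wt (swap_word a b sg)) g.
  by apply: E_ext (E_intertwine hb Ee za zab) => k; rewrite /wt /word_wt level_swap !ffunE.
have Te : T a e = diag_coef sg a b *: e + g by rewrite addrC subrK.
case: (boolP (admissible (swap_word a b sg))) => hs.
  have [Ee' e'0] := he' hs; have [c gE] := E_line hs Eg Ee' e'0.
  exists c; split=> [|_]; first by rewrite Te gE.
  apply/eqP => c0; apply: (admissible_generic hb hw hs).
  apply: (hecke_diag_eigen quad ha za zab en).
  by rewrite Te gE c0 scale0r addr0.
exists 0; split=> //; rewrite Te; congr (_ + _); apply/eqP/negPn/negP => g0.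
have [v [tu [hv hz]]] := E_weight Eg g0.
have hs' : word la (level (swap_word a b sg)) (swap_word a b sg) = false := negbTE hs.
have [ev ec] : v = level (swap_word a b sg) /\
    forall i, content (swap_word a b sg i) = content (tu i).
  split; last by move=> i; have /qs_inj[] := hz i.
  by apply/ffunP => i; have /qs_inj[/esym] := hz i.
have elev : level sg a = level sg b.
  by apply/eqP; move: hs; rewrite (admissible_swap hb hw) negbK => /andP[].
suff etu : swap_word a b sg = tu by move: hv; rewrite ev -etu hs'.
have [hi hc hbf] := wordP _ _ _ hw; have [ti tc tbf] := wordP _ _ _ hv.
apply/ffunP; apply: (contents_inj (v := v)) ec => //.
- by move=> i j; rewrite !ffunE => /hi /perm_inj.
- move=> i; have [j hj] := word_surj la_part hw (tc i); exists (tperm a b j).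
  by rewrite ffunE tpermK.
- by move=> i; rewrite ffunE; apply: (word_surj la_part hv).
(* The exchanged word violates the order only at the pair [a], [b]. These cells lie on different
   diagonals, so the criterion by contents still applies to it. *)
- move=> i j ec lt1; rewrite ev level_swap -[i](tpermK a b) -[j](tpermK a b).
  apply: (before_swap hb); last first.
    by apply: (word_diag la_part hw); move: ec lt1; rewrite !ffunE.
  apply/negP => /andP[/andP[_ /eqP ej] /eqP ei].
  move: ec; rewrite !ffunE ej ei => ec.
  by have := content_step hb hw elev; rewrite ec eqxx.
by move=> i j; apply: (word_diag la_part hv).
Qed.

Section Basis.

Variables (e : filling -> M) (off : filling -> 'I_N -> 'I_N -> F).
Hypothesis e_eigen : forall sg, admissible sg -> E (wt sg) (e sg).
Hypothesis e_neq0 : forall sg, admissible sg -> e sg != 0.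
Hypothesis T_e : forall sg (a b : 'I_N), b = a.+1 :> nat -> admissible sg ->
  T a (e sg) = diag_coef sg a b *: e sg
    + (if admissible (swap_word a b sg) then off sg a b *: e (swap_word a b sg) else 0).
Hypothesis off_neq0 : forall sg (a b : 'I_N), b = a.+1 :> nat -> admissible sg ->
  admissible (swap_word a b sg) -> off sg a b != 0.

Definition span_vec (c : filling -> F) : M := \sum_(sg | admissible sg) c sg *: e sg.

Lemma span_vecP k c d : span_vec (fun sg => k * c sg + d sg) = k *: span_vec c + span_vec d.
Proof.
rewrite /span_vec scaler_sumr -big_split; apply: eq_bigr => sg _.
by rewrite scalerDl scalerA.
Qed.

Lemma span_vec_inj c d : span_vec c = span_vec d -> forall sg, admissible sg -> c sg = d sg.
Proof.
move=> h sg hsg; apply/eqP; rewrite -subr_eq0.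
suff /eqP : (c sg - d sg) *: e sg = 0 by rewrite scaler_eq0 (negPf (e_neq0 hsg)) orbF.
have := E_indep (S := [set sg | admissible sg]) (z := wt)
  (g := fun sg => (c sg - d sg) *: e sg).
move=> /(_ _ _ _ sg); rewrite inE; apply=> //.
- move=> x y; rewrite !inE => hx hy xy; apply: (word_wt_sep la_part qs_inj hx hy).
  by apply: contraNneq xy => -[_ ->].
- by move=> x; rewrite inE => hx; apply/EZ/e_eigen.
rewrite (eq_bigl admissible) => [|x]; last by rewrite inE.
under eq_bigr do rewrite scalerBl; rewrite sumrB; apply/eqP; rewrite subr_eq0.
exact/eqP.
Qed.

(** Coefficients transform by the transposed matrix: the off-diagonal entry is taken at the
    exchanged word. *)
Definition act (a b : 'I_N) (c : filling -> F) (sg : filling) : F :=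
  diag_coef sg a b * c sg + (if admissible (swap_word a b sg)
    then off (swap_word a b sg) a b * c (swap_word a b sg) else 0).

Lemma T_span (a b : 'I_N) c : b = a.+1 :> nat -> T a (span_vec c) = span_vec (act a b c).
Proof.
move=> hb; rewrite /span_vec linear_sum.
rewrite (eq_bigr (fun sg => diag_coef sg a b * c sg *: e sg +
  (if admissible (swap_word a b sg) then (off sg a b * c sg) *: e (swap_word a b sg) else 0))).
  rewrite big_split /= [X in _ + X](reindex_inj (inv_inj (@swap_wordK N a b))) /=.
  rewrite [X in _ + X]big_mkcond /=.
  rewrite [X in _ + X](eq_bigr (fun sg => if admissible sg then
     (if admissible (swap_word a b sg) then
       (off (swap_word a b sg) a b * c (swap_word a b sg)) *: e sg else 0) else 0)).
    rewrite -big_mkcond -big_split /=; apply: eq_bigr => sg _; rewrite scalerDl.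
    by case: ifP => // _; rewrite scale0r.
  by move=> sg _; rewrite swap_wordK; case: ifP => // h1; case: ifP.
move=> sg hsg; rewrite linearZ /= (T_e hb hsg) scalerDr scalerA mulrC; congr (_ + _).
by case: ifP => _; rewrite ?scaler0 // scalerA mulrC.
Qed.

Definition antisym_below k (f : M) := forall i, (i.+1 < k)%N -> T i f = - f.

Lemma antisym_coef k c (a b : 'I_N) sg : b = a.+1 :> nat -> (b < k)%N ->
  antisym_below k (span_vec c) -> admissible sg -> act a b c sg = - c sg.
Proof.
move=> hb hbk hc hsg; apply: (span_vec_inj (d := fun sg => - c sg) _ hsg).
rewrite -(T_span _ hb) hc -?hb //.
by rewrite /span_vec -sumrN; apply: eq_bigr => u _; rewrite scaleNr.
Qed.

(** Where the coefficient is zero, the antisymmetry equation reduces to a nonzero entry times the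
    neighbouring coefficient. *)
Lemma antisym_propagate k c (a b : 'I_N) sg : b = a.+1 :> nat -> (b < k)%N ->
  antisym_below k (span_vec c) -> admissible sg -> admissible (swap_word a b sg) ->
  c sg = 0 -> c (swap_word a b sg) = 0.
Proof.
move=> hb hbk hc hsg hs c0; have := antisym_coef hb hbk hc hsg.
rewrite /act hs c0 mulr0 add0r oppr0 => /eqP; rewrite mulf_eq0 => /orP[|/eqP //].
by rewrite (negPf (off_neq0 hb hs _)) // swap_wordK.
Qed.

Lemma admissible_perm sg tu : admissible sg -> admissible tu ->
  exists p : {perm 'I_N}, forall i, sg i = tu (p i).
Proof.
move=> hs ht; have [si sc _] := wordP _ _ _ hs.
have /fin_all_exists [p hp] (i : 'I_N) : exists j, tu j = sg i by apply: (word_surj la_part ht).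
have pi : injective p by move=> i j h; apply: si; rewrite -!hp h.
by exists (perm pi) => i; rewrite permE hp.
Qed.

(** A bounded potential that grows when an adjacent descent is removed; it is not the number of
    inversions. *)
Definition inversion_weight (p : {perm 'I_N}) : nat := (\sum_(i < N) i * p i)%N.

Lemma inversion_weight_swap (p : {perm 'I_N}) (a b : 'I_N) : b = a.+1 :> nat -> (p b < p a)%N ->
  (inversion_weight p < inversion_weight (tperm a b * p))%N.
Proof.
move=> hb hp; have nba : b != a by apply: contraTneq hp => ->; rewrite ltnn.
rewrite /inversion_weight (bigD1 a) //= [X in (_ + X)%N](bigD1 b) //=.
rewrite [X in (_ < X)%N](bigD1 a) //= [X in (_ < _ + X)%N](bigD1 b) //=.
rewrite !permM tpermL tpermR.
rewrite [X in (_ < _ + (_ + X))%N](eq_bigr (fun i : 'I_N => i * p i)%N); last first.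
  by move=> i /andP[ia ib]; rewrite permM tpermD // eq_sym.
rewrite hb; move: (bigop _ _ _) => X; nia.
Qed.

(** Bubble sort: [p] rearranges [sg] into [tu], and each adjacent descent of [p] is an admissible
    exchange among the first [k] positions. *)
Lemma antisym_connect k c sg tu : (k <= N)%N -> antisym_below k (span_vec c) ->
  admissible sg -> admissible tu -> (forall i : 'I_N, (k <= i)%N -> sg i = tu i) ->
  c sg = 0 -> c tu = 0.
Proof.
move=> hk hc hs ht hst; have [p hp] := admissible_perm hs ht.
have ti : injective tu by case/wordP: ht.
have bound (r : {perm 'I_N}) : (inversion_weight r <= N * (N * N))%N.
  apply: leq_trans (leq_sum _ (fun i _ => _ : _ <= N * N)%N) _.
    by move=> i _; apply: leq_mul; apply: ltnW.
  by rewrite sum_nat_const card_ord.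
have [n] := ubnP (N * (N * N) - inversion_weight p)%N.
elim: n p sg hp hs hst => // n IH p sg hp hs hst hn c0.
have pfix (i : 'I_N) : (k <= i)%N -> p i = i.
  by move=> /hst; rewrite hp => /ti.
have [/existsP[a /existsP[b /and3P[/eqP hb hbk hlt]]]|] :=
    boolP [exists a : 'I_N, exists b : 'I_N, [&& (b : nat) == a.+1, (b < k)%N & (p b < p a)%N]].
  have hs' : admissible (swap_word a b sg).
    (* If the exchange were blocked, the order of [tu] would put [p a] before [p b], against the
       descent. *)
    rewrite (admissible_swap hb hs); apply/negP => /andP[/eqP el hl].
    have [_ _ tb] := wordP _ _ _ ht; have := tb (p b) (p a); rewrite -!hp => /(_ hl).
    by move: el; rewrite /before !ffunE !hp => ->; rewrite ltnn eqxx /= ltnNge ltnW.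
  apply: (IH (tperm a b * p)%g (swap_word a b sg)) => //.
  - by move=> i; rewrite ffunE permM hp.
  - move=> i hi; by rewrite ffunE tpermD ?hst //; apply: contraTneq hi => <-; rewrite -ltnNge // -ltnS -hb ltnW.
  - have := inversion_weight_swap hb hlt; have := bound (tperm a b * p)%g; lia.
  exact: (antisym_propagate hb hbk).
(* Without a descent below [k] and with all later positions fixed, [p] is increasing, hence the
   identity. *)
rewrite negb_exists => /forallP nd.
suff p1 : p = 1%g by rewrite (_ : tu = sg) //; apply/ffunP => i; rewrite hp p1 perm1.
apply: perm_ge_id => i; have [ik|ki] := ltnP i k; last by rewrite pfix.
move: ik; have [m] := ubnP (i : nat); elim: m i => // m IHm i hm ik.
case: (posnP i) => [-> //|i0].
have hj : (i.-1 < N)%N by have := ltn_ord i; lia.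
pose j : 'I_N := Ordinal hj; have hij : i = j.+1 :> nat by rewrite /= prednK.
have := IHm j; rewrite /= => /(_ _ _) h; have {}h : (i.-1 <= p j)%N by apply: h; lia.
have := nd j; rewrite negb_exists => /forallP /(_ i); rewrite hij eqxx -hij ik /= -leqNgt.
rewrite leq_eqVlt => /orP[/eqP pji|]; last by lia.
by have := perm_inj (val_inj pji) => eji; move: hij; rewrite -eji; lia.
Qed.

Lemma antisym_eq0 c sg : antisym_below N (span_vec c) -> admissible sg -> c sg = 0 ->
  span_vec c = 0.
Proof.
move=> hc hs c0; rewrite /span_vec big1 // => tu ht.
rewrite (antisym_connect (leqnn N) hc hs ht _ c0) ?scale0r // => i.
by rewrite leqNgt ltn_ord.
Qed.

Hypothesis s_neqN1 : s + 1 != 0.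

Lemma antisym_row_adjacent c sg (a b : 'I_N) : b = a.+1 :> nat ->
  antisym_below N (span_vec c) -> admissible sg -> level sg a = level sg b ->
  (sg a).1 = (sg b).1 -> span_vec c = 0.
Proof.
move=> hb hc hs el er; apply: (antisym_eq0 hc hs).
have hc1 : content (sg a) = 1 + content (sg b).
  have := admissible_cases hb hs el; rewrite /content er.
  by case=> -[h1 h2]; move: h1 h2; rewrite ?er; lia.
have hsw : admissible (swap_word a b sg) = false.
  rewrite (admissible_swap hb hs) el eqxx /= /cell_lt er eqxx /=; apply: negbTE.
  rewrite negbK; move: hc1; rewrite /content er; lia.
have := antisym_coef hb (ltn_ord b) hc hs; rewrite /act hsw addr0.
rewrite /diag_coef /hecke_diag (wt_smul el hc1).
have wb := wt_neq0 sg b; have s1 : s - 1 != 0.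
  rewrite subr_eq0; apply/eqP => s1; have := @qs_inj 0 0 1 0.
  by rewrite !expr0 !mul1r expr1z expr0z => /(_ s1) [].
have -> : (s - 1) / (1 - wt sg b / (s * wt sg b)) = s by field; rewrite s0 wb s1.
move=> /eqP; rewrite -addr_eq0 -{2}[c sg]mul1r -mulrDl mulf_eq0 (negPf s_neqN1) /=.
by move/eqP.
Qed.

Hypothesis row_strictT : forall c d : 'I_N * 'I_N, in_shape la d -> c.1 = d.1 ->
  (c.2 < d.2)%N -> (Tf c.1 c.2 < Tf d.1 d.2)%N.

Lemma blocked_same_column sg (a b : 'I_N) : b = a.+1 :> nat -> admissible sg ->
  ~~ admissible (swap_word a b sg) -> level sg a = level sg b /\ (sg a).2 = (sg b).2.
Proof.
move=> hb hs; rewrite (admissible_swap hb hs) negbK => /andP[/eqP el].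
rewrite /cell_lt => /orP[/andP[/eqP e1 h]|/andP[/eqP e2 _]]; last by split.
have [_ hc _] := wordP _ _ _ hs.
have := row_strictT (hc a) e1 h; move: el; rewrite !ffunE => ->; by rewrite ltnn.
Qed.

(** The exchange is blocked and the diagonal entry is -1, so the antisymmetry equation holds at [sg]
    for every [c]. *)
Lemma column_coef c sg (a b : 'I_N) : b = a.+1 :> nat -> admissible sg ->
  level sg a = level sg b -> (sg a).2 = (sg b).2 -> act a b c sg = - c sg.
Proof.
move=> hb hs el ec.
have hc1 : content (sg b) = 1 + content (sg a).
  have := admissible_cases hb hs el; rewrite /content ec.
  by case=> -[h1 h2]; move: h1 h2; rewrite ?ec; lia.
have hsw : admissible (swap_word a b sg) = false.
  rewrite (admissible_swap hb hs) el eqxx /= /cell_lt ec eqxx /=; apply: negbTE.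
  rewrite negbK; move: hc1; rewrite /content ec; lia.
rewrite /act hsw addr0 /diag_coef /hecke_diag (wt_smul (esym el) hc1).
have wa := wt_neq0 sg a; have s1 : 1 - s != 0.
  rewrite subr_eq0; apply/eqP => s1; have := @qs_inj 0 0 0 1.
  by rewrite !expr0 !mul1r expr1z expr0z => /(_ s1) [].
by rewrite mulfK // -opprB mulNr divff // mulN1r.
Qed.

Lemma s_integer_neq0 n : \sum_(i < n.+1) (s^-1) ^+ i != 0.
Proof.
apply/eqP => h; have := subrX1 s^-1 n.+1; rewrite h mulr0 => /eqP.
rewrite subr_eq0 exprVn invr_eq1 => /eqP e1; have := @qs_inj 0 0 n.+1 0.
by rewrite !expr0 !mul1r expr0z -exprnP e1 => /(_ erefl) [].
Qed.

Definition ordn (i : nat) : 'I_N := insubd (Ordinal N_gt0) i.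

Lemma ordnE i : (i < N)%N -> ordn i = i :> nat.
Proof. by move=> hi; rewrite val_insubd hi. Qed.

Definition agree k (sg tu : filling) := forall i : 'I_N, (k <= i)%N -> sg i = tu i.

Lemma span_vec_sum n (r : 'I_n -> F) (c : 'I_n -> filling -> F) :
  \sum_m r m *: span_vec (c m) = span_vec (fun sg => \sum_m r m * c m sg).
Proof.
rewrite /span_vec; under eq_bigr do rewrite scaler_sumr.
rewrite exchange_big; apply: eq_bigr => sg _; rewrite scaler_suml.
by apply: eq_bigr => m _; rewrite scalerA.
Qed.

(** For a row-strict filling, only two such cells in consecutive positions can block each other's
    exchange. *)
Definition column_mate (d d' : 'I_N * 'I_N) : bool :=
  (d.2 == d'.2) && (Tf d.1 d.2 == Tf d'.1 d'.2).

(** Minimise the sum of the positions of the mates of the cell [tu K]. A mate just after a non-mate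
    could be moved forward, since a blocked pair would consist of two mates. *)
Lemma front_word k (K : 'I_N) tu : K = k :> nat -> admissible tu ->
  exists y j, [/\ admissible y, agree k y tu, (j <= k)%N,
    forall i, (i < j)%N -> column_mate (y (ordn i)) (tu K) &
    forall i, (j <= i)%N -> (i < k)%N -> ~~ column_mate (y (ordn i)) (tu K)].
Proof.
move=> hK ht; have hk : (k < N)%N by rewrite -hK.
pose A sg := admissible sg && [forall i : 'I_N, (k <= i)%N ==> (sg i == tu i)].
have AP sg : A sg -> admissible sg /\ agree k sg tu.
  move=> /andP[h1 /forallP h2]; split=> // i hi; apply/eqP.
  by have := h2 i; rewrite hi.
have At : A tu by rewrite /A ht; apply/forallP => i; rewrite eqxx implybT.
pose pot (sg : filling) := (\sum_(i < N) column_mate (sg i) (tu K) * i)%N.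
case: (arg_minnP pot At) => y /AP [hy yt] ymin.
have mate_front i (a b : 'I_N) : a = i :> nat -> b = i.+1 :> nat -> (i.+1 < k)%N ->
    column_mate (y b) (tu K) -> column_mate (y a) (tu K).
  move=> ha hb hi mb; apply/negPn/negP => ma.
  have hab : b = a.+1 :> nat by rewrite ha.
  have nba : b != a by rewrite -val_eqE /= hab neq_ltn ltnSn orbT.
  have hsw : admissible (swap_word a b y).
    apply/negPn/negP => /(blocked_same_column hab hy) [el ec].
    by case/negP: ma; move: mb el; rewrite /column_mate !ffunE ec => h ->.
  have : A (swap_word a b y).
    rewrite /A hsw; apply/forallP => j; apply/implyP => hj.
    by rewrite ffunE tpermD ?yt //; apply: contraTneq hj => <-; rewrite -ltnNge ?ha ?hb // ltnW.
  move=> /ymin; apply/negP; rewrite -ltnNge /pot.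
  rewrite (bigD1 a) // [X in (_ < X)%N](bigD1 a) //= (bigD1 b) //= [X in (_ < _ + X)%N](bigD1 b) //=.
  rewrite !ffunE tpermL tpermR mb (negPf ma).
  rewrite [X in (_ + (_ + X) < _)%N](eq_bigr (fun i : 'I_N => column_mate (y i) (tu K) * i)%N); last first.
    by move=> l /andP[la0 lb0]; rewrite ffunE tpermD // eq_sym.
  by rewrite hab !(mul0n, mul1n) !add0n ltn_add2r.
have [j [jk jm jn]] : exists j, [/\ (j <= k)%N, forall i, (i < j)%N -> column_mate (y (ordn i)) (tu K) &
    forall i, (j <= i)%N -> (i < k)%N -> ~~ column_mate (y (ordn i)) (tu K)].
  apply: initial_run => i hi; apply: (mate_front i) => //; apply: ordnE; apply: leq_trans hk; rewrite ltnS ?(ltnW hi) ?(ltnW (ltnW hi)) //.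
by exists y, j.
Qed.

Section Extension.

Variables (k : nat) (K : 'I_N) (tu : filling) (c : filling -> F).
Hypothesis hK : K = k :> nat.
Hypothesis c_supp : forall sg, admissible sg -> c sg != 0 -> agree k sg tu.

Let k_lt : (k < N)%N. Proof. by rewrite -hK. Qed.

Definition chain_swap m : filling -> filling :=
  swap_word (ordn (k.-1 - m)) (ordn (k.-1 - m).+1).

Fixpoint chain_coef m : filling -> F :=
  if m is m'.+1 then act (ordn (k.-1 - m')) (ordn (k.-1 - m').+1) (chain_coef m') else c.

(** The word [y] with the cell at position [k] carried [m] steps to the left. *)
Fixpoint chain_word (y : filling) m : filling :=
  if m is m'.+1 then chain_swap m' (chain_word y m') else y.

Let posE m : (m < k)%N -> [/\ ordn (k.-1 - m) = (k.-1 - m)%N :> nat,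
  ordn (k.-1 - m).+1 = (k.-1 - m).+1 :> nat & (k.-1 - m).+1 = (k - m)%N].
Proof. by move: k_lt => hk hm; split; rewrite ?ordnE //; clear -hk hm; lia. Qed.

Let posS m : (m < k)%N -> ordn (k.-1 - m).+1 = (ordn (k.-1 - m)).+1 :> nat.
Proof. by case/posE => -> ->. Qed.

Lemma chain_coefE m : (m <= k)%N -> down_chain T k (span_vec c) m = span_vec (chain_coef m).
Proof.
elim: m => // m IH hm /=; rewrite IH ?(ltnW hm) // -(T_span _ (posS hm)).
by have [-> _ _] := posE hm.
Qed.

(** Each factor of the chain moves the cell [tu K] by at most one step, so after [m] factors it has
    not passed position [k-m]. *)
Lemma chain_supp m sg : (m <= k)%N -> admissible sg -> chain_coef m sg != 0 ->
  agree k.+1 sg tu /\ forall i : 'I_N, (i < k - m)%N -> sg i != tu K.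
Proof.
elim: m sg => [|m IH] sg hm hs.
  move=> /(c_supp hs) ha; split=> [i hi|i]; first by apply: ha; apply: ltnW.
  rewrite subn0 -(ha K) ?hK // => hi; have [si _ _] := wordP _ _ _ hs.
  by rewrite (inj_eq si) -val_eqE /= hK neq_ltn hi.
have [e1 e2 e3] := posE hm; rewrite /= /act.
have [cs0|cs] := eqVneq (chain_coef m sg) 0; last first.
  move=> _; have [h1 h2] := IH _ (ltnW hm) hs cs; split=> // i hi; apply: h2; clear -hi; lia.
rewrite cs0 mulr0 add0r; case: ifP => [hsw|]; last by rewrite eqxx.
rewrite mulf_eq0 negb_or => /andP[_ h]; have [h1 h2] := IH _ (ltnW hm) hsw h.
have fixi (i : 'I_N) : (i < k.-1 - m)%N || (k < i)%N ->
    swap_word (ordn (k.-1 - m)) (ordn (k.-1 - m).+1) sg i = sg i.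
  by move=> hi; rewrite ffunE tpermD // -val_eqE /= ?e1 ?e2; clear -hi hm; lia.
split=> i hi; first by rewrite -(h1 i hi) fixi ?hi ?orbT.
by rewrite -fixi ?h2 //; clear -hi hm; lia.
Qed.

Variables (y : filling) (j : nat).
Hypothesis y_adm : admissible y.
Hypothesis y_tu : agree k y tu.
Hypothesis jk : (j <= k)%N.
Hypothesis y_mate : forall i, (i < j)%N -> column_mate (y (ordn i)) (tu K).
Hypothesis y_nmate : forall i, (j <= i)%N -> (i < k)%N -> ~~ column_mate (y (ordn i)) (tu K).

Let ordK : ordn k = K.
Proof. by apply: val_inj; rewrite /= ordnE. Qed.

Lemma chain_wordP m : (m <= k - j)%N -> [/\ admissible (chain_word y m),
  chain_word y m (ordn (k - m)) = tu K &
  forall i : 'I_N, (i < k - m)%N -> chain_word y m i = y i].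
Proof.
elim: m => [|m IH] hm; first by split; rewrite // subn0 ordK y_tu // hK.
have hmk : (m < k)%N := leq_trans hm (leq_subr _ _).
have [e1 e2 e3] := posE hmk; have [h1 h2 h3] := IH (ltnW hm).
have hsw : admissible (chain_swap m (chain_word y m)).
  apply/negPn/negP => /(blocked_same_column (posS hmk) h1) [el ec].
  have hya : chain_word y m (ordn (k.-1 - m)) = y (ordn (k.-1 - m)) by apply: h3; rewrite e1; clear -hmk; lia.
  have /negP[] : ~~ column_mate (y (ordn (k.-1 - m))) (tu K) by apply: y_nmate; clear -hm hmk; lia.
  by move: el ec; rewrite e3 !ffunE h2 hya => el ec; rewrite /column_mate ec -el ec !eqxx.
split=> //=.
- by rewrite ffunE (_ : k - m.+1 = k.-1 - m)%N ?tpermL ?e3 //; clear; lia.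
- move=> i hi; rewrite ffunE tpermD ?h3 // -?val_eqE /= ?e1 ?e2; clear -hi hmk; lia.
Qed.

(** By [chain_supp] the diagonal term contributes nothing here; the coefficient is the previous one
    times a nonzero off-diagonal entry. *)
Lemma chain_word_neq0 m : c y != 0 -> (m <= k - j)%N -> chain_coef m (chain_word y m) != 0.
Proof.
move=> cy; elim: m => [|m IH] hm //; have hmk : (m < k)%N := leq_trans hm (leq_subr _ _).
have [h1 h2 h3] := chain_wordP (ltnW hm); have [g1 g2 _] := chain_wordP hm.
rewrite /= /act swap_wordK h1.
have -> : chain_coef m (chain_swap m (chain_word y m)) = 0.
  apply/eqP/negPn/negP => h; have [_ hh] := chain_supp (ltnW hmk) g1 h.
  have := hh (ordn (k - m.+1)); rewrite (g2 : chain_swap m (chain_word y m) _ = _) eqxx => h'.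
  have hmN : (k - m.+1 < N)%N := leq_ltn_trans (leq_subr _ _) k_lt.
  have // : ~~ true by apply: h'; rewrite ordnE //; clear -hmk; lia.
rewrite mulr0 add0r mulf_neq0 ?IH //; last exact: ltnW.
by apply: off_neq0 => //; apply: posS.
Qed.

Local Notation m0 := (k - j)%N.
Local Notation y' := (chain_word y m0).

Let y'j : y' (ordn j) = tu K.
Proof. by have [_ <- _] := chain_wordP (leqnn m0); rewrite subKn. Qed.

Let y'_adm : admissible y'. Proof. by have [] := chain_wordP (leqnn m0). Qed.

Lemma chain_low m : (m < m0)%N -> chain_coef m y' = 0.
Proof.
move=> hm; apply/eqP/negPn/negP => h.
have [_ hh] := chain_supp (ltnW (leq_trans hm (leq_subr _ _))) y'_adm h; have := hh (ordn j).
rewrite y'j eqxx => h'; have // : ~~ true.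
apply: h'; rewrite ordnE ?(leq_ltn_trans jk k_lt) //; clear -hm jk; lia.
Qed.

Lemma chain_mate (i : 'I_N) : (i <= j)%N ->
  (y' i).2 = (tu K).2 /\ level y' i = Tf (tu K).1 (tu K).2.
Proof.
have [_ _ y'i] := chain_wordP (leqnn m0).
move=> hi; rewrite ffunE; have [ij|ne] := eqVneq (i : nat) j.
  by rewrite (_ : i = ordn j) ?y'j //; apply: val_inj; rewrite /= ordnE // -ij.
have ij : (i < j)%N by rewrite ltn_neqAle ne.
rewrite y'i ?subKn //; have := y_mate ij; rewrite (_ : ordn i = i).
  by case/andP=> /eqP -> /eqP ->.
by apply: val_inj; rewrite /= ordnE.
Qed.

(** The positions [0] to [j] of [y'] are filled by mates, so by [column_coef] each further factor
    only changes the sign. These signs cancel those of the powers of -1/s. *)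
Lemma chain_high l : (l <= j)%N -> chain_coef (m0 + l) y' = (-1) ^+ l * chain_coef m0 y'.
Proof.
elim: l => [|l IH] hl; first by rewrite addn0 expr0 mul1r.
have hmk : (m0 + l < k)%N by clear -hl jk; lia.
have [e1 e2 e3] := posE hmk; rewrite addnS /=.
have [|c1 l1] := @chain_mate (ordn (k.-1 - (m0 + l))); first by rewrite e1; clear -jk; lia.
have [|c2 l2] := @chain_mate (ordn (k.-1 - (m0 + l)).+1); first by rewrite e2; clear -jk hl; lia.
rewrite (column_coef _ (posS hmk)) ?l1 ?c1 // IH ?(ltnW hl) //.
by rewrite exprS mulN1r mulNr.
Qed.

(* Nonvanishing is seen on the word where the cells of the same column and level as the new cell *)
(* come first: the new cell moves left to them by off-diagonal coefficients, and the remaining   *)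
(* terms of the sum contribute an s-integer.                                                      *)
Lemma chain_sum_neq0 : c y != 0 -> \sum_(m < k.+1) (- s^-1) ^+ m * chain_coef m y' != 0.
Proof.
move=> cy; rewrite -(big_mkord xpredT (fun m => (- s^-1) ^+ m * chain_coef m y')).
rewrite (big_cat_nat (n := m0)) //=; last by apply: leqW; rewrite leq_subr.
rewrite big_nat big1 ?add0r => [|m hm]; last by rewrite chain_low ?mulr0.
rewrite -{1}[m0]add0n big_addn (_ : k.+1 - m0 = j.+1)%N; last by clear -jk; lia.
rewrite big_mkord (eq_bigr (fun l : 'I_j.+1 => (- s^-1) ^+ m0 * chain_coef m0 y' * s^-1 ^+ l)).
  rewrite -mulr_sumr mulf_neq0 ?s_integer_neq0 // mulf_neq0 ?chain_word_neq0 //.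
  by rewrite expf_neq0 // oppr_eq0 invr_eq0.
move=> l _; rewrite addnC chain_high; last by rewrite -ltnS.
by rewrite exprD [in X in _ * X * _]exprNn -!mulrA [X in _ * (_ * X)]mulrCA signrMK [X in _ = _ * X]mulrC.
Qed.

End Extension.

Lemma antisym_extend k (K : 'I_N) tu c : K = k :> nat -> admissible tu ->
  (forall sg, admissible sg -> c sg != 0 -> agree k sg tu) ->
  antisym_below k (span_vec c) -> (exists2 sg, admissible sg & c sg != 0) ->
  exists c', [/\ forall sg, admissible sg -> c' sg != 0 -> agree k.+1 sg tu,
    antisym_below k.+1 (span_vec c') & exists2 sg, admissible sg & c' sg != 0].
Proof.
move=> hK ht supp hc [sg0 hsg0 c0]; have hk : (k < N)%N by rewrite -hK.
have [y [j [hy yt jk jm jn]]] := front_word hK ht.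
(* The words in the support agree from [k] on, hence are linked to [y] by exchanges below [k], where
   antisymmetry already holds; a zero at [y] would spread to [sg0]. *)
have cy : c y != 0.
  apply/eqP => cy0; apply: (negP c0); apply/eqP.
  apply: (antisym_connect (ltnW hk) hc hy hsg0) cy0 => i hi.
  by rewrite yt // (supp _ hsg0 c0).
exists (fun sg => \sum_(m < k.+1) (- s^-1) ^+ m * chain_coef k c m sg); split.
- move=> sg hs; have [/existsP[m hm]|] := boolP [exists m : 'I_k.+1, chain_coef k c m sg != 0].
    by have [] := chain_supp hK supp (ltn_ord m) hs hm.
  rewrite negb_exists => /forallP h; rewrite big1 ?eqxx // => m _.
  by have /negPn/eqP -> := h m; rewrite mulr0.
- rewrite -span_vec_sum => i hi.
  rewrite -(eq_bigr _ (fun (m : 'I_k.+1) _ => congr1 (fun u => (- s^-1) ^+ m *: u)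
    (chain_coefE c hK (ltn_ord m)))).
  exact: (antisymmetrizeP s0 quad braid far hk hc).
exists (chain_word k y (k - j)).
  by have [] := chain_wordP hK hy yt jn (leqnn _).
exact: (chain_sum_neq0 hK supp hy yt jk jm jn cy).
Qed.

Lemma antisym_exists tu : admissible tu ->
  exists c, antisym_below N (span_vec c) /\ exists2 sg, admissible sg & c sg != 0.
Proof.
move=> ht; suff /(_ N (leqnn N)) [c [_ h1 h2]] : forall k, (k <= N)%N -> exists c,
    [/\ forall sg, admissible sg -> c sg != 0 -> agree k sg tu,
    antisym_below k (span_vec c) & exists2 sg, admissible sg & c sg != 0] by exists c.
elim=> [_|k IH hk].
  exists (fun sg => (sg == tu)%:R); split=> //.
    by move=> sg _; case: (eqVneq sg tu) => [-> //|_]; rewrite eqxx.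
  by exists tu; rewrite // eqxx oner_eq0.
have [c [h1 h2 h3]] := IH (ltnW hk).
exact: (antisym_extend (erefl : Ordinal hk = k :> nat) ht h1 h2 h3).
Qed.

Lemma antisym_line c c0 sg : antisym_below N (span_vec c) -> antisym_below N (span_vec c0) ->
  admissible sg -> c0 sg != 0 -> exists r, span_vec c = r *: span_vec c0.
Proof.
move=> hc hc0 hs c00; exists (c sg / c0 sg); apply/eqP; rewrite -subr_eq0 -scaleNr addrC.
rewrite -span_vecP; apply/eqP/(antisym_eq0 _ hs).
  by move=> i hi; rewrite span_vecP linearD linearZ /= hc // hc0 // opprD scalerN.
by rewrite mulNr divfK // addNr.
Qed.

End Basis.

End AntisymmetricWords.

(** * The row reading word *)

Section ReadingWord.

Variables (N : nat) (la : seq nat).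
Hypothesis la_part : is_partition N la.
Local Notation filling := {ffun 'I_N -> 'I_N * 'I_N}.

(* Rows from top to bottom, each read from right to left. *)
Definition reading (c d : 'I_N * 'I_N) : bool :=
  (d.1 < c.1)%N || ((d.1 == c.1 :> nat) && (d.2 <= c.2)%N).

(** Sort the cells by the total order [reading]: nothing lies strictly between two neighbours of a
    row, so they become consecutive. *)
Lemma reading_word : exists sg : filling, [/\ injective sg, forall i, in_shape la (sg i),
  forall i j, cell_lt (sg i) (sg j) -> (j < i)%N &
  forall i j, (sg i).1 = (sg j).1 -> (sg i).2 = (sg j).2.+1 :> nat -> j = i.+1 :> nat].
Proof.
pose l := sort reading (enum [set c : 'I_N * 'I_N | in_shape la c]).
have lS : size l = N by rewrite size_sort -cardE card_shape.
have lU : uniq l by rewrite sort_uniq enum_uniq.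
have r_tot : total reading by move=> c d; rewrite /reading; lia.
have r_refl : reflexive reading by move=> c; rewrite /reading; lia.
have r_tr : transitive reading by move=> c d f; rewrite /reading; lia.
case: (posnP N) => [N0|N_gt0].
  by exists [ffun i : 'I_N => (i, i)]; split=> [i|i|i|i]; have := ltn_ord i; rewrite [X in (_ < X)%N]N0.
pose c0 := (Ordinal N_gt0, Ordinal N_gt0).
pose sg : filling := [ffun i : 'I_N => nth c0 l i].
have sgI : injective sg.
  by move=> i j /eqP; rewrite !ffunE nth_uniq ?lS // => /eqP/val_inj.
have sgR (i j : 'I_N) : (i <= j)%N -> reading (sg i) (sg j).
  move=> ij; rewrite !ffunE; apply: (sorted_leq_nth r_tr r_refl) => //; rewrite ?inE ?lS //.
  exact: sort_sorted.
exists sg; split=> //.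
- move=> i; have : sg i \in l by rewrite ffunE mem_nth ?lS.
  by rewrite mem_sort mem_enum inE.
- move=> i j; rewrite [(j < i)%N]ltnNge; apply: contraL => /sgR.
  by rewrite /reading /cell_lt -!val_eqE /=; clear; lia.
move=> i j e1 e2; have ij : (i < j)%N.
  by rewrite ltnNge; apply/negP => /sgR; rewrite /reading e1; clear -e2; lia.
apply/eqP/negPn/negP => nij.
have hk : (i.+1 < N)%N by have := ltn_ord j; clear -ij; lia.
pose k : 'I_N := Ordinal hk.
have r1 := sgR i k (leqnSn i); have r2 : reading (sg k) (sg j) by apply: sgR => /=; clear -ij nij; lia.
have [ek|ek] : sg k = sg i \/ sg k = sg j.
  have er : ((sg k).1 : nat) = (sg j).1.
    by move: r1 r2; rewrite /reading e1; clear; lia.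
  have [ec|ec] : ((sg k).2 : nat) = (sg i).2 \/ ((sg k).2 : nat) = (sg j).2.
    by move: r1 r2; rewrite /reading e1; clear -e2 er; lia.
  - by left; apply: cell_eq; rewrite ?e1.
  by right; apply: cell_eq.
- by move: (sgI _ _ ek) => /(congr1 val) /=; clear; lia.
by move: nij; rewrite -(sgI _ _ ek) eqxx.
Qed.

Variable Tf : nat -> nat -> nat.
Hypothesis T_incr : weakly_increasing la Tf.

(** A cell further right or higher is read earlier and carries at least as large a value, which is
    what [before] demands. *)
Lemma admissible_reading : exists sg : filling, admissible la Tf sg /\
  forall i j, (sg i).1 = (sg j).1 -> (sg i).2 = (sg j).2.+1 :> nat -> j = i.+1 :> nat.
Proof.
have [sg [h1 h2 h3 h4]] := reading_word; exists sg; split=> //.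
apply/wordP; split=> // i j hij; have ji := h3 i j hij; rewrite /before !ffunE.
suff : (Tf (sg i).1 (sg i).2 <= Tf (sg j).1 (sg j).2)%N by clear -ji; lia.
have [t1 t2] := T_incr; case/orP: hij => /andP[/eqP -> /ltnW h].
  by apply: t1 => //; apply: h2.
by apply: t2 => //; apply: h2.
Qed.

End ReadingWord.

(** * Pairs of a composition and a tableau correspond to words *)

Section Standardization.

Variables (N : nat) (la : seq nat).
Local Notation filling := {ffun 'I_N -> 'I_N * 'I_N}.
Implicit Types (v : {ffun 'I_N -> nat}) (t : Tab N la).

(** The count in [rv] includes [i] itself, and its predecessor removes it. *)
Lemma rvE v i : rv v i = #|[set j | before v j i]|.
Proof.
rewrite /rv -cardsUI [X in (_ + X)%N]eq_card0 => [|j]; last first.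
  by rewrite !inE; clear; lia.
rewrite addn0 (_ : _ :|: _ = i |: [set j | before v j i]).
  by rewrite cardsU1 inE before_irr.
apply/setP => j; rewrite !inE /before -val_eqE /=; case: (eqVneq j i) => [->|]; last first.
  by rewrite -val_eqE /=; clear; lia.
by clear; lia.
Qed.

Lemma rv_lt v i : (rv v i < N)%N.
Proof.
rewrite rvE -[X in (_ < X)%N]card_ord -cardsT; apply: proper_card; rewrite properE subsetT /=.
by apply/subsetPn; exists i; rewrite ?inE ?before_irr.
Qed.

Definition rank v i : 'I_N := Ordinal (rv_lt v i).

Lemma rank_mono v i j : before v i j -> (rank v i < rank v j)%N.
Proof.
move=> hij; rewrite /= !rvE; apply: proper_card; apply/properP; split.
  by apply/subsetP => k; rewrite !inE => /before_trans; apply.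
by exists i; rewrite !inE ?before_irr.
Qed.

Lemma rank_inj v : injective (rank v).
Proof.
move=> i j e; apply/eqP/negPn/negP => /(before_total v) /orP[] /rank_mono; by rewrite e ltnn.
Qed.

Lemma before_rank v i j : before v i j = (rank v i < rank v j)%N.
Proof.
apply/idP/idP; first exact: rank_mono.
apply: contraTT => nij; rewrite -leqNgt leq_eqVlt.
have [-> |ne] := eqVneq i j; first by rewrite eqxx.
by case/orP: (before_total v ne) nij => [-> //|/rank_mono ->]; rewrite orbT.
Qed.

Definition rank_perm v : {perm 'I_N} := perm (@rank_inj v).

Lemma vplus_rank v i : vplus v (rank v i) = v i.
Proof.
pose p := (rank_perm v)^-1%g; pose l := [seq v (p k) | k <- enum 'I_N].
have pk k : rank v (p k) = k by rewrite -[LHS](permE (@rank_inj v)) permKV.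
have -> : v i = nth 0%N l (rank v i).
  rewrite (nth_map (rank v i)) ?size_enum_ord // nth_ord_enum; congr (v _).
  by apply: (@rank_inj v); rewrite pk.
rewrite /vplus; congr (nth _ _ _).
have gt : transitive geq by move=> x y z /= h h'; apply: leq_trans h' h.
apply: (sorted_eq gt); first by move=> x y /=; clear; lia.
- by apply: sort_sorted => x y /=; clear; lia.
- rewrite /l sorted_map; have : sorted (relpre (@nat_of_ord N) leq) (enum 'I_N).
    by rewrite -sorted_map val_enum_ord iota_sorted.
  apply: sub_sorted => a b /=; rewrite leq_eqVlt => /orP[/eqP/val_inj -> //|].
  by rewrite -{1}(pk a) -{1}(pk b) -before_rank /before; clear; lia.
rewrite perm_sort /l (map_comp v p); apply: perm_map; apply: uniq_perm.
- exact: enum_uniq.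
- by rewrite map_inj_uniq ?enum_uniq //; apply: perm_inj.
move=> k; rewrite mem_enum; apply/esym/mapP; exists (rank v k); first by rewrite mem_enum.
by apply: (@rank_inj v); rewrite pk.
Qed.

Definition tab_word v t : filling := [ffun i : 'I_N => val t (rank v i)].

Lemma cellT_val t (a : 'I_N) : cellT t a = ((val t a).1 : nat, (val t a).2 : nat).
Proof. by rewrite /cellT valK. Qed.

Lemma CT_rv v t i : CT t (rv v i) = content (tab_word v t i).
Proof. by rewrite /CT /colT /rowT (cellT_val t (rank v i)) /content ffunE. Qed.

Lemma tab_word_word v t : word la v (tab_word v t).
Proof.
case/and4P: (valP t) => /injectiveP h1 /forallP h2 h3 h4; apply/wordP; split.
- by move=> i j; rewrite !ffunE => /h1/rank_inj.
- by move=> i; rewrite ffunE; apply: h2.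
move=> i j; rewrite !ffunE before_rank => /orP[h|h].
  by move/forallP: h3 => /(_ (rank v i)) /forallP /(_ (rank v j)); rewrite h.
by move/forallP: h4 => /(_ (rank v i)) /forallP /(_ (rank v j)); rewrite h.
Qed.

(** The part of rank [a] in [v] is the [a]-th entry of the decreasing rearrangement ([vplus_rank]),
    so the condition on entries of the tableau becomes one on positions. *)
Lemma fill_eqP v t T : fill_eq t v T <-> level T (tab_word v t) = v.
Proof.
split=> [h|h a].
  apply/ffunP => i; have := h (rank v i).
  by rewrite /rowT /colT cellT_val vplus_rank !ffunE.
pose i := (rank_perm v)^-1%g a.
have ai : rank v i = a by rewrite -[LHS](permE (@rank_inj v)) permKV.
have := congr1 (fun u : {ffun 'I_N -> nat} => u i) h.
by rewrite -ai vplus_rank /rowT /colT cellT_val !ffunE.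
Qed.

Lemma word_tab v (sg : filling) : word la v sg -> exists t, tab_word v t = sg.
Proof.
move=> /wordP [h1 h2 h3]; pose p := (rank_perm v)^-1%g.
have pk k : rank v (p k) = k by rewrite -[LHS](permE (@rank_inj v)) permKV.
have pi i : p (rank v i) = i by apply: (@rank_inj v); rewrite pk.
pose f : filling := [ffun k : 'I_N => sg (p k)].
have ft : tabb la f.
  apply/and4P; split.
  - by apply/injectiveP => i j; rewrite !ffunE => /h1/perm_inj.
  - by apply/forallP => i; rewrite ffunE; apply: h2.
  - apply/forallP => i; apply/forallP => j; apply/implyP; rewrite !ffunE => h.
    by rewrite -(pk i) -(pk j) -before_rank; apply: h3; rewrite /cell_lt h.
  apply/forallP => i; apply/forallP => j; apply/implyP; rewrite !ffunE => h.
  by rewrite -(pk i) -(pk j) -before_rank; apply: h3; rewrite /cell_lt h orbT.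
by exists (exist _ f ft); apply/ffunP => i; rewrite !ffunE pi.
Qed.

Lemma tab_word_inj v : injective (@tab_word v).
Proof.
move=> t t' e; apply: val_inj; apply/ffunP => a.
pose i := (rank_perm v)^-1%g a.
have ai : rank v i = a by rewrite -[LHS](permE (@rank_inj v)) permKV.
by have := congr1 (fun u : filling => u i) e; rewrite !ffunE ai.
Qed.

End Standardization.

(** * From the affine Hecke relations to antisymmetric vectors *)

Section Synthesis.

Variables (F : fieldType) (M : lmodType F) (s q : F) (N : nat) (la : seq nat).
Local Notation filling := {ffun 'I_N -> 'I_N * 'I_N}.
Local Notation composition := {ffun 'I_N -> nat}.

Variables (T : nat -> {linear M -> M}) (w : {linear M -> M}) (x : nat -> {linear M -> M}).
Hypothesis N_gt1 : (1 < N)%N.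
Hypothesis la_part : is_partition N la.
Hypothesis s0 : s != 0.
Hypothesis q0 : q != 0.
Hypothesis s_neqN1 : s + 1 != 0.
Hypothesis qs_inj : forall (m n : nat) (k l : int),
  q ^+ m * s ^ k = q ^+ n * s ^ l -> m = n /\ k = l.
Hypothesis quad : forall i f, (i.+1 < N)%N -> T i (T i f) = (s - 1) *: T i f + s *: f.
Hypothesis braid : forall i f, (i.+2 < N)%N ->
  T i (T i.+1 (T i f)) = T i.+1 (T i (T i.+1 f)).
Hypothesis far : forall i j f, (i.+1 < j)%N -> (j.+1 < N)%N -> T i (T j f) = T j (T i f).
Hypothesis wT : forall i f, (i.+2 < N)%N -> w (T i.+1 f) = T i (w f).
Hypothesis wwT : forall f, w (w (T 0%N f)) = T N.-2 (w (w f)).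
Hypothesis Tx : forall i f, (i.+1 < N)%N -> T i (x i f) = x i.+1 (T i f + (1 - s) *: f).
Hypothesis Tx_far : forall i j f, (i.+1 < N)%N -> (j < N)%N -> j != i -> j != i.+1 ->
  T i (x j f) = x j (T i f).
Hypothesis wx0 : forall f, w (x 0%N f) = q *: x N.-1 (w f).
Hypothesis wxS : forall j f, (j.+1 < N)%N -> w (x j.+1 f) = x j (w f).
Hypothesis x_inj : forall f, x N.-1 f = 0 -> f = 0.

Variables (u : filling -> M) (cA cO : int -> F).
Hypothesis u_neq0 : forall f, tabb la f -> u f != 0.
Hypothesis cA_ratio : forall k l, cA (l - k) = (s - 1) / (1 - s ^ l / s ^ k).
Hypothesis Tu : forall f (a b : 'I_N), b = a.+1 :> nat -> tabb la f ->
  T a (u f) = cA (content (f b) - content (f a)) *: u f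
    + cO (content (f b) - content (f a)) *: u (swap_word a b f).
Hypothesis tabb_swap : forall f (a b : 'I_N), b = a.+1 :> nat -> tabb la f ->
  cO (content (f b) - content (f a)) != 0 -> tabb la (swap_word a b f).
Hypothesis content_neq : forall f (a b : 'I_N), b = a.+1 :> nat -> tabb la f ->
  content (f b) - content (f a) != 0.
Hypothesis content_last : forall f (a : 'I_N), a = N.-1 :> nat -> tabb la f -> content (f a) = 0.
Hypothesis w_u : forall f, tabb la f ->
  w (downT s T N.-1 (u f)) = foldl (fun g k => T k g) (downT s T N.-1 (u f)) (iota 0 N.-1).

Let N_gt0 : (0 < N)%N := ltnW N_gt1.
Local Notation E := (@joint_eigen F M s N T w).

(** Descending induction on [i]. The largest entry sits in the corner, of content 0, and gives
    eigenvalue 1 by [cherednik_last]; [cherednik_rec] does the rest inside the block of [f] and its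
    exchange. *)
Lemma cherednik_base f (i : 'I_N) : tabb la f ->
  cherednik s N T w i (u f) = s ^ content (f i) *: u f.
Proof.
have [n] := ubnP (N - i)%N; elim: n i f => // n IH i f hn hf.
have [e|ne] := eqVneq (i : nat) N.-1.
  rewrite (content_last e hf) expr0z scale1r e; apply: (cherednik_last s0) => //.
  exact: w_u.
have hi : (i.+1 < N)%N by have := ltn_ord i; clear -ne; lia.
pose b : 'I_N := Ordinal hi; have hb : b = i.+1 :> nat by [].
have hbn : (N - b < n)%N by rewrite hb; clear -hn hi; lia.
have ab0 : s ^ content (f i) != 0 by apply: expfz_neq0.
have gap1 : s ^ content (f i) - s ^ content (f b) != 0.
  rewrite subr_eq0; apply/eqP => h; have := @qs_inj 0 0 (content (f i)) (content (f b)).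
  by rewrite h => /(_ erefl) [_ /eqP]; rewrite eq_sym -subr_eq0 (negPf (content_neq hb hf)).
have := cA_ratio (content (f i)) (content (f b)).
have := Tu hb hf; set A := cA _; set O := cO _ => TE AE.
have TO : O *: u (swap_word i b f) = T i (u f) - A *: u f by rewrite TE addrAC subrr add0r.
(* Either the coefficient [O] vanishes, or the exchanged filling is a tableau and the induction
   hypothesis applies to it. *)
have EO : cherednik s N T w b (O *: u (swap_word i b f)) =
    s ^ content (f i) *: (O *: u (swap_word i b f)).
  rewrite cherednikZ; have [-> | hO] := eqVneq O 0; first by rewrite !scale0r scaler0.
  by rewrite IH ?(tabb_swap hb hf hO) // ffunE tpermR !scalerA mulrC.
have Az : A * (s ^ content (f i) - s ^ content (f b)) = (s - 1) * s ^ content (f i).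
  by rewrite AE; field; rewrite ab0 gap1.
rewrite cherednik_rec // -hb TE cherednikD EO cherednikZ IH // TO.
rewrite [T i (_ + _)]linearD ![T i (_ *: _)]linearZ /= [T i (_ - _)]linearB [T i (A *: _)]linearZ /= quad //.
move: Az; set z := s ^ content (f i); set y := s ^ content (f b) => Az; set v := T i (u f).
have -> : A *: (y *: v) + z *: ((s - 1) *: v + s *: u f - A *: v) =
    (A * y + z * (s - 1) - z * A) *: v + (z * s) *: u f.
  by rewrite scalerBr scalerDr !scalerA !addrA addrAC -scalerDl -scalerBl.
have -> : A * y + z * (s - 1) - z * A = 0 by rewrite [z * (s - 1)]mulrC -Az; ring.
by rewrite scale0r add0r scalerA mulrCA mulVf // mulr1.
Qed.

Variable deg_le : nat -> M -> Prop.
Hypothesis deg_le_T : forall i d f, (i.+1 < N)%N -> deg_le d f -> deg_le d (T i f).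
Hypothesis deg_le_w : forall d f, deg_le d f -> deg_le d (w f).
Hypothesis deg_le_x : forall d f, deg_le d f -> deg_le d.+1 (x N.-1 f).
Hypothesis deg_leD : forall d f g, deg_le d f -> deg_le d g -> deg_le d (f + g).
Hypothesis deg_leZ : forall d c f, deg_le d f -> deg_le d (c *: f).
Hypothesis deg_leW : forall d d' f, (d <= d')%N -> deg_le d f -> deg_le d' f.
Hypothesis deg_ex : forall f, exists d, deg_le d f.
Hypothesis u_deg : forall f, tabb la f -> deg_le 0 (u f).

Variables (Id : nat -> finType) (idx : forall d, Id d -> composition * filling).
Variable (coord : forall d, Id d -> M -> F).
Hypothesis idx_word : forall d (y : Id d), word la (idx y).1 (idx y).2.
Hypothesis idx_deg : forall d (y : Id d), (comp_sum (idx y).1 <= d)%N.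
Hypothesis idx_inj : forall d, injective (@idx d).
Hypothesis idx_surj : forall d v sg, word la v sg -> (comp_sum v <= d)%N ->
  exists y : Id d, idx y = (v, sg).
Hypothesis coordP : forall d (y : Id d) c f g, coord y (c *: f + g) = c * coord y f + coord y g.
Hypothesis coord_inj : forall d f, deg_le d f -> (forall y : Id d, coord y f = 0) -> f = 0.

Let E_ext z z' f : z =1 z' -> E z f -> E z' f.
Proof. by move=> h Ef i; rewrite -h. Qed.

Let EZ z c f : E z f -> E z (c *: f).
Proof. exact: joint_eigenZ. Qed.

Let EB z f g : E z f -> E z g -> E z (f - g).
Proof. exact: joint_eigen_sub. Qed.

Let E_indep (I : finType) (z : I -> 'I_N -> F) (g : I -> M) (S : {set I}) :
  (forall y t, y \in S -> t \in S -> y != t -> exists i, z y i != z t i) ->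
  (forall y, y \in S -> E (z y) (g y)) ->
  \sum_(y in S) g y = 0 -> forall y, y \in S -> g y = 0.
Proof. exact: eigen_independent. Qed.

Let E_intertwine z (a b : 'I_N) f : b = a.+1 :> nat -> E z f ->
  z a != 0 -> z a != z b -> E (fun k => z (tperm a b k)) (T a f - hecke_diag s z a b *: f).
Proof. by apply: intertwine. Qed.

Let raise (f : M) : M := affine_raise N w x f.

Let E_raise z z' f : E z f ->
  (forall i j : 'I_N, j = i.+1 :> nat -> z' i = z j) ->
  (forall i j : 'I_N, i.+1 = N -> j = 0%N :> nat -> z' i = q * z j) ->
  E z' (raise f).
Proof.
have raiseZ c g : raise (c *: g) = c *: raise g by rewrite /raise /affine_raise !linearZ.
move=> Ef h1 h2 i; have [e|ne] := eqVneq i.+1 N.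
  rewrite (h2 i (Ordinal N_gt0)) // (_ : i = N.-1 :> nat); last by rewrite -[in RHS]e.
  rewrite [LHS](cherednik_last_raise (q := q)) // -/(raise _).
  by rewrite (Ef (Ordinal N_gt0)) raiseZ scalerA.
have hi : (i.+1 < N)%N by rewrite ltn_neqAle ne ltn_ord.
rewrite (h1 i (Ordinal hi)) // [LHS]cherednik_raise // -/(raise _).
by rewrite (Ef (Ordinal hi)) raiseZ.
Qed.

Let raise_eq0 z f : E z f -> (forall i, z i != 0) -> raise f = 0 -> f = 0.
Proof.
(* Since [downT 0] is the identity, [w f = 0] makes [cherednik 0] vanish on [f], against a nonzero
   eigenvalue. *)
move=> Ef z0 /x_inj wf; have := Ef (Ordinal N_gt0).
rewrite /cherednik /downT /= wf /upT; have foldl0 l : foldl (fun g k => T k g) 0 l = 0.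
  by elim: l => //= k l IH; rewrite linear0.
by rewrite foldl0 scaler0 => /esym/eqP; rewrite scaler_eq0 (negPf (z0 _)) => /eqP.
Qed.

Let deg_le_raise d f : deg_le d f -> deg_le d.+1 (raise f).
Proof. by move=> hf; apply/deg_le_x/deg_le_w. Qed.

Let u_eigen f : tabb la f -> E (fun i => s ^ content (f i)) (u f).
Proof. by move=> hf i; apply: cherednik_base. Qed.

Let E_exists v sg : word la v sg -> exists f, f != 0 /\ E (word_wt s q v sg) f.
Proof.
move=> hw; have [f [f0 Ef _]] := eigen_exists N_gt0 la_part s0 q0 qs_inj E_ext E_intertwine quad
  E_raise raise_eq0 deg_le_T deg_le_raise deg_leD deg_leZ deg_leW u_eigen u_neq0 u_deg hw.
by exists f.
Qed.

Let E_line v sg f e : word la v sg -> E (word_wt s q v sg) f ->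
  E (word_wt s q v sg) e -> e != 0 -> exists c, f = c *: e.
Proof.
exact: (eigen_line N_gt0 la_part s0 q0 qs_inj E_ext EZ EB E_indep E_intertwine quad E_raise raise_eq0
  deg_le_T deg_le_raise deg_leD deg_leZ deg_leW deg_ex u_eigen u_neq0 u_deg
  idx_word idx_deg idx_inj idx_surj coordP coord_inj).
Qed.

Let E_weight z f : E z f -> f != 0 -> exists v sg, word la v sg /\ z =1 word_wt s q v sg.
Proof.
exact: (eigen_weight N_gt0 la_part s0 q0 qs_inj E_ext EZ E_indep E_intertwine quad E_raise raise_eq0
  deg_le_T deg_le_raise deg_leD deg_leZ deg_leW deg_ex u_eigen u_neq0 u_deg
  idx_word idx_deg idx_inj coordP coord_inj).
Qed.

Variable Tf : nat -> nat -> nat.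
Hypothesis T_incr : weakly_increasing la Tf.
Local Notation adm := (admissible (N := N) la Tf).
Local Notation weight := (wt (N := N) s q Tf).

(** M_T in terms of words: any vector of a joint eigenspace is allowed as a summand, and each
    eigenspace is a line by [E_line]. *)
Inductive eigen_span : M -> Prop :=
| eigen_span0 : eigen_span 0
| eigen_spanD sg f g : adm sg -> E (weight sg) f -> eigen_span g -> eigen_span (f + g).

Let good_basis (e : filling -> M) (off : filling -> 'I_N -> 'I_N -> F) :=
  [/\ forall sg, adm sg -> E (weight sg) (e sg), forall sg, adm sg -> e sg != 0,
   forall sg (a b : 'I_N), b = a.+1 :> nat -> adm sg ->
     T a (e sg) = diag_coef s q Tf sg a b *: e sg
       + (if adm (swap_word a b sg) then off sg a b *: e (swap_word a b sg) else 0) &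
   forall sg (a b : 'I_N), b = a.+1 :> nat -> adm sg -> adm (swap_word a b sg) -> off sg a b != 0].

Let good_basis_exists : exists e off, good_basis e off.
Proof.
have /fin_all_exists [e he] (sg : filling) : exists f, adm sg -> f != 0 /\ E (weight sg) f.
  by have [/E_exists[f hf]|nsg] := boolP (adm sg); [exists f|exists 0].
have /fin_all_exists [off hoff] (y : filling * ('I_N * 'I_N)) : exists c : F,
    y.2.2 = y.2.1.+1 :> nat -> adm y.1 ->
    T y.2.1 (e y.1) = diag_coef s q Tf y.1 y.2.1 y.2.2 *: e y.1 +
      (if adm (swap_word y.2.1 y.2.2 y.1) then c *: e (swap_word y.2.1 y.2.2 y.1) else 0) /\
    (adm (swap_word y.2.1 y.2.2 y.1) -> c != 0).
  case: y => sg [a b] /=; have [/eqP hb|hb] := boolP ((b : nat) == a.+1); last first.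
    by exists 0 => /eqP h; rewrite h in hb.
  have [hs|hs] := boolP (adm sg); last by exists 0.
  have [e0 Ee] := he sg hs.
  have [|c hc] := eigen_action (e' := e (swap_word a b sg)) N_gt0 la_part s0 q0 qs_inj quad E_ext E_intertwine E_line E_weight
    hb hs Ee e0; last by exists c.
  by move=> /he [].
exists e, (fun sg a b => off (sg, (a, b))); split.
- by move=> sg /he [].
- by move=> sg /he [].
- by move=> sg a b hb hs; have [] := hoff (sg, (a, b)) hb hs.
by move=> sg a b hb hs hs'; have [_] := hoff (sg, (a, b)) hb hs; apply.
Qed.

Let span_vecE e off f : good_basis e off -> eigen_span f -> exists c, f = span_vec la Tf e c.
Proof.
case=> e_eigen e_neq0 _ _; elim=> [|sg {}f g hs Ef _ [c ->]].
  by exists (fun=> 0); rewrite /span_vec big1 // => sg _; rewrite scale0r.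
have [r ->] := E_line hs Ef (e_eigen sg hs) (e_neq0 sg hs).
exists (fun tu => r * (tu == sg)%:R + c tu); rewrite span_vecP; congr (_ *: _ + _).
rewrite /span_vec (bigD1 sg) //= eqxx scale1r big1 ?addr0 // => tu /andP[_ /negPf ->].
by rewrite scale0r.
Qed.

Let span_vec_eigen e off c : good_basis e off -> eigen_span (span_vec la Tf e c).
Proof.
case=> e_eigen _ _ _; rewrite /span_vec; elim/big_rec: _ => [|sg g hs hg].
  exact: eigen_span0.
by apply: eigen_spanD hg; last exact/EZ/e_eigen.
Qed.

Lemma antisym_span_line : row_strict la Tf -> exists f0, [/\ eigen_span f0, antisym_below T N f0,
  f0 != 0 & forall f, eigen_span f -> antisym_below T N f -> exists c, f = c *: f0].
Proof.
move=> hT; have [e [off hg]] := good_basis_exists; have [h1 h2 h3 h4] := hg.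
have [tu [ht _]] := admissible_reading la_part T_incr.
have rs (c d : 'I_N * 'I_N) : in_shape la d -> c.1 = d.1 -> (c.2 < d.2)%N ->
    (Tf c.1 c.2 < Tf d.1 d.2)%N by move=> hd -> h; apply: hT.
have [c0 [hc0 [sg hs c00]]] := antisym_exists N_gt0 la_part s0 q0 qs_inj quad braid far EZ E_indep
  h1 h2 h3 h4 s_neqN1 rs ht.
exists (span_vec la Tf e c0); split=> //.
- exact: span_vec_eigen hg.
- apply: contraNneq c00 => sv0.
  apply/eqP/(span_vec_inj la_part qs_inj EZ E_indep h1 h2 (d := fun=> 0) _ hs).
  by rewrite sv0 /span_vec big1 // => ? _; rewrite scale0r.
move=> f /(span_vecE hg) [c ->] hc.
exact: (antisym_line N_gt0 la_part s0 q0 qs_inj EZ E_indep h1 h2 h3 h4 hc hc0 hs c00).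
Qed.

(** Strictness need only be checked between neighbours. Equal neighbours would be consecutive in the
    reading word, where [antisym_row_adjacent] forces the vector to vanish. *)
Lemma antisym_span_row_strict f : eigen_span f -> antisym_below T N f -> f != 0 -> row_strict la Tf.
Proof.
have [e [off hg]] := good_basis_exists; have [h1 h2 h3 h4] := hg.
move=> /(span_vecE hg) [c0 ->] hc f0.
have adj r c : is_cell la r c.+1 -> (Tf r c < Tf r c.+1)%N.
  move=> hd; have [t1 _] := T_incr; have := t1 r c c.+1 (leqnSn c) hd.
  rewrite leq_eqVlt => /orP[/eqP er|//]; case/negP: f0; apply/eqP.
  have [sg [hs hadj]] := admissible_reading la_part T_incr.
  have /andP[rN cN] := is_cell_bound la_part hd.
  have hd' : is_cell la r c := is_cell_le la_part hd (leqnn _) (leqnSn _).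
  have [a ha] := word_surj la_part hs (hd : in_shape la (Ordinal rN, Ordinal cN)).
  have [b hb] := word_surj la_part hs (hd' : in_shape la (Ordinal rN, Ordinal (ltnW cN))).
  have hba : b = a.+1 :> nat by apply: hadj; rewrite ha hb.
  apply: (antisym_row_adjacent N_gt0 la_part s0 q0 qs_inj EZ E_indep h1 h2 h3 h4 s_neqN1 hba hc hs).
    by rewrite !ffunE ha hb /= er.
  by rewrite ha hb.
move=> r c c' lt hc'; have [t1 _] := T_incr; apply: leq_trans (adj r c _) (t1 _ _ _ lt hc').
exact: (is_cell_le la_part hc' (leqnn r) lt).
Qed.

End Synthesis.

(** * The module M_lambda *)

Section ConstantVectors.

Variables (F : fieldType) (V M : lmodType F) (s : F) (N : nat).
Variables (t : nat -> {linear V -> V}) (T : nat -> {linear M -> M}) (w : M -> M) (iota : {linear V -> M}).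
Hypothesis T_iota : forall i v, (i.+1 < N)%N -> T i (iota v) = iota (t i v).
Hypothesis w_iota : forall v, w (iota v) = iota (foldl (fun u k => t k u) v (seq.iota 0 N.-1)).

Lemma downT_const i v : (i < N)%N -> exists v', downT s T i (iota v) = iota v'.
Proof.
elim: i v => [|i IH] v hi; first by exists v.
have [v' hv'] := IH (s^-1 *: (t i v + (1 - s) *: v)) (ltnW hi).
exists v'; rewrite downT_step -hv'; congr (downT _ _ _ _).
by rewrite /Tinv T_iota // [RHS]linearZ; congr (_ *: _); rewrite [RHS]linearD [iota (_ *: _)]linearZ.
Qed.

(** [downT] maps constants to constants, where [w] acts as the product of all [T k]. *)
Lemma w_const v : (0 < N)%N ->
  w (downT s T N.-1 (iota v)) = foldl (fun g k => T k g) (downT s T N.-1 (iota v)) (seq.iota 0 N.-1).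
Proof.
move=> N0; have [|v' ->] := @downT_const N.-1 v; first by rewrite prednK.
rewrite w_iota; have : all (fun k => k.+1 < N)%N (seq.iota 0 N.-1).
  by apply/allP => k; rewrite mem_iota; clear -N0; lia.
elim: (seq.iota 0 N.-1) v' => //= k l IH v' /andP[hk hl].
by rewrite T_iota // IH.
Qed.

End ConstantVectors.

Section Macdonald.

Variables (N : nat) (la : seq nat).
Hypothesis N_gt1 : (1 < N)%N.
Hypothesis la_part : is_partition N la.
Local Notation Vect := {ffun Tab N la -> KK^o}.
Local Notation Mod := {ffun Tab N la -> {mpoly KK[N]}}.
Local Notation filling := {ffun 'I_N -> 'I_N * 'I_N}.
Local Notation composition := {ffun 'I_N -> nat}.

Definition base_vec (f : filling) : Mod := iotaM N la (tab_vec la f).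

Lemma const_tensor_eq0 (v : Vect) : const_tensor v = 0 -> v = 0.
Proof.
move=> h; apply/ffunP => t; have := congr1 (fun g : Mod => g t) h.
rewrite !ffunE => /eqP; rewrite scaler_eq0 oner_eq0 orbF => /eqP; exact.
Qed.

Lemma base_vec_neq0 f : tabb la f -> base_vec f != 0.
Proof.
by move=> /tab_vec_neq0 h; apply: contraNneq h => /const_tensor_eq0 ->.
Qed.

Lemma var_mul_eq0 (f : Mod) : var_mul N.-1 f = 0 -> f = 0.
Proof.
move=> h; apply/ffunP => t; have := congr1 (fun g : Mod => g t) h.
have hN : (N.-1 < N)%N by rewrite prednK // ltnW.
rewrite [X in X = _ -> _]ffunE (Xn_lt hN) [X in _ = X -> _]ffunE => /eqP; rewrite mulf_eq0 => /orP[|/eqP ->]; last by rewrite ffunE.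
by move=> /eqP /(congr1 (mcoeff U_(Ordinal hN)%MM)) /eqP; rewrite mcoeffX eqxx mcoeff0 oner_eq0.
Qed.

Lemma TM_base f (a b : 'I_N) : b = a.+1 :> nat -> tabb la f ->
  TM N la a (base_vec f) = coefA (content (f b) - content (f a)) *: base_vec f
    + coefO (content (f b) - content (f a)) *: base_vec (swap_word a b f).
Proof.
move=> hb hf; rewrite /base_vec TM_iota -?hb // (heckeV_tab la_part hb hf : TV _ _ _ _ = _).
by rewrite [LHS]linearD ![iotaM _ _ (_ *: _)]linearZ.
Qed.

Lemma content_last f (a : 'I_N) : a = N.-1 :> nat -> tabb la f -> content (f a) = 0.
Proof.
rewrite tabb_word => ea hf; have [_ hc _] := wordP _ _ _ hf.
have N0 : (0 < N)%N := ltnW N_gt1; pose o : 'I_N := Ordinal N0.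
have [j hj] : exists j, f j = (o, o) by apply: (word_surj la_part hf); apply: (in_shape_le la_part (hc a)).
have [eja|ja] := eqVneq j a; first by rewrite -eja hj.
have := word_le la_part hf ja; rewrite hj /= => /(_ isT isT).
rewrite /before !ffunE /= ea; have := ltn_ord j; clear; lia.
Qed.

(** A monomial with a tableau names a coefficient of a vector, and its exponents with the same
    tableau name a word. This double role is the dimension count behind [eigenbasis]. *)
Definition graded_index d : finType := ('X_{1..N < d.+1} * Tab N la)%type.
Definition mnm_comp (m : 'X_{1..N}) : composition := [ffun i => m i].
Definition index_word d (y : graded_index d) : composition * filling :=
  (mnm_comp (bmnm y.1), tab_word (mnm_comp (bmnm y.1)) y.2).
Definition mod_coef d (y : graded_index d) (f : Mod) : KK := (f y.2)@_(bmnm y.1).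

Lemma comp_sum_mnm (m : 'X_{1..N}) : comp_sum (mnm_comp m) = mdeg m.
Proof. by rewrite mdegE; apply: eq_bigr => i _; rewrite ffunE. Qed.

Lemma index_word_deg d (y : graded_index d) : (comp_sum (index_word y).1 <= d)%N.
Proof. by rewrite comp_sum_mnm -ltnS; case: y => -[m hm] t. Qed.

Lemma index_word_inj d : injective (@index_word d).
Proof.
move=> [m t] [m' t'] [em et].
have e : m = m'.
  apply: val_inj; apply/mnmP => i.
  by have := congr1 (fun v : composition => v i) em; rewrite !ffunE.
by rewrite e in et *; rewrite (tab_word_inj et).
Qed.

Lemma index_word_surj d v sg : word la v sg -> (comp_sum v <= d)%N ->
  exists y : graded_index d, index_word y = (v, sg).
Proof.
move=> /word_tab [t <-] hd; pose m := [multinom v i | i < N].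
have mv : mnm_comp m = v by apply/ffunP => i; rewrite ffunE mnmE.
have hm : (mdeg m < d.+1)%N by rewrite -comp_sum_mnm mv ltnS.
by exists (BMultinom hm, t); rewrite /index_word /= mv.
Qed.

Lemma mod_coef_linear d (y : graded_index d) c (f g : Mod) :
  mod_coef y (c *: f + g) = c * mod_coef y f + mod_coef y g.
Proof. by rewrite /mod_coef ffunE mcoeffD ffunE mcoeffZ. Qed.

Lemma mod_coef_inj d (f : Mod) : mod_degree_le d f ->
  (forall y : graded_index d, mod_coef y f = 0) -> f = 0.
Proof.
move=> hf h; apply/ffunP => t; rewrite ffunE; apply/mpolyP => m; rewrite mcoeff0.
have [hm|hm] := ltnP (mdeg m) d.+1; first exact: (h (BMultinom hm, t)).
by apply: memN_msupp_eq0; apply: msize_mdeg_ge; apply: leq_trans (hf t) hm.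
Qed.

Lemma mod_degree_ex (f : Mod) : exists d, mod_degree_le d f.
Proof.
exists (\max_t msize (f t)) => t; apply: leqW; exact: (leq_bigmax (F := fun t => msize (f t))).
Qed.

Lemma mod_degreeW d d' (f : Mod) : (d <= d')%N -> mod_degree_le d f -> mod_degree_le d' f.
Proof. by move=> hd hf t; apply: leq_trans (hf t) _. Qed.

Lemma mod_degreeD d (f g : Mod) : mod_degree_le d f -> mod_degree_le d g -> mod_degree_le d (f + g).
Proof. by move=> hf hg t; rewrite ffunE; apply: degree_leD. Qed.

Lemma mod_degreeZ d c (f : Mod) : mod_degree_le d f -> mod_degree_le d (c *: f).
Proof. by move=> hf t; rewrite ffunE; apply: degree_leZ. Qed.

End Macdonald.

Section Main.

Variables (N : nat) (la : seq nat) (Tf : nat -> nat -> nat).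
Hypothesis N_gt1 : (1 < N)%N.
Hypothesis la_part : is_partition N la.
Hypothesis T_incr : weakly_increasing la Tf.
Local Notation Mod := {ffun Tab N la -> {mpoly KK[N]}}.
Local Notation T := (TM N la).
Local Notation w := (WM N la).
Local Notation span := (eigen_span ss qq N la T w Tf).

Lemma eigenP_joint v t (f : Mod) : eigenP v t f <-> joint_eigen ss T w (word_wt ss qq v (tab_word v t)) f.
Proof. by split=> h i; have := h i; rewrite /word_wt CT_rv. Qed.

(** A pair with the prescribed filling yields an admissible word by [fill_eqP]; conversely each
    admissible word comes from a tableau by [word_tab]. *)
Lemma inMT_span (f : Mod) : inMT Tf f <-> span f.
Proof.
split=> [[l [hl ->]]|].
  elim: l hl => [|y l IH] hl; first by rewrite big_nil; apply: eigen_span0.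
  have [/fill_eqP hv /eigenP_joint hy] := hl y (or_introl (erefl y)).
  rewrite big_cons; apply: (eigen_spanD (sg := tab_word y.1.1 y.1.2)).
  - by rewrite /admissible hv; apply: tab_word_word.
  - by rewrite /wt hv.
  by apply: IH => y' hy'; apply: hl; right.
elim=> [|sg {}f g hs hf _ [l [hl ->]]]; first by exists [::]; rewrite big_nil.
have [t ht] := word_tab hs; exists ((level Tf sg, t, f) :: l); split; last by rewrite big_cons.
move=> y [<-|]; last exact: hl.
split; first by apply/fill_eqP; rewrite ht.
by apply/eigenP_joint; rewrite ht.
Qed.

Let x_inj (f : Mod) : XM N la N.-1 f = 0 -> f = 0.
Proof. exact: var_mul_eq0. Qed.

Let content_gap f (a b : 'I_N) : b = a.+1 :> nat -> tabb la f -> content (f b) - content (f a) != 0.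
Proof. exact: gap_neq0. Qed.

Let base_swap f (a b : 'I_N) : b = a.+1 :> nat -> tabb la f ->
  coefO (content (f b) - content (f a)) != 0 -> tabb la (swap_word a b f).
Proof. exact: tabb_swap. Qed.

Let w_base f : tabb la f -> w (downT ss T N.-1 (base_vec la f)) =
  foldl (fun g k => T k g) (downT ss T N.-1 (base_vec la f)) (iota 0 N.-1).
Proof.
move=> _; exact: (w_const ss (fun i v => @TM_iota N la i v) (@WM_iota N la) _ (ltnW N_gt1)).
Qed.

Let deg_T i d (f : Mod) : (i.+1 < N)%N -> mod_degree_le d f -> mod_degree_le d (T i f).
Proof. exact: heckeM_degree. Qed.

Let deg_w d (f : Mod) : mod_degree_le d f -> mod_degree_le d (w f).
Proof. exact: wM_degree. Qed.

Let deg_x d (f : Mod) : mod_degree_le d f -> mod_degree_le d.+1 (XM N la N.-1 f).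
Proof. exact: var_mul_degree. Qed.

Let deg_base f : tabb la f -> mod_degree_le 0 (base_vec la f : Mod).
Proof. move=> _; exact: const_tensor_degree. Qed.

Let index_word_word d (y : graded_index N la d) : word la (index_word y).1 (index_word y).2.
Proof. exact: tab_word_word. Qed.

Lemma antisym_in_MT : row_strict la Tf -> exists f0, [/\ span f0, antisym_below T N f0,
  f0 != 0 & forall f, span f -> antisym_below T N f -> exists c, f = c *: f0].
Proof.
exact: (antisym_span_line N_gt1 la_part ss_neq0 qq_neq0 ss_neqN1 (@qq_ss_inj) (TM_quad la_part)
  (TM_braid N_gt1 la_part) (TM_far N_gt1 la_part) (WM_T N_gt1 la_part) (WM_WM_T N_gt1 la_part)
  (@TM_X N la) (@TM_X_far N la) (WM_X0 N_gt1) (@WM_XS N la) x_inj (@base_vec_neq0 N la) coefA_ratio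
  (TM_base la_part) base_swap content_gap (content_last N_gt1 la_part) w_base
  deg_T deg_w deg_x (@mod_degreeD N la) (@mod_degreeZ N la) (@mod_degreeW N la) (@mod_degree_ex N la)
  deg_base index_word_word (@index_word_deg N la) (@index_word_inj N la) (@index_word_surj N la)
  (@mod_coef_linear N la) (@mod_coef_inj N la) T_incr).
Qed.

Lemma antisym_in_MT_row_strict f : span f -> antisym_below T N f -> f != 0 -> row_strict la Tf.
Proof.
exact: (antisym_span_row_strict N_gt1 la_part ss_neq0 qq_neq0 ss_neqN1 (@qq_ss_inj) (TM_quad la_part)
  (TM_braid N_gt1 la_part) (TM_far N_gt1 la_part) (WM_T N_gt1 la_part) (WM_WM_T N_gt1 la_part)
  (@TM_X N la) (@TM_X_far N la) (WM_X0 N_gt1) (@WM_XS N la) x_inj (@base_vec_neq0 N la) coefA_ratio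
  (TM_base la_part) base_swap content_gap (content_last N_gt1 la_part) w_base
  deg_T deg_w deg_x (@mod_degreeD N la) (@mod_degreeZ N la) (@mod_degreeW N la) (@mod_degree_ex N la)
  deg_base index_word_word (@index_word_deg N la) (@index_word_inj N la) (@index_word_surj N la)
  (@mod_coef_linear N la) (@mod_coef_inj N la) T_incr).
Qed.

End Main.

Theorem theorem5p6 (N : nat) (la : seq nat) (T : nat -> nat -> nat) :
  (2 <= N)%N -> is_partition N la -> weakly_increasing la T ->
  (row_strict la T ->
     exists f0 : {ffun Tab N la -> {mpoly KK[N]}},
       [/\ inMT T f0, antisym f0, f0 != 0 &
           forall f : {ffun Tab N la -> {mpoly KK[N]}},
             inMT T f -> antisym f -> exists c : KK, f = c *: f0]) /\
  (~ row_strict la T ->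
     forall f : {ffun Tab N la -> {mpoly KK[N]}}, inMT T f -> antisym f -> f = 0).
Proof.
move=> N_gt1 la_part T_incr; split=> [strictT|nstrict f /inMT_span hf anti].
  have [f0 [h1 h2 h3 h4]] := antisym_in_MT N_gt1 la_part T_incr strictT.
  exists f0; split=> //; first exact/inMT_span.
  by move=> f /inMT_span hf anti; apply: h4.
apply/eqP/negPn/negP => f_neq0; apply: nstrict.
exact: (antisym_in_MT_row_strict N_gt1 la_part T_incr hf anti f_neq0).
Qed.
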